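(* Let $\alpha\in[1,2)$, let $d>1$, let $m\ge2$ and $k\ge3$ be integers, and let $r\in(0,1)$. There exists $\varepsilon_0>0$ such that the following holds for every $\varepsilon\in(0,\varepsilon_0)$. Let $f\in V^r$ and $R(x)=1+\varepsilon^{1+\alpha}f(x)$, and suppose that $R$ is a solution of the co-rotating contour equation (CR) for some $\Omega\in\mathbb R$, or of the travelling contour equation (TR) for some $W\in\mathbb R$. Then $R\in C^\infty$, and $R$ parameterizes a convex patch, i.e. the domain with boundary $x\mapsto(\varepsilon R(x)\cos x,\varepsilon R(x)\sin x)$, $x\in[0,2\pi)$, is convex.
   Context: Notation: $C_\alpha=\frac{\Gamma(\alpha/2)}{2^{1-\alpha}\Gamma(\frac{2-\alpha}{2})}$; $Q_\theta$ is the counterclockwise rotation of angle $\theta$ about the origin; $\boldsymbol z(x)=(\varepsilon R(x)\cos x,\varepsilon R(x)\sin x)$; $H^s$ is the Sobolev space of $2\pi$-periodic functions. Function spaces: $X^{s}=\{g\in H^s: g(x)=\sum_{j=2}^\infty a_j\cos(jx)\}$ and $$X^k_{\log}=\left\{g\in X^k:\ \left\|\int_0^{2\pi}\frac{\partial^kg(x-y)-\partial^kg(x)}{|\sin(\frac y2)|}dy\right\|_{L^2}<\infty\right\},$$ normed by the $H^k$ norm plus the displayed $L^2$ norm. $V^r$ is the open ball of radius $r$ centered at $0$ in $X^k_{\log}$ if $\alpha=1$, and in $X^{k+\alpha-1}$ if $1<\alpha<2$. Write $$N_\theta(x,y)=(R(x)R(y)+R'(x)R'(y))\sin(x-y-\theta)+(R(x)R'(y)-R'(x)R(y))\cos(x-y-\theta),$$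 $$I(x)=\frac{C_\alpha}{\varepsilon^{1+\alpha}R(x)}\cdot\frac1{2\pi}\int_0^{2\pi}\frac{N_0(x,y)\,dy}{\left((R(x)-R(y))^2+4R(x)R(y)\sin^2\frac{x-y}2\right)^{\alpha/2}}.$$ Equation (CR), for all $x$: $$\Omega\left(\varepsilon R'(x)-\frac{dR'(x)\cos x}{R(x)}+d\sin x\right)+I(x)+\sum_{i=1}^{m-1}\frac{C_\alpha}{\varepsilon R(x)}\cdot\frac1{2\pi}\int_0^{2\pi}\frac{N_{2\pi i/m}(x,y)\,dy}{\left|(\boldsymbol z(x)-(d,0))-Q_{\frac{2\pi i}m}(\boldsymbol z(y)-(d,0))\right|^\alpha}=0.$$ Equation (TR), for all $x$: $$-W\left(\sin x-\frac{R'(x)}{R(x)}\cos x\right)+I(x)+\frac{C_\alpha}{\varepsilon R(x)}\cdot\frac1{2\pi}\int_0^{2\pi}\frac{N_0(x,y)\,dy}{\left|\boldsymbol z(x)+\boldsymbol z(y)-(2d,0)\right|^{\alpha}}=0.$$ *)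

(* Defs.v *)
From HB Require Import structures.
From mathcomp Require Import all_boot all_order all_algebra.
From mathcomp Require Import all_classical all_reals all_analysis.

Set Implicit Arguments.
Unset Strict Implicit.
Unset Printing Implicit Defensive.
Import Order.TTheory GRing.Theory Num.Theory.
Import numFieldNormedType.Exports.

Local Open Scope classical_set_scope.
Local Open Scope ring_scope.

Section Spaces.
Variable R : realType.
Implicit Types (f g h u phi : R -> R) (s r : R) (k : nat).

Local Notation leb := (@lebesgue_measure R).

Definition period : set R := `[0, 2 * pi].

Definition smooth f := forall (n : nat) (x : R), derivable (derive1n n f) x 1.

Definition L2norm f : \bar R := 'N[leb]_(2%:E)[EFin \o (f \_ period)]%E.

(* A measurable 2pi-periodic function, square integrable over a period. *)
Definition L2per f :=
  [/\ measurable_fun setT f, periodic f (2 * pi) & (L2norm f < +oo)%E].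

(* The n-th Fourier coefficient of f is fourier_re f n - i * fourier_im f n. *)
Definition fourier_re f (n : int) : R :=
  (2 * pi)^-1 * \int[leb]_(x in period) (f x * cos (n%:~R * x)).
Definition fourier_im f (n : int) : R :=
  (2 * pi)^-1 * \int[leb]_(x in period) (f x * sin (n%:~R * x)).

Definition Hnorm s f : \bar R :=
  ((esum [set: int] (fun n : int =>
     (((1 + (n%:~R) ^+ 2) `^ s)%R
       * (fourier_re f n ^+ 2 + fourier_im f n ^+ 2)%R)%:E)) `^ 2^-1)%E.

Definition HSobolev s : set (R -> R) :=
  [set f | L2per f /\ (Hnorm s f < +oo)%E].

(* The cosine series is an identity between elements of H^s, hence of L^2:
   its partial sums converge to g in L^2 over a period. *)
Definition Xspace s : set (R -> R) :=
  [set g | HSobolev s g /\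
    exists a : nat -> R,
      (fun N : nat =>
         L2norm (fun x => g x - \sum_(2 <= j < N) a j * cos (j%:R * x)))
        @ \oo --> 0%E].

(* h is the k-th derivative of the periodic function g, as an L^2 function. *)
Definition weak_derive k g h := L2per h /\
  forall phi, smooth phi -> periodic phi (2 * pi) ->
    \int[leb]_(x in period) (g x * derive1n k phi x)
    = (-1) ^+ k * \int[leb]_(x in period) (h x * phi x).

(* u(x) = \int_0^{2pi} (h(x - y) - h(x)) / |sin(y/2)| dy.  For h merely in L^2
   the integral need not converge absolutely; it is the L^2 limit of the
   integrals truncated near both zeros of sin(y/2), y = 0 and y = 2pi. *)
Definition log_truncated h (delta x : R) : R :=
  \int[leb]_(y in `[delta, 2 * pi - delta])
    ((h (x - y) - h x) / `| sin (y / 2) |).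

Definition log_integral h u := L2per u /\
  (fun delta : R => L2norm (fun x => log_truncated h delta x - u x))
    @ 0^'+ --> 0%E.

(* N is the X^k_log norm of g. *)
Definition Xlog_norm k g (N : \bar R) :=
  exists h u, [/\ weak_derive k g h, log_integral h u
                & N = (Hnorm k%:R g + L2norm u)%E].

Definition Xlog k : set (R -> R) :=
  [set g | Xspace k%:R g /\ exists N, Xlog_norm k g N].

Definition Vball (alpha : R) k r : set (R -> R) :=
  if alpha == 1 then
    [set f | Xlog k f /\ exists2 N, Xlog_norm k f N & (N < r%:E)%E]
  else
    [set f | Xspace (k%:R + alpha - 1) f
             /\ (Hnorm (k%:R + alpha - 1) f < r%:E)%E].

End Spaces.

Section Contour.
Variable R : realType.

Local Notation leb := (@lebesgue_measure R).
Local Notation plane := (R^o * R^o)%type.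

Definition Gamma (x : R) : R :=
  \int[leb]_(t in `]0, +oo[) (t `^ (x - 1) * expR (- t)).

Definition Calpha (alpha : R) : R :=
  Gamma (alpha / 2) / (2 `^ (1 - alpha) * Gamma ((2 - alpha) / 2)).

(* The norm of the product type in the library is the sup norm. *)
Definition enorm (p : plane) : R := Num.sqrt (p.1 ^+ 2 + p.2 ^+ 2).

Definition rotation (theta : R) (p : plane) : plane :=
  (cos theta * p.1 - sin theta * p.2, sin theta * p.1 + cos theta * p.2).

Variables (alpha eps d : R) (rho : R -> R).

Definition curve (x : R) : plane :=
  (eps * rho x * cos x, eps * rho x * sin x).

Definition Nker (theta x y : R) : R :=
  (rho x * rho y + derive1 rho x * derive1 rho y) * sin (x - y - theta)
  + (rho x * derive1 rho y - derive1 rho x * rho y) * cos (x - y - theta).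

Definition self_term (x : R) : R :=
  Calpha alpha / (eps `^ (1 + alpha) * rho x) *
  ((2 * pi)^-1 * \int[leb]_(y in `[0, 2 * pi])
     (Nker 0 x y /
      ((rho x - rho y) ^+ 2
       + 4 * rho x * rho y * sin ((x - y) / 2) ^+ 2) `^ (alpha / 2))).

Definition CR (m : nat) (Omega : R) := forall x : R,
  Omega * (eps * derive1 rho x - d * derive1 rho x * cos x / rho x + d * sin x)
  + self_term x
  + \sum_(1 <= i < m)
      Calpha alpha / (eps * rho x) *
      ((2 * pi)^-1 * \int[leb]_(y in `[0, 2 * pi])
         (Nker (2 * pi * i%:R / m%:R) x y /
          enorm ((curve x - (d, 0))
                 - rotation (2 * pi * i%:R / m%:R) (curve y - (d, 0)))
            `^ alpha))
  = 0.

Definition TR (W : R) := forall x : R,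
  - W * (sin x - derive1 rho x / rho x * cos x)
  + self_term x
  + Calpha alpha / (eps * rho x) *
    ((2 * pi)^-1 * \int[leb]_(y in `[0, 2 * pi])
       (Nker 0 x y / enorm (curve x + curve y - (2 * d, 0)) `^ alpha))
  = 0.

(* The boundary of an open set D is closure D `\` D. *)
Definition convex_patch :=
  exists D : set plane,
    [/\ [/\ open D, connected D & bounded_set D],
        closure D `\` D = curve @` `[0, 2 * pi[
      & @convex_set R plane D].

End Contour.

(* Main.v *)
Require Import Defs.
From mathcomp Require Import all_boot all_order all_algebra.
From mathcomp Require Import all_classical all_reals all_analysis.
From mathcomp Require Import measurable_realfun ring lra.

Import Order.TTheory GRing.Theory Num.Theory.
Import numFieldNormedType.Exports.

Local Open Scope classical_set_scope.
Local Open Scope ring_scope.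

(* Write [p] for [R'].  With [t = x - y], each contour equation reads
     int (p(x) - p(x - t)) kappa(x, t) / (2 sin (t/2))^alpha dt = G(x),
   where [kappa(x, 0) = 1] after multiplication by a positive function of [R] and
   [p], and where [kappa] and [G] are as regular in [x] as [p]: the other patches
   stay at a positive distance and only contribute smooth kernels.  The kernel
   is not integrable, so it is strongly coercive: evaluated at the maximum of a
   second difference of a derivative of [p], the equation bounds this second
   difference by [C |a| |h|].  Thus a Lipschitz derivative of [p] is [C^(1,1)],
   and the equation, differentiated once more, can be used again.  The induction
   starts because the Fourier coefficients [a_j] of [f] satisfy
   [sum j^(2+b) |a_j| <= 3] for some [b > alpha - 1], so that [f] is [C^(2,b)]
   with bounds that do not depend on [f].  These bounds also make [R] close to
   [1] in [C^2] for small [eps], hence [1/R] lies above all its tangent linear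
   forms and the patch is an intersection of half-planes. *)

(** * Classes of kernels *)

(** The second difference of [kappa] contains that of the top derivative [u] of [p], so the estimate
    at the maximum gives back the unknown bound [A] on it. It closes because 1/chord has an infinite
    integral, though only logarithmically so when [alpha = 1]: the coercivity constant can be taken
    larger than twice the coefficient of [A], and [A] improves to [A/2 + B]. A Lipschitz [u]
    provides a finite initial [A] only for each fixed step [h], namely [2L/|h|]; hence bounds
    indexed by the step, whose dependence on [h] disappears under iteration.

    Products of a first increment of the difference quotient of [u] and a first increment of [kappa]
    cannot be absorbed in this way, and the Lipschitz bound alone would leave the non-integrable
    [chord^(-alpha)]. At the first gain the Hoelder exponent [b] of [p'] pays for them: the weight
    becomes [chord^(-(alpha - b))], integrable since [b > alpha - 1]. Afterwards [kappa] is regular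
    enough for its increments to vanish like the chord; the normalization [kappa(x, 0) = 1] serves
    this purpose. *)

Section calculus.
Context {R : realType}.
Implicit Types (f g : R -> R) (x y h c C : R).

Lemma mean_value f f' : (forall x, is_derive x 1 f (f' x)) ->
  forall x y, exists c, f y - f x = f' c * (y - x).
Proof.
move=> df x y.
have cf : continuous f.
  by move=> z; apply: differentiable_continuous; apply/derivable1_diffP.
have [xy|yx|->] := ltgtP x y; last by exists y; rewrite !subrr mulr0.
  have [|c _ ->] := @MVT R f f' x y xy (fun z _ => df z); last by exists c.
  exact: continuous_subspaceT.
have [|c _ e] := @MVT R f f' y x yx (fun z _ => df z); last first.
  by exists c; rewrite -[LHS]opprB e -mulrN opprB.
exact: continuous_subspaceT.
Qed.

Lemma is_derive_continuous f f' : (forall x, is_derive x 1 f (f' x)) -> continuous f.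
Proof. by move=> df z; apply: differentiable_continuous; apply/derivable1_diffP. Qed.

Lemma derive_bound_lipschitz f f' C : (forall x, is_derive x 1 f (f' x)) ->
  (forall x, `|f' x| <= C) -> forall x h, `|f (x + h) - f x| <= C * `|h|.
Proof.
move=> df bf x h; have [c ->] := mean_value _ _ df x (x + h).
by rewrite addrAC subrr add0r normrM ler_wpM2r.
Qed.

Lemma is_derive_shift_arg f df x h : is_derive (x + h) 1 f df ->
  is_derive x 1 (fun z => f (z + h)) df.
Proof.
move=> d; rewrite -[df]mulr1; apply: (@is_derive1_comp R f (fun z => z + h)) => //.
by apply: is_derive_eq; rewrite addr0.
Qed.

Lemma continuous_measurable f : continuous f -> measurable_fun setT f.
Proof. exact: continuous_measurable_fun. Qed.

Lemma is_deriveDr f g x df dg : is_derive x 1 f df -> is_derive x 1 g dg ->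
  is_derive x 1 (fun z => f z + g z) (df + dg).
Proof. by move=> ? ?; apply: is_deriveD. Qed.

Lemma is_deriveBr f g x df dg : is_derive x 1 f df -> is_derive x 1 g dg ->
  is_derive x 1 (fun z => f z - g z) (df - dg).
Proof. by move=> ? ?; apply: is_deriveB. Qed.

Lemma is_deriveMr f g x df dg : is_derive x 1 f df -> is_derive x 1 g dg ->
  is_derive x 1 (fun z => f z * g z) (df * g x + f x * dg).
Proof.
move=> Hf Hg; have := @is_deriveM _ _ f g x 1 df dg Hf Hg.
by rewrite /GRing.scale /= addrC (mulrC (g x)).
Qed.

Lemma is_derive_powR f x df a : 0 < f x -> is_derive x 1 f df ->
  is_derive x 1 (fun z => f z `^ a) (a * f x `^ (a - 1) * df).
Proof.
move=> f0 d; apply: (@is_derive1_comp R (fun y => y `^ a) f) => //.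
have i : f x \in `]0, +oo[ by rewrite in_itv/= f0.
by apply: DeriveDef; [exact: derivable_powR|rewrite -derive1E powR_derive1].
Qed.

End calculus.

Section second_difference.
Context {R : realType}.
Implicit Types (k l : R -> R -> R) (f g : R -> R) (P : R -> R -> Prop).
Implicit Types (x t h a b C D A : R).

(** Symmetric in the two steps: it is read either as an increment of step [a] of an increment of
    step [b], or the other way round. *)
Definition diff2 f (a b x : R) := f (x + a + b) - f (x + a) - (f (x + b) - f x).

(* The class of kernels k(x,t) having n bounded derivatives in x, the last of
   which is Lipschitz in x with second differences controlled, for each h, by
   any A such that P h A.  The parameter P is instantiated with the bounds on
   the second differences of the top derivative of the unknown. *)
Fixpoint Ycls P (n : nat) k : Prop :=
  (forall x, measurable_fun setT (k x)) /\
  match n with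
  | 0 => exists2 C : R, 0 <= C &
      [/\ forall x t, `|k x t| <= C,
          forall x h t, `|k (x + h) t - k x t| <= C * `|h|
        & forall h A, 0 <= A -> P h A -> forall x a t,
            `|diff2 (k ^~ t) a h x| <= C * (1 + A) * `|a| * `|h| ]
  | n'.+1 => (exists C, forall x t, `|k x t| <= C) /\
      exists2 k' : R -> R -> R,
        (forall x t : R, is_derive x (1 : R) (k ^~ t) (k' x t)) & Ycls P n' k'
  end.

Lemma Ycls_measurable P n k : Ycls P n k -> forall x, measurable_fun setT (k x).
Proof. by case: n => [|n] []. Qed.

Lemma Ycls_bounded P n k : Ycls P n k -> exists2 C, 0 <= C & forall x t, `|k x t| <= C.
Proof.
case: n => [|n] [_] []; first by move=> C C0 [? _ _]; exists C.
move=> [C bC] _; exists C => //.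
by rewrite (le_trans _ (bC 0 0)).
Qed.

Lemma Ycls_lipschitz P n k : Ycls P n k ->
  exists2 C, 0 <= C & forall x h t, `|k (x + h) t - k x t| <= C * `|h|.
Proof.
case: n => [|n] [_] []; first by move=> C C0 [_ ? _]; exists C.
move=> _ [k' dk /Ycls_bounded[C C0 bC]]; exists C => // x h t.
exact: (@derive_bound_lipschitz R (k ^~ t) (k' ^~ t)).
Qed.

(** It is the increment of step [a] of [f (z + b) - f z], whose derivative is at most [C |b|]. *)
Lemma diff2_le f f' C : (forall x, is_derive x 1 f (f' x)) ->
  (forall x h, `|f' (x + h) - f' x| <= C * `|h|) ->
  forall a b x, `|diff2 f a b x| <= C * `|a| * `|b|.
Proof.
move=> df lf a b x; rewrite /diff2.
pose g z := f (z + b) - f z.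
have dg (z : R) : is_derive z 1 g (f' (z + b) - f' z).
  by apply: is_deriveBr => //; exact: is_derive_shift_arg.
have := derive_bound_lipschitz _ _ (C * `|b|) dg (fun z => lf z b) x a.
by rewrite mulrAC.
Qed.

(** Only the lowest level needs an argument: one more derivative, itself Lipschitz, bounds the
    second differences outright, for every [A]. *)
Lemma Ycls_S P n k : Ycls P n.+1 k -> Ycls P n k.
Proof.
elim: n k => [|n IH] k [mk [[C bk] [k' dk Yk']]]; last first.
  by split=> //; split; [exists C|exists k' => //; exact: IH].
split=> //.
have [C1 C10 bk'] := Ycls_bounded P 0 k' Yk'.
have [C2 C20 lk'] := Ycls_lipschitz P 0 k' Yk'.
have C0 : 0 <= C by rewrite (le_trans _ (bk 0 0)).
exists (C + C1 + C2); first by rewrite !addr_ge0.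
split.
- by move=> x t; rewrite (le_trans (bk _ _))// -addrA lerDl addr_ge0.
- move=> x h t.
  have := derive_bound_lipschitz _ _ C1 (dk ^~ t) (bk' ^~ t) x h.
  by move/le_trans; apply; rewrite ler_wpM2r// addrAC lerDr addr_ge0.
- move=> h A A0 _ x a t.
  have := diff2_le _ _ C2 (dk ^~ t) (fun x h => lk' x h t) a h x.
  move/le_trans; apply; rewrite ler_wpM2r// ler_wpM2r//.
  rewrite mulrDr mulr1 -[leLHS]addr0 lerD ?mulr_ge0 ?addr_ge0//.
  by rewrite lerDr addr_ge0.
Qed.

Lemma Ycls_le P m n k : (m <= n)%N -> Ycls P n k -> Ycls P m k.
Proof.
move=> /subnK <-; elim: (n - m)%N => [|j IH]//.
by rewrite addSn => /Ycls_S.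
Qed.

Lemma YclsD P n k l : Ycls P n k -> Ycls P n l ->
  Ycls P n (fun x t => k x t + l x t).
Proof.
elim: n k l => [|n IH] k l [mk +] [ml +].
  move=> [C C0 [bk lk dk]] [D D0 [bl ll dl]].
  split; first by move=> x; exact: measurable_funD.
  exists (C + D); first exact: addr_ge0.
  split.
  - by move=> x t; rewrite (le_trans (ler_normD _ _))// lerD.
  - move=> x h t; rewrite opprD addrACA mulrDl (le_trans (ler_normD _ _))//.
    by rewrite lerD.
  - move=> h A A0 PA x a t.
    have -> : diff2 (fun x => k x t + l x t) a h x =
      diff2 (k ^~ t) a h x + diff2 (l ^~ t) a h x by rewrite /diff2; ring.
    by rewrite (le_trans (ler_normD _ _))// !mulrDl lerD ?dk ?dl.
move=> [[C bk] [k' dk Yk']] [[D bl] [l' dl Yl']].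
split; first by move=> x; exact: measurable_funD.
split; first by exists (C + D) => x t; rewrite (le_trans (ler_normD _ _))// lerD.
exists (fun x t => k' x t + l' x t); last exact: IH.
by move=> x t; exact: is_deriveDr.
Qed.

Lemma ler_prod_norm (a b c d : R) : `|a| <= c -> `|b| <= d -> `|a * b| <= c * d.
Proof. by move=> ac bd; rewrite normrM ler_pM. Qed.

(** Discrete Leibniz rule. The two middle terms are products of first increments, so [A] enters the
    bound of [YclsM] only linearly. *)
Lemma diff2M f g a h x : diff2 (fun z => f z * g z) a h x =
  diff2 f a h x * g x + (f (x + a + h) - f (x + a)) * (g (x + a) - g x)
  + (f (x + h + a) - f (x + h)) * (g (x + h) - g x)
  + f (x + a + h) * diff2 g a h x.
Proof. by rewrite /diff2 (addrAC x h a); ring. Qed.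

Lemma YclsM P n k l : Ycls P n k -> Ycls P n l ->
  Ycls P n (fun x t => k x t * l x t).
Proof.
elim: n k l => [|n IH] k l Yk Yl.
  move: Yk Yl => [mk [C C0 [bk lk dk]]] [ml [D D0 [bl ll dl]]].
  split; first by move=> x; exact: measurable_funM.
  have CD : 0 <= C * D by rewrite mulr_ge0.
  exists (4 * (C * D)); first by rewrite mulr_ge0.
  split.
  - move=> x t; rewrite (le_trans (ler_prod_norm _ _ _ _ (bk _ _) (bl _ _)))//.
    by rewrite ler_peMl// ler1n.
  - move=> x h t.
    have -> : k (x + h) t * l (x + h) t - k x t * l x t =
      (k (x + h) t - k x t) * l (x + h) t + k x t * (l (x + h) t - l x t) by ring.
    rewrite (le_trans (ler_normD _ _))//.
    have := ler_prod_norm _ _ _ _ (lk x h t) (bl (x + h) t).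
    have := ler_prod_norm _ _ _ _ (bk x t) (ll x h t).
    have := mulr_ge0 CD (normr_ge0 h); lra.
  - move=> h A A0 PA x a t; rewrite diff2M.
    have e1 := ler_prod_norm _ _ _ _ (dk h A A0 PA x a t) (bl x t).
    have e2 := ler_prod_norm _ _ _ _ (lk (x + a) h t) (ll x a t).
    have e3 := ler_prod_norm _ _ _ _ (lk (x + h) a t) (ll x h t).
    have e4 := ler_prod_norm _ _ _ _ (bk (x + a + h) t) (dl h A A0 PA x a t).
    do 3 rewrite (le_trans (ler_normD _ _))// -lerBrDr.
    have p0 : 0 <= C * D * `|a| * `|h| by rewrite !mulr_ge0.
    have p1 : 0 <= C * D * `|a| * `|h| * A by rewrite mulr_ge0.
    lra.
have [C C0 bk] := Ycls_bounded _ _ _ Yk.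
have [D D0 bl] := Ycls_bounded _ _ _ Yl.
have Yk1 := Ycls_S _ _ _ Yk; have Yl1 := Ycls_S _ _ _ Yl.
move: Yk Yl => [mk [_ [k' dk Yk']]] [ml [_ [l' dl Yl']]].
split; first by move=> x; exact: measurable_funM.
split; first by exists (C * D) => x t; exact: ler_prod_norm.
exists (fun x t => k' x t * l x t + k x t * l' x t).
  by move=> x t; exact: is_deriveMr.
by apply: YclsD; exact: IH.
Qed.

Lemma Ycls_cst P n (w : R -> R) C : measurable_fun setT w -> (forall t, `|w t| <= C) ->
  Ycls P n (fun _ t => w t).
Proof.
move=> mw bw.
have C0 : 0 <= C by rewrite (le_trans _ (bw 0)).
elim: n w C C0 mw bw => [|n IH] w C C0 mw bw.
  split=> //; exists C => //; split=> //.
    by move=> x h t; rewrite subrr normr0 mulr_ge0.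
  move=> h A A0 _ x a t; rewrite /diff2 !subrr normr0 !mulr_ge0//.
  by rewrite addr_ge0.
split=> //; split; first by exists C.
exists (fun _ _ => 0); first by move=> x t; exact: is_derive_cst.
by apply: (IH _ 0) => // t; rewrite normr0.
Qed.

Lemma YclsC P n (c : R) : Ycls P n (fun _ _ => c).
Proof. exact: (@Ycls_cst _ _ (fun=> c) `|c|). Qed.

Lemma YclsN P n k : Ycls P n k -> Ycls P n (fun x t => - k x t).
Proof.
move=> Yk; have -> : (fun x t => - k x t) = (fun x t => -1 * k x t).
  by apply/funext => x; apply/funext => t; rewrite mulN1r.
by apply: YclsM => //; exact: YclsC.
Qed.

Lemma YclsB P n k l : Ycls P n k -> Ycls P n l ->
  Ycls P n (fun x t => k x t - l x t).
Proof. by move=> Yk Yl; apply: YclsD => //; exact: YclsN. Qed.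

(** The angles of [Nker] have this shape, with [w y = - y - th]. Sine and cosine go together, since
    up to sign each is the derivative of the other. *)
Lemma Ycls_sincos P n (w : R -> R) : measurable_fun setT w ->
  Ycls P n (fun x t => sin (x + w t)) /\ Ycls P n (fun x t => cos (x + w t)).
Proof.
move=> mw.
have ms x : measurable_fun setT (fun t => sin (x + w t)).
  apply: (measurableT_comp (continuous_measurable sin (@continuous_sin R))).
  exact: measurable_funD.
have mc x : measurable_fun setT (fun t => cos (x + w t)).
  apply: (measurableT_comp (continuous_measurable cos (@continuous_cos R))).
  exact: measurable_funD.
have ds x t : is_derive x 1 (fun x => sin (x + w t)) (cos (x + w t)).
  exact: (is_derive_shift_arg sin).
have dc x t : is_derive x 1 (fun x => cos (x + w t)) (- sin (x + w t)).
  exact: (is_derive_shift_arg cos).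
elim: n => [|n [IHs IHc]].
  suff H : Ycls P 1 (fun x t => sin (x + w t)) /\ Ycls P 1 (fun x t => cos (x + w t)).
    by split; apply: Ycls_S; apply H.
  have H0 : Ycls P 0 (fun x t => sin (x + w t)) /\ Ycls P 0 (fun x t => cos (x + w t)).
    have ls x h t : `|sin (x + h + w t) - sin (x + w t)| <= 1 * `|h|.
      by apply: (derive_bound_lipschitz (fun x => sin (x + w t))) => // y; exact: cos_max.
    have lc x h t : `|cos (x + h + w t) - cos (x + w t)| <= 1 * `|h|.
      apply: (derive_bound_lipschitz (fun x => cos (x + w t)))  => // y.
      by rewrite normrN sin_max.
    split; split=> //; exists 1 => //; split=> //.
    - by move=> *; exact: sin_max.
    - move=> h A A0 _ x a t.
      have := diff2_le (fun x => sin (x + w t)) _ 1 (ds ^~ t) (fun x h => lc x h t) a h x.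
      by move/le_trans; apply; rewrite !ler_wpM2r// ler_peMr// lerDl.
    - by move=> *; exact: cos_max.
    - move=> h A A0 _ x a t.
      have := diff2_le (fun x => cos (x + w t)) _ 1 (dc ^~ t) _ a h x.
      move=> H; have {}H := H _.
      have /H : forall x h, `|- sin (x + h + w t) - - sin (x + w t)| <= 1 * `|h|.
        by move=> y b; rewrite -opprD normrN.
      by move/le_trans; apply; rewrite !ler_wpM2r// ler_peMr// lerDl.
  split; (split; first by []); (split; first by exists 1 => *; rewrite ?sin_max ?cos_max).
    by exists (fun x t => cos (x + w t)) => //; exact: H0.2.
  by exists (fun x t => - sin (x + w t)) => //; apply: YclsN; exact: H0.1.
split; (split; first by []); (split; first by exists 1 => *; rewrite ?sin_max ?cos_max).
  by exists (fun x t => cos (x + w t)).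
by exists (fun x t => - sin (x + w t)) => //; exact: YclsN.
Qed.

End second_difference.

(** * Real powers of kernels bounded away from zero *)

Section powers.
Context {R : realType}.
Implicit Types (k l : R -> R -> R) (f g : R -> R) (P : R -> R -> Prop).
Implicit Types (x y z t h a b C D A lo hi : R).

(** The power increases or decreases according to the sign of [a]; the sum of its values at the two
    ends serves in both cases. *)
Lemma powR_bounds lo hi y a : 0 < lo -> lo <= y <= hi ->
  0 <= y `^ a <= lo `^ a + hi `^ a.
Proof.
move=> lo0 /andP[ly yh]; rewrite powR_ge0/=.
have y0 : 0 < y by exact: lt_le_trans ly.
have hi0 : 0 < hi by exact: lt_le_trans yh.
have [a0|a0] := leP 0 a.
  rewrite -[leLHS]add0r lerD ?powR_ge0//.
  by apply: ge0_ler_powR => //; rewrite nnegrE ltW.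
rewrite -[leLHS]addr0 lerD ?powR_ge0//.
rewrite -(opprK a) (powRN y) (powRN lo) lef_pV2 ?posrE ?powR_gt0//.
by apply: ge0_ler_powR => //; rewrite ?nnegrE ?oppr_ge0 ltW.
Qed.

Lemma powR_lipschitz lo hi y z a : 0 < lo -> lo <= y <= hi -> lo <= z <= hi ->
  `|y `^ a - z `^ a| <= `|a| * (lo `^ (a - 1) + hi `^ (a - 1)) * `|y - z|.
Proof.
move=> lo0; wlog yz : y z / y <= z.
  move=> H ly lz; have [/H->//|/ltW/H] := leP y z.
  by rewrite distrC (distrC z); apply.
move=> /andP[ly yh] /andP[lz zh].
have [->|ne] := eqVneq y z; first by rewrite !subrr normr0 mulr0.
have {ne}yz : y < z by rewrite lt_neqAle ne.
have d w : y <= w -> is_derive w 1 (fun v => v `^ a) (a * w `^ (a - 1) * 1).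
  by move=> yw; apply: is_derive_powR; rewrite (lt_le_trans lo0)// (le_trans ly).
have [| |c cyz e] := @MVT R (fun v => v `^ a) (fun v => a * v `^ (a - 1) * 1) y z yz.
- by move=> w; rewrite in_itv/= => /andP[yw _]; apply: d; exact: ltW.
- apply: derivable_within_continuous => w; rewrite in_itv/= => /andP[yw _].
  by case: (d _ yw).
rewrite distrC e (distrC y) normrM ler_wpM2r// mulr1 normrM ler_wpM2l//.
move: cyz; rewrite in_itv/= => /andP[yc cz].
have /andP[p0 p1] : 0 <= c `^ (a - 1) <= lo `^ (a - 1) + hi `^ (a - 1).
  by apply: powR_bounds; rewrite // (le_trans ly (ltW yc)) (le_trans (ltW cz)).
by rewrite ger0_norm.
Qed.

(** The segments from [y3] to [y4] and from [y1] to [y2] are run with a common parameter [s]. One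
    mean value for [F] then separates the second difference of the points from the variation of the
    derivative of the power. *)
Lemma powR_diff2 lo hi a : 0 < lo ->
  exists2 M, 0 <= M & forall y1 y2 y3 y4 : R,
   lo <= y1 <= hi -> lo <= y2 <= hi -> lo <= y3 <= hi -> lo <= y4 <= hi ->
   `|y4 `^ a - y3 `^ a - (y2 `^ a - y1 `^ a)| <=
   M * `|y4 - y3 - (y2 - y1)| + M * (`|y3 - y1| + `|y4 - y2|) * `|y2 - y1|.
Proof.
move=> lo0.
pose M1 := `|a| * (lo `^ (a - 1) + hi `^ (a - 1)).
pose M2 := `|a| * (`|a - 1| * (lo `^ (a - 1 - 1) + hi `^ (a - 1 - 1))).
have M10 : 0 <= M1 by rewrite mulr_ge0// addr_ge0// powR_ge0.
have M20 : 0 <= M2 by rewrite !mulr_ge0// addr_ge0// powR_ge0.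
exists (M1 + M2); first exact: addr_ge0.
move=> y1 y2 y3 y4 i1 i2 i3 i4.
have conv u v s : 0 <= s <= 1 -> lo <= u <= hi -> lo <= v <= hi ->
    lo <= u + s * (v - u) <= hi.
  by move=> /andP[s0 s1] /andP[? ?] /andP[? ?]; apply/andP; split; nra.
pose F s := (y3 + s * (y4 - y3)) `^ a - (y1 + s * (y2 - y1)) `^ a.
pose F' s := a * (y3 + s * (y4 - y3)) `^ (a - 1) * (y4 - y3)
             - a * (y1 + s * (y2 - y1)) `^ (a - 1) * (y2 - y1).
have dl (u v s : R) : is_derive s 1 (fun s => u + s * (v - u)) (v - u).
  have H := is_deriveDr _ _ s _ _ (is_derive_cst u s 1)
    (is_deriveMr _ _ s _ _ (is_derive_id s 1) (is_derive_cst (v - u) s 1)).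
  by apply: is_derive_eq; rewrite add0r mul1r mulr0 addr0.
have dF (s : R) : 0 <= s <= 1 -> is_derive s 1 F (F' s).
  move=> s01; apply: is_deriveBr; apply: is_derive_powR => //.
  - by have /andP[+ _] := conv _ _ _ s01 i3 i4; exact: lt_le_trans.
  - by have /andP[+ _] := conv _ _ _ s01 i1 i2; exact: lt_le_trans.
have [| |s s01 e] := @MVT R F F' 0 1 ltr01.
- by move=> s; rewrite in_itv/= => /andP[s0 s1]; apply: dF; rewrite !ltW.
- apply: derivable_within_continuous => s; rewrite in_itv/= => s01.
  by case: (dF _ s01).
have {}s01 : 0 <= s <= 1 by move: s01; rewrite in_itv/= => /andP[? ?]; rewrite !ltW.
have -> : y4 `^ a - y3 `^ a - (y2 `^ a - y1 `^ a) = F' s.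
  rewrite subr0 mulr1 in e; rewrite -e /F !mul1r !mul0r !addr0 !subrKC.
  by ring.
set u := y3 + s * (y4 - y3); set v := y1 + s * (y2 - y1).
have iu := conv _ _ _ s01 i3 i4; have iv := conv _ _ _ s01 i1 i2.
have -> : F' s = a * u `^ (a - 1) * (y4 - y3 - (y2 - y1))
   + a * (u `^ (a - 1) - v `^ (a - 1)) * (y2 - y1) by rewrite /F' -/u -/v; ring.
apply: (le_trans (ler_normD _ _)); rewrite lerD//.
  rewrite normrM ler_wpM2r// (@le_trans _ _ M1)// ?lerDl// normrM ler_wpM2l//.
  by have /andP[p0 p1] := powR_bounds _ _ _ (a - 1) lo0 iu; rewrite ger0_norm.
rewrite normrM ler_wpM2r// (@le_trans _ _ (M2 * (`|y3 - y1| + `|y4 - y2|)))//; last first.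
  by rewrite ler_wpM2r ?addr_ge0// lerDr.
rewrite normrM -mulrA ler_wpM2l//.
rewrite (le_trans (powR_lipschitz _ _ _ _ (a - 1) lo0 iu iv))//.
rewrite ler_wpM2l ?mulr_ge0 ?addr_ge0 ?powR_ge0//.
have -> : u - v = (1 - s) * (y3 - y1) + s * (y4 - y2) by rewrite /u /v; ring.
move/andP: s01 => [s0 s1].
rewrite (le_trans (ler_normD _ _))// !normrM (ger0_norm s0) ger0_norm ?subr_ge0//.
by rewrite lerD// ler_piMl// gerBl.
Qed.

(** The exponent is generalized in the induction because each differentiation lowers it by one. The
    bound [c] keeps [k] in a compact interval of positive reals. *)
Lemma Ycls_powR P n k a c : 0 < c -> (forall x t, c <= k x t) -> Ycls P n k ->
  Ycls P n (fun x t => k x t `^ a).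
Proof.
move=> c0 ck; elim: n k a ck => [|n IH] k a ck Yk.
  have mk := Ycls_measurable _ _ _ Yk; move: Yk => [_ [C C0 [bk lk dk]]].
  split.
    by move=> x; exact: (measurableT_comp (measurable_powR a) (mk x)).
  have kI x t : c <= k x t <= C by rewrite ck (le_trans (ler_norm _)).
  have [M M0 HM] := powR_diff2 c C a c0.
  pose B := c `^ a + C `^ a.
  pose L := `|a| * (c `^ (a - 1) + C `^ (a - 1)).
  have B0 : 0 <= B by rewrite addr_ge0// powR_ge0.
  have L0 : 0 <= L by rewrite mulr_ge0// addr_ge0// powR_ge0.
  have e1 : 0 <= L * C by rewrite mulr_ge0.
  have e2 : 0 <= M * C by rewrite mulr_ge0.
  have e3 : 0 <= 2 * M * C * C by rewrite !mulr_ge0.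
  exists (B + L * C + M * C + 2 * M * C * C); first by lra.
  split.
  - move=> x t; have /andP[p0 p1] := powR_bounds _ _ _ a c0 (kI x t).
    rewrite ger0_norm// (le_trans p1)// -/B; lra.
  - move=> x h t; rewrite (le_trans (powR_lipschitz _ _ _ _ a c0 (kI _ _) (kI _ _)))//.
    rewrite -/L (@le_trans _ _ (L * (C * `|h|)))// ?ler_wpM2l// mulrA ler_wpM2r//.
    lra.
  - move=> h A A0 PA x b t.
    rewrite /diff2 (le_trans (HM _ _ _ _ (kI _ _) (kI _ _) (kI _ _) (kI _ _)))//.
    have f1 := dk h A A0 PA x b t; rewrite /diff2 in f1.
    have f2 := lk x b t.
    have f3 : `|k (x + b + h) t - k (x + h) t| <= C * `|b| by rewrite addrAC.
    have f4 := lk x h t.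
    have g1 := ler_wpM2l M0 f1.
    have f23 := lerD f2 f3.
    have h1 : 0 <= `|k (x + b) t - k x t| + `|k (x + b + h) t - k (x + h) t|.
      by rewrite addr_ge0.
    have g2 := ler_pM h1 (normr_ge0 _) f23 f4.
    have {}g2 := ler_wpM2l M0 g2.
    rewrite (le_trans (lerD g1 (_ : _ <= M * ((C * `|b| + C * `|b|) * (C * `|h|)))))//.
      by rewrite -mulrA.
    have q0 : 0 <= `|b| * `|h| by rewrite mulr_ge0.
    have q1 : 0 <= B * (`|b| * `|h|) by rewrite mulr_ge0.
    have q2 : 0 <= L * C * (`|b| * `|h|) by rewrite mulr_ge0.
    have q3 : 0 <= B * (`|b| * `|h|) * A by rewrite mulr_ge0.
    have q4 : 0 <= L * C * (`|b| * `|h|) * A by rewrite mulr_ge0.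
    have q5 : 0 <= M * C * C * (`|b| * `|h|) * A by rewrite !mulr_ge0.
    lra.
have [C C0 bk] := Ycls_bounded _ _ _ Yk.
have Yk1 := Ycls_S _ _ _ Yk.
move: Yk => [mk [_ [k' dk Yk']]].
have kI x t : c <= k x t <= C by rewrite ck (le_trans (ler_norm _)).
split; first by move=> x; exact: (measurableT_comp (measurable_powR a) (mk x)).
split.
  exists (c `^ a + C `^ a) => x t.
  by have /andP[p0 p1] := powR_bounds _ _ _ a c0 (kI x t); rewrite ger0_norm.
exists (fun x t => a * k x t `^ (a - 1) * k' x t).
  by move=> x t; apply: is_derive_powR => //; exact: lt_le_trans (ck x t).
apply: YclsM => //; apply: YclsM; first exact: YclsC.
exact: IH.
Qed.

Lemma Ycls_inv P n k c : 0 < c -> (forall x t, c <= k x t) -> Ycls P n k ->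
  Ycls P n (fun x t => (k x t)^-1).
Proof.
move=> c0 ck /(Ycls_powR _ _ _ (-1) _ c0 ck).
congr Ycls; apply/funext => x; apply/funext => t; rewrite powR_inv1//.
by rewrite (le_trans (ltW c0)).
Qed.

End powers.

(** * Integrals over a period *)

Section integrals.
Context {R : realType}.
Implicit Types (f g w : R -> R) (x y z t h a b C D A : R).
Local Notation leb := (@lebesgue_measure R).

Lemma integral_primitive f F a b : a < b ->
  (forall x, a <= x <= b -> is_derive (x : R) (1 : R) F (f x)) ->
  (forall x, a <= x <= b -> {for x, continuous f}) ->
  (\int[leb]_(x in `[a, b]) (f x)%:E = (F b - F a)%:E)%E.
Proof.
move=> ab dF cf.
have cF x : a <= x <= b -> {for x, continuous F}.
  move=> /dF d; apply: differentiable_continuous; apply/derivable1_diffP.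
  by case: d.
rewrite EFinB (@continuous_FTC2 _ f F)//.
- apply: continuous_in_subspaceT => x; rewrite inE/= in_itv/=; exact: cf.
- split.
  + by move=> x; rewrite in_itv/= => /andP[ax xb]; case: (dF x) => //; rewrite !ltW.
  + by apply: cvg_at_right_filter; apply: cF; rewrite lexx ltW.
  + by apply: cvg_at_left_filter; apply: cF; rewrite lexx ltW.
- move=> x; rewrite in_itv/= => /andP[ax xb].
  by case: (dF x) => [|_ <-]; rewrite ?derive1E// !ltW.
Qed.

(** The integrals over compact subintervals are at most [2 * M], and monotone convergence carries
    this bound to the open interval, at whose ends [f] may blow up. *)
Lemma integrable_primitive f F a b M : a < b ->
  (forall x, a < x < b -> is_derive (x : R) (1 : R) F (f x)) ->
  (forall x, a < x < b -> {for x, continuous f}) ->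
  (forall x, a < x < b -> 0 <= f x) -> (forall x, a < x < b -> `|F x| <= M) ->
  leb.-integrable `]a, b[ (EFin \o f).
Proof.
move=> ab dF cf f0 bF.
have mf : measurable_fun `]a, b[ f.
  apply: open_continuous_measurable_fun; first exact: interval_open.
  by move=> x; rewrite inE/= in_itv/=; exact: cf.
apply/integrableP; split; first exact/measurable_EFinP.
rewrite (@le_lt_trans _ _ (2 * M)%:E) ?ltry//.
(* With [n + 3] in the denominator, the two margins take at most two thirds of the interval already
   for [n = 0]. *)
pose e (n : nat) := (b - a) / n.+3%:R.
have e0 n : 0 < e n by rewrite divr_gt0// subr_gt0.
have ea n : a + e n < b - e n.
  rewrite ltrBrDr -addrA -ltrBrDl -mulrDl ltr_pdivrMr// mulrC -subr_gt0.
  have ba : 0 < b - a by rewrite subr_gt0.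
  have n0 : (3 : R) <= n.+3%:R by rewrite ler_nat.
  nra.
pose I n : set R := `[a + e n, b - e n]%classic.
have eS n : e n.+1 <= e n.
  apply: ler_wpM2l; first by rewrite subr_ge0 ltW.
  by rewrite lef_pV2 ?posrE// ler_nat.
have Inn : nondecreasing_seq I.
  apply/nondecreasing_seqP => n; rewrite subsetEset => x.
  by rewrite /I/= !in_itv/=; have := eS n; lra.
have IE : \bigcup_n I n = `]a, b[%classic.
  apply/seteqP; split => x.
    by move=> [n _]; rewrite /I/= !in_itv/=; have := e0 n; lra.
  rewrite /= in_itv/= => /andP[ax xb].
  pose m := Num.min (x - a) (b - x).
  have m0 : 0 < m by rewrite lt_min !subr_gt0 ax xb.
  have [n nP] : exists n : nat, (b - a) / m < n%:R.
    exists (Num.trunc ((b - a) / m)).+1.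
    by rewrite truncnS_gt// ltW// divr_gt0// subr_gt0.
  exists n => //; rewrite /I/= in_itv/=.
  have : e n <= m.
    rewrite /e ler_pdivrMr// mulrC -ler_pdivrMr// (le_trans (ltW nP))// ler_nat.
    by rewrite -addn3 leq_addr.
  rewrite le_min => /andP[? ?]; apply/andP; split; lra.
rewrite -IE.
have Isub n x : I n x -> a < x < b.
  by rewrite /I/= in_itv/=; have := e0 n; lra.
have cvgI : (\int[leb]_(x in I i) `|(EFin \o f) x| @[i --> \oo] -->
    \int[leb]_(x in \bigcup_i I i) `|(EFin \o f) x|)%E.
  apply: ge0_nondecreasing_set_cvg_integral => //.
    by move=> i; rewrite /I; exact: measurable_itv.
  move=> i; apply: measurableT_comp => //; apply/measurable_EFinP.
  by apply: measurable_funS mf => // x /Isub; rewrite /= in_itv.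
rewrite -(cvg_lim _ cvgI)//; apply: lime_le; first by apply/cvg_ex; eexists; exact: cvgI.
apply: nearW => n /=.
have -> : (\int[leb]_(x in I n) `|(f x)%:E| = \int[leb]_(x in I n) (f x)%:E)%E.
  by apply: eq_integral => x; rewrite inE => /Isub xab /=; rewrite ger0_norm ?f0.
have -> : (\int[leb]_(x in I n) (f x)%:E = (F (b - e n) - F (a + e n))%:E)%E.
  apply: integral_primitive => // x xi.
    by apply: dF; apply: (Isub n); rewrite /I/= in_itv.
  by apply: cf; apply: (Isub n); rewrite /I/= in_itv.
have p1 : a < a + e n < b by have := ea n; have := e0 n; lra.
have p2 : a < b - e n < b by have := ea n; have := e0 n; lra.
have := bF _ p1; have := bF _ p2.
have := ler_norm (F (b - e n)); have := ler_norm (- F (a + e n)).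
by rewrite lee_fin normrN; lra.
Qed.

(* The length of the chord of angle t of the unit circle. *)
Definition chord t : R := 2 * sin (t / 2).

Lemma is_derive_half (t : R) : is_derive t 1 (fun s : R => s / 2) (2^-1 : R).
Proof.
have := is_deriveMr _ _ t _ _ (is_derive_id t 1) (is_derive_cst (2^-1 : R) t 1).
by rewrite mul1r mulr0 addr0.
Qed.

Lemma is_derive_chord (t : R) : is_derive t 1 chord (cos (t / 2)).
Proof.
have ds : is_derive t 1 (fun s => sin (s / 2)) (cos (t / 2) * 2^-1).
  exact: (@is_derive1_comp R sin (fun s => s / 2) t _ _ _ (is_derive_half t)).
have := is_deriveMr _ _ t _ _ (is_derive_cst (2 : R) t 1) ds.
by rewrite (_ : 0 * _ + _ = cos (t / 2))//; field.
Qed.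

Lemma continuous_chord : continuous chord.
Proof. exact: (is_derive_continuous chord _ is_derive_chord). Qed.

Lemma chord_le t : 0 <= t -> chord t <= t.
Proof.
move=> t0; have [c] := mean_value chord _ is_derive_chord 0 t.
rewrite /chord mul0r sin0 mulr0 !subr0 => ->.
by rewrite ler_piMl// cos_le1.
Qed.

Lemma chord_le2 t : chord t <= 2.
Proof. by rewrite /chord -[leRHS]mulr1 ler_wpM2l// sin_le1. Qed.

Lemma chord_gt0 t : 0 < t < 2 * pi -> 0 < chord t.
Proof.
move=> /andP[t0 t1]; rewrite /chord mulr_gt0// sin_gt0_pi// divr_gt0//=.
by rewrite ltr_pdivrMr// mulrC.
Qed.

Lemma chord_2pi t : chord (2 * pi - t) = chord t.
Proof.
rewrite /chord mulrBl mulrAC divff// mul1r sinB sinpi cospi; ring.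
Qed.

(** The angle is halved twice. For [s = t / 4] the mean value theorem gives [s cos s <= sin s], so
    [chord t = 4 sin s cos s >= 4 s cos^2 s], and [2 cos^2 s >= 1] because [cos (t / 2) >= 0]. *)
Lemma le_chord t : 0 <= t <= pi -> t <= 2 * chord t.
Proof.
move=> /andP[t0 tpi].
have cq : cos (t / 2) >= 0.
  apply: cos_ge0_pihalf; rewrite ler_wpM2r// (le_trans _ (_ : 0 <= t / 2)) ?divr_ge0//.
  by rewrite oppr_le0 divr_ge0// pi_ge0.
have [->|tn0] := eqVneq t 0; first by rewrite /chord mul0r sin0 !mulr0.
have {tn0 t0}t0 : 0 < t by rewrite lt_neqAle eq_sym tn0.
set s := t / 4.
have s2 : t / 2 = s *+ 2 by rewrite /s mulr2n; field.
have s0 : 0 < s by rewrite divr_gt0.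
have ss : cos s * s <= sin s.
  have [|c + e] := @MVT R sin cos 0 s s0 (fun x _ => is_derive_sin x).
    exact/continuous_subspaceT/continuous_sin.
  rewrite in_itv/= => /andP[c0 cs].
  move: e; rewrite sin0 !subr0 => ->; rewrite ler_wpM2r ?ltW// ltr_cos ?in_itv//=.
    by rewrite (ltW c0)/= (le_trans (ltW cs))// /s; have := pi_gt0 R; lra.
  by rewrite (ltW s0)/= /s; have := pi_gt0 R; lra.
have cs : 0 <= cos s.
  by apply: cos_ge0_pihalf; rewrite /s; have := pi_gt0 R; lra.
move: cq; rewrite /chord s2 cos_mulr2n sin_mulr2n !mulr2n => cq.
have -> : t = s * 4 by rewrite /s divfK.
have : cos s * (cos s * s) <= cos s * sin s by rewrite ler_wpM2l.
have : s * (cos s ^+ 2 + cos s ^+ 2 - 1) >= 0 by rewrite mulr_ge0// ltW.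
rewrite expr2; lra.
Qed.

End integrals.

(** * Chordal difference quotients of periodic functions *)

Section difference_quotients.
Context {R : realType}.
Implicit Types (k l : R -> R -> R) (f g w : R -> R) (P : R -> R -> Prop).
Implicit Types (x y z t h a b C D A : R).
Local Notation leb := (@lebesgue_measure R).
Local Notation I2pi := (`]0, 2 * pi[%classic : set R).

Definition lips (C : R) f := forall x h, `|f (x + h) - f x| <= C * `|h|.

Lemma periodicB f x : periodic f (2 * pi) -> f (x - 2 * pi) = f x.
Proof. by move=> pf; rewrite -pf subrK. Qed.

(** Beyond [pi], periodicity replaces [t] by [t - 2 pi]: the chord is comparable to the distance on
    the circle, not to [t] itself. *)
Lemma lips_chord C f x t : 0 <= C -> lips C f -> periodic f (2 * pi) ->
  0 < t < 2 * pi -> `|f x - f (x - t)| <= 2 * C * chord t.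
Proof.
move=> C0 lf pf /andP[t0 t2].
have [tpi|pit] := leP t pi.
  rewrite -{1}(subrK t x) (le_trans (lf _ _))// gtr0_norm// (mulrC 2) -mulrA ler_wpM2l// le_chord// tpi ltW//.
have -> : f x = f (x - t + (t - 2 * pi)) by rewrite addrA subrK periodicB.
have -> : 2 * C * chord t = C * (2 * chord t) by ring.
rewrite (le_trans (lf _ _))// ler_wpM2l// -chord_2pi.
have e : `|t - 2 * pi| = 2 * pi - t by rewrite ltr0_norm ?subr_lt0// opprB.
by rewrite e le_chord//; apply/andP; split; lra.
Qed.

(** Cut off outside one period, so that the bounds on [dq] hold for every real [t], as [Ycls]
    demands. *)
Definition ichord t : R := if (0 < t) && (t < 2 * pi) then (chord t)^-1 else 0.

Definition dq g x t := (g x - g (x - t)) * ichord t.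

Lemma ichordE t : 0 < t < 2 * pi -> ichord t = (chord t)^-1.
Proof. by rewrite /ichord => ->. Qed.

Lemma measurable_ichord : measurable_fun setT ichord.
Proof.
have -> : ichord = fun t => if (0 < t) && (t < 2 * pi) then chord t `^ (-1) else 0.
  apply/funext => t; rewrite /ichord; case: ifPn => // /chord_gt0/ltW c0.
  by rewrite powR_inv1.
apply: measurable_fun_ifT => //.
  apply: measurable_and.
    by apply: measurable_fun_ltr.
  by apply: measurable_fun_ltr.
exact: (measurableT_comp (measurable_powR (-1))
  (continuous_measurable _ continuous_chord)).
Qed.

Lemma dq_le C g x t : 0 <= C -> lips C g -> periodic g (2 * pi) ->
  `|dq g x t| <= 2 * C.
Proof.
move=> C0 lg pg; rewrite /dq /ichord; case: ifPn => [tI|_]; last first.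
  by rewrite mulr0 normr0 mulr_ge0.
have c0 := chord_gt0 _ tI.
by rewrite normrM normfV (gtr0_norm c0) ler_pdivrMr// lips_chord.
Qed.

Lemma lips_continuous C f : lips C f -> continuous f.
Proof.
move=> lf x; apply/cvgrPdist_le => /= e e0.
have C1 : 0 < `|C| + 1 by rewrite ltr_wpDl.
exists (e / (`|C| + 1)) => /=; first by rewrite divr_gt0.
move=> y /=; rewrite ltr_pdivlMr// => H.
rewrite -(subrKC x y) distrC (le_trans (lf _ _))//.
rewrite (distrC y) (le_trans _ (ltW H))// mulrC ler_wpM2l//.
by rewrite (le_trans (ler_norm _))// lerDl.
Qed.

Lemma measurable_dq g x : continuous g -> measurable_fun setT (dq g x).
Proof.
move=> cg; apply: measurable_funM; last exact: measurable_ichord.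
apply: measurable_funB => //; apply: (measurableT_comp (continuous_measurable g cg)).
exact: measurable_funB.
Qed.

Lemma periodic_derive g g' : (forall x : R, is_derive x (1 : R) g (g' x)) ->
  periodic g (2 * pi) -> periodic g' (2 * pi).
Proof.
move=> dg pg x.
have := is_derive_shift_arg g _ x (2 * pi) (dg (x + 2 * pi)).
have -> : (fun z => g (z + 2 * pi)) = g by apply/funext => z; exact: pg.
by move=> d; rewrite -(@derive_val _ _ _ _ _ _ _ d) (@derive_val _ _ _ _ _ _ _ (dg x)).
Qed.

(** An increment in [x] of [dq g] is [dq] of an increment of [g], whose Lipschitz constant is read
    off [g']. Thus [dq g] is as regular as [g'], one derivative below [g]. *)
Lemma Ycls_dq P n g g' : (forall x : R, is_derive x (1 : R) g (g' x)) ->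
  periodic g (2 * pi) -> Ycls P n (fun x _ => g' x) -> Ycls P n (dq g).
Proof.
elim: n g g' => [|n IH] g g' dg pg Yg.
  have mg x := measurable_dq g x (is_derive_continuous g _ dg).
  move: Yg => [_ [C C0 [bg lg d2g]]]; split=> //.
  exists (2 * C); first by rewrite mulr_ge0.
  have Lg : lips C g by move=> y h; exact: (derive_bound_lipschitz g g' C dg (bg ^~ 0)).
  split.
  - by move=> x t; exact: dq_le.
  - move=> x h t; pose f z := g (z + h) - g z.
    have -> : dq g (x + h) t - dq g x t = dq f x t.
      by rewrite /dq /f (addrAC x h); ring.
    rewrite -mulrA; apply: dq_le; first by rewrite mulr_ge0.
      move=> y b; apply: (derive_bound_lipschitz f (fun z => g' (z + h) - g' z)) => z.
        by apply: is_deriveBr => //; exact: is_derive_shift_arg.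
      exact: (lg z h 0).
    by move=> y; rewrite /f addrAC !pg.
  - move=> h A A0 PA x a t.
    have -> : diff2 ((dq g)^~ t) a h x = dq (diff2 g a h) x t.
      by rewrite /diff2 /dq !(addrAC _ (- t)); ring.
    rewrite -!mulrA; apply: dq_le.
    + by rewrite !mulr_ge0// addr_ge0.
    + move=> y b; apply: (derive_bound_lipschitz _ (diff2 g' a h)) => z.
        by rewrite /diff2; do 2?apply: is_deriveBr => //; do 2?exact: is_derive_shift_arg;
          apply: (is_derive_shift_arg (fun z => g (z + h))); exact: is_derive_shift_arg.
      by rewrite !mulrA; exact: (d2g h A A0 PA z a 0).
    + by move=> y; rewrite /diff2 !(addrAC _ (2 * pi)) !pg.
have [C C0 bg] := Ycls_bounded _ _ _ Yg.
have cg := is_derive_continuous g _ dg.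
move: Yg => [_ [_ [g2 dg' Yg2]]].
split; first by move=> x; exact: measurable_dq.
split; first by exists (2 * C) => x t; apply: dq_le => // y h; exact: derive_bound_lipschitz (bg ^~ 0) _ _.
exists (dq g').
  move=> x t; rewrite /dq.
  have d1 := is_derive_shift_arg g _ x (- t) (dg (x - t)).
  have := is_deriveMr _ _ x _ _ (is_deriveBr _ _ x _ _ (dg x) d1) (is_derive_cst (ichord t) x 1).
  by rewrite mulr0 addr0.
apply: (IH g' (g2 ^~ 0)) => //; first exact: periodic_derive dg pg.
congr Ycls: Yg2; apply/funext => x; apply/funext => t.
have d0 := dg' x 0; have dt := dg' x t.
by rewrite -(@derive_val _ _ _ _ _ _ _ d0) (@derive_val _ _ _ _ _ _ _ dt).
Qed.

End difference_quotients.

(** * Integrals depending on a parameter *)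

Section integral_operators.
Context {R : realType}.
Implicit Types (k l : R -> R -> R) (f g w : R -> R) (P : R -> R -> Prop).
Implicit Types (x y z t h a b C D A : R).
Local Notation leb := (@lebesgue_measure R).
Local Notation I2pi := (`]0, 2 * pi[%classic : set R).

Lemma Ycls_derive P n f : Ycls P n.+1 (fun x _ => f x) ->
  exists2 f', (forall x : R, is_derive x (1 : R) f (f' x)) & Ycls P n (fun x _ => f' x).
Proof.
move=> [_ [_ [k' dk Yk]]]; exists (k' ^~ 0); first by move=> x; exact: dk x 0.
congr Ycls: Yk; apply/funext => x; apply/funext => t.
have d0 := dk x 0; have dt := dk x t.
by rewrite -(@derive_val _ _ _ _ _ _ _ d0) (@derive_val _ _ _ _ _ _ _ dt).
Qed.

Lemma Ycls_primitive P n f f' C : (forall x : R, is_derive x (1 : R) f (f' x)) ->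
  (forall x, `|f x| <= C) -> Ycls P n (fun x _ => f' x) -> Ycls P n.+1 (fun x _ => f x).
Proof.
move=> df bf Yf; split; first by move=> x; exact: measurable_cst.
by split; [exists C|exists (fun x _ => f' x)].
Qed.

Lemma Ycls_continuous P n f : Ycls P n (fun x _ => f x) -> continuous f.
Proof.
move=> /Ycls_lipschitz[C C0 lf]; apply: (@lips_continuous _ C) => x h.
exact: lf x h 0.
Qed.

Lemma Ycls_reflect P n f : Ycls P n (fun x _ => f x) -> Ycls P n (fun x t => f (x - t)).
Proof.
have mf g x : continuous g -> measurable_fun setT (fun t => g (x - t)).
  move=> cg; apply: (measurableT_comp (continuous_measurable g cg)).
  exact: measurable_funB.
elim: n f => [|n IH] f Yf.
  have cf := Ycls_continuous _ _ _ Yf.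
  move: Yf => [_ [C C0 [bf lf d2f]]]; split; first by move=> x; exact: mf.
  exists C => //; split.
  - by move=> x t; exact: bf _ 0.
  - by move=> x h t; rewrite addrAC; exact: lf _ _ 0.
  - move=> h A A0 PA x a t; have := d2f h A A0 PA (x - t) a 0.
    by rewrite /diff2 !(addrAC _ (- t)).
have cf := Ycls_continuous _ _ _ Yf.
have [C C0 bf] := Ycls_bounded _ _ _ Yf.
have [f' df Yf'] := Ycls_derive _ _ _ Yf.
split; first by move=> x; exact: mf.
split; first by exists C => x t; exact: bf _ 0.
exists (fun x t => f' (x - t)); last exact: IH.
by move=> x t; exact: (is_derive_shift_arg f).
Qed.

(** The open interval leaves out the zeros of the chord. *)
Definition J f : R := \int[leb]_(t in I2pi) f t.

Definition intg f := leb.-integrable I2pi (EFin \o f).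

Lemma intg_bounded f C : measurable_fun setT f -> (forall t, `|f t| <= C) -> intg f.
Proof.
move=> mf bf; apply: measurable_bounded_integrable => //.
- rewrite /= lebesgue_measure_itv/= lte_fin mulr_gt0 ?pi_gt0//.
  by rewrite -EFinB ltry.
- exact: measurable_funTS.
- exists C; split; first exact: num_real.
  by move=> D CD x _ /=; rewrite (le_trans (bf x))// ltW.
Qed.

Lemma intgM f w C : measurable_fun setT f -> (forall t, `|f t| <= C) -> intg w ->
  intg (fun t => f t * w t).
Proof.
move=> mf bf iw; rewrite /intg.
have -> : EFin \o (fun t => f t * w t) = ((EFin \o f) \* (EFin \o w))%E.
  by apply/funext => t /=; rewrite EFinM.
apply: integrableMr => //; first exact: measurable_funTS.
exists C; split; first exact: num_real.
by move=> D CD x _ /=; rewrite (le_trans (bf x))// ltW.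
Qed.

Lemma intgD f g : intg f -> intg g -> intg (fun t => f t + g t).
Proof. by move=> i1 i2; apply: (integrableD _ i1 i2). Qed.

Lemma intgB f g : intg f -> intg g -> intg (fun t => f t - g t).
Proof. by move=> i1 i2; apply: (integrableB _ i1 i2). Qed.

Lemma intgZ a f : intg f -> intg (fun t => a * f t).
Proof. by move=> i1; apply: (integrableZl _ a i1). Qed.

Lemma intg_abs f : intg f -> intg (fun t => `|f t|).
Proof. by move=> i1; apply: (integrable_norm i1). Qed.

Lemma JD f g : intg f -> intg g -> J (fun t => f t + g t) = J f + J g.
Proof. by move=> i1 i2; exact: RintegralD. Qed.

Lemma JB f g : intg f -> intg g -> J (fun t => f t - g t) = J f - J g.
Proof. by move=> i1 i2; exact: RintegralB. Qed.

Lemma JZ a f : intg f -> J (fun t => a * f t) = a * J f.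
Proof. by move=> i1; exact: RintegralZl. Qed.

Lemma eq_J f g : (forall t, 0 < t < 2 * pi -> f t = g t) -> J f = J g.
Proof.
by move=> fg; apply: eq_Rintegral => t; rewrite inE/= in_itv/= => tI; exact: fg.
Qed.

Lemma eq_intg f g : (forall t, 0 < t < 2 * pi -> f t = g t) -> intg f -> intg g.
Proof.
move=> fg; apply: eq_integrable => // t; rewrite inE/= in_itv/= => tI.
by rewrite /= fg.
Qed.

Lemma le_J f g : intg f -> intg g -> (forall t, 0 < t < 2 * pi -> f t <= g t) ->
  J f <= J g.
Proof.
by move=> i1 i2 fg; apply: le_Rintegral => // t; rewrite /= in_itv/=; exact: fg.
Qed.

Lemma abs_J_le f g : intg f -> intg g -> (forall t, 0 < t < 2 * pi -> `|f t| <= g t) ->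
  `|J f| <= J g.
Proof.
move=> i1 i2 fg; rewrite (le_trans (le_normr_Rintegral _ _))//.
by apply: le_J => //; exact: intg_abs.
Qed.

Lemma J_ge0 f : (forall t, 0 < t < 2 * pi -> 0 <= f t) -> 0 <= J f.
Proof. by move=> f0; apply: Rintegral_ge0 => t; rewrite /= in_itv/=; exact: f0. Qed.

Lemma is_derive_J k k' w C : (forall x, measurable_fun setT (k x)) ->
  (exists D, forall x t, `|k x t| <= D) ->
  (forall x t : R, is_derive x (1 : R) (k ^~ t) (k' x t)) ->
  (forall x t, `|k' x t| <= C) -> intg w ->
  forall x : R, is_derive x (1 : R) (fun z => J (fun t => k z t * w t))
    (J (fun t => k' x t * w t)).
Proof.
move=> mk [D bk] dk bk' iw x.
have dkw y t : is_derive (y : R) (1 : R) (fun z => k z t * w t) (k' y t * w t).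
  have := is_deriveMr _ _ y _ _ (dk y t) (is_derive_cst (w t) y 1).
  by rewrite mulr0 addr0.
have I1 : `]x - 1, x + 1[%classic x by rewrite /= in_itv/=; apply/andP; split; lra.
have i1 y : `]x - 1, x + 1[%classic y -> leb.-integrable I2pi (EFin \o (fun t => k y t * w t)).
  by move=> _; exact: (@intgM _ _ D).
have d1 y t : `]x - 1, x + 1[%classic y -> I2pi t ->
    derivable ((fun z t => k z t * w t) ^~ t) y 1.
  by move=> _ _; case: (dkw y t).
have pE y t : partial1of2 (fun z t => k z t * w t) y t = k' y t * w t.
  by rewrite partial1of2E (@derive_val _ _ _ _ _ _ _ (dkw y t)).
have C0 : 0 <= C by rewrite (le_trans _ (bk' 0 0)).
have g0 t : 0 <= C * `|w t| by rewrite mulr_ge0.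
have iG := intgZ C _ (intg_abs _ iw).
have ub y t : `]x - 1, x + 1[%classic y -> I2pi t ->
    `|partial1of2 (fun z t => k z t * w t) y t| <= C * `|w t|.
  by move=> _ _; rewrite pE normrM ler_wpM2r.
have H1 := @derivable_under_integral R _ _ leb (fun z t => k z t * w t) I2pi
  (measurable_itv _) x (x - 1) (x + 1) I1 i1 d1 _ g0 iG ub.
have H2 := @differentiation_under_integral R _ _ leb (fun z t => k z t * w t) I2pi
  (measurable_itv _) x (x - 1) (x + 1) I1 i1 d1 _ g0 iG ub.
apply: DeriveDef; first exact: H1.
rewrite -derive1E; apply: (eq_trans H2).
by apply: eq_J => t _; rewrite -pE.
Qed.

(** The bounds in [Ycls] are uniform in [t], so integration multiplies them by the L^1 norm of [w],
    which may carry the singularity. *)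
Lemma Ycls_J P n k w : intg w -> Ycls P n k -> Ycls P n (fun x _ => J (fun t => k x t * w t)).
Proof.
move=> iw; have iaw := intg_abs _ iw.
have Jw0 : 0 <= J (fun t => `|w t|) by apply: J_ge0.
have bJ f C : measurable_fun setT f -> (forall t, `|f t| <= C) ->
    `|J (fun t => f t * w t)| <= C * J (fun t => `|w t|).
  move=> mf bf; rewrite -JZ//; apply: abs_J_le.
  - exact: intgM mf bf iw.
  - exact: intgZ.
  - by move=> t _; rewrite normrM ler_wpM2r.
elim: n k => [|n IH] k Yk.
  move: Yk => [mk [C C0 [bk lk dk]]]; split; first by move=> x; exact: measurable_cst.
  have ik x := intgM (k x) w C (mk x) (bk x) iw.
  have E x y : J (fun t => k x t * w t) - J (fun t => k y t * w t) =
      J (fun t => (k x t - k y t) * w t).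
    by rewrite -JB//; apply: eq_J => t _; rewrite mulrBl.
  have mkB x y : measurable_fun setT (fun t => k x t - k y t) by exact: measurable_funB.
  have bkB x y t : `|k x t - k y t| <= C + C.
    by rewrite (le_trans (ler_normB _ _))// lerD.
  exists (C * J (fun t => `|w t|)); first by rewrite mulr_ge0.
  split.
  - by move=> x _; exact: bJ.
  - by move=> x h _; rewrite E mulrAC; apply: bJ => // t; exact: lk.
  - move=> h A A0 PA x a _; rewrite /diff2 !E -JB; last 2 first.
    + exact: (@intgM _ _ (C + C)).
    + exact: (@intgM _ _ (C + C)).
    have -> : J (fun t => (k (x + a + h) t - k (x + a) t) * w t -
        (k (x + h) t - k x t) * w t) = J (fun t => diff2 (k ^~ t) a h x * w t).
      by apply: eq_J => t _; rewrite -mulrBl.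
    have -> : C * J (fun t => `|w t|) * (1 + A) * `|a| * `|h| =
        C * (1 + A) * `|a| * `|h| * J (fun t => `|w t|) by ring.
    apply: bJ; last by move=> t; exact: dk.
    by rewrite /diff2; apply: measurable_funB; exact: mkB.
have [D D0 bk] := Ycls_bounded _ _ _ Yk.
move: Yk => [mk [_ [k' dk Yk']]].
have [C C0 bk'] := Ycls_bounded _ _ _ Yk'.
apply: (Ycls_primitive _ _ _ (fun x => J (fun t => k' x t * w t)) (D * J (fun t => `|w t|))).
- by apply: (is_derive_J _ _ _ C) => //; exists D.
- by move=> x; exact: bJ.
- exact: IH.
Qed.

End integral_operators.

(** * Translations and reflections of integrals over a period *)

Section lebesgue_invariance.
Context {R : realType}.
Implicit Types (f g : R -> R) (x y z t a b : R).
Local Notation leb := (@lebesgue_measure R).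
Local Notation I2pi := (`]0, 2 * pi[%classic : set R).
Local Notation mR := (measurableTypeR R).

(** By uniqueness of Lebesgue measure, which agrees with its image under [phi] on half-open
    intervals. Splitting into positive and negative parts gives the formula for every measurable
    [f]. *)
Lemma integral_invariant (phi : mR -> mR) (f : mR -> \bar R) (D : set mR) :
  measurable_fun setT phi ->
  (forall u v : R, leb (phi @^-1` `]u, v]%classic) = leb `]u, v]%classic) ->
  measurable D -> measurable_fun setT f ->
  (\int[leb]_(x in D) f x = \int[leb]_(x in phi @^-1` D) f (phi x))%E.
Proof.
move=> mphi phiE mD mf.
have E (A : set mR) : measurable A -> leb A = pushforward leb phi A.
  apply: (@lebesgue_measure_unique R (measure_function_pushforward__canonical__measure_function_Measure leb mphi)).
  by move=> _ [[u v] _ <-] /=; rewrite /pushforward phiE.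
have pos (g : mR -> \bar R) : measurable_fun setT g -> (forall x, 0 <= g x)%E ->
    (\int[leb]_(x in D) g x = \int[leb]_(x in phi @^-1` D) g (phi x))%E.
  move=> mg g0; rewrite -(@ge0_integral_pushforward _ _ mR mR R phi mphi leb D g)//.
    by apply: eq_measure_integral => A mA _; exact: E.
  exact: measurable_funTS.
rewrite integralE [RHS]integralE.
have mp : measurable_fun setT (f^\+%E : mR -> \bar R) by apply: measurable_funepos.
have mn : measurable_fun setT (f^\-%E : mR -> \bar R) by apply: measurable_funeneg.
have e1 := pos f^\+%E mp (funepos_ge0 f).
have e2 := pos f^\-%E mn (funeneg_ge0 f).
rewrite e1 e2; congr (_ - _)%E; apply: eq_integral => x _.
  by rewrite !funeposE.
by rewrite !funenegE.
Qed.

Lemma integral_translation (f : R -> \bar R) u v a : measurable_fun setT f ->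
  (\int[leb]_(x in `]u, v[) f x = \int[leb]_(x in `](u - a)%R, (v - a)%R[) f (x + a)%R)%E.
Proof.
move=> mf; rewrite (integral_invariant (fun x => x + a))//.
- by congr (integral _ _ _); apply/seteqP; split => x /=; rewrite !in_itv/= ltrBlDr ltrBrDr.
- exact: (@measurable_funD _ mR).
- move=> b c; have -> : (fun x : mR => x + a) @^-1` `]b, c]%classic = `]b - a, c - a]%classic.
    by apply/seteqP; split => x /=; rewrite !in_itv/= ltrBlDr lerBrDr.
  rewrite !lebesgue_measure_itv/= !lte_fin ltrD2r.
  by case: ifP => // _; rewrite -!EFinB; congr EFin; ring.
Qed.

Lemma integral_reflection (f : R -> \bar R) u v a : measurable_fun setT f ->
  (\int[leb]_(x in `]u, v[) f x = \int[leb]_(x in `](a - v)%R, (a - u)%R[) f (a - x)%R)%E.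
Proof.
move=> mf; rewrite (integral_invariant (fun x => a - x))//.
- congr (integral _ _ _); apply/seteqP; split => x /=; rewrite !in_itv/=;
    move=> /andP[? ?]; apply/andP; split; lra.
- exact: (@measurable_funB _ mR).
- move=> b c; have -> : (fun x : mR => a - x) @^-1` `]b, c]%classic = `[a - c, a - b[%classic.
    apply/seteqP; split => x /=; rewrite !in_itv/=; move=> /andP[? ?]; apply/andP; split; lra.
  rewrite !lebesgue_measure_itv/= !lte_fin ltrD2l ltrN2.
  by case: ifP => // _; rewrite -!EFinB; congr EFin; ring.
Qed.

Lemma integral_split (f : R -> \bar R) u v w : measurable_fun setT f -> u < v -> v < w ->
  (\int[leb]_(x in `]u, w[) f x =
   \int[leb]_(x in `]u, v[) f x + \int[leb]_(x in `]v, w[) f x)%E.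
Proof.
move=> mf uv vw.
have -> : `]u, w[%classic = `]u, v]%classic `|` `]v, w[%classic :> set mR.
  by rewrite -itv_bndbnd_setU// bnd_simp ltW.
rewrite integral_setU//; last 2 first.
- exact: measurable_funTS.
- apply/disj_setPS => x /= []; rewrite !in_itv/= => /andP[_ xv] /andP[vx _].
  by move: (le_lt_trans xv vx); rewrite ltxx.
by rewrite -integral_itv_bndo_bndc//; exact: measurable_funTS.
Qed.

Lemma periodic_shift f (n : nat) x : periodic f (2 * pi) -> f (x + n%:R * (2 * pi)) = f x.
Proof. by move=> pf; rewrite mulr_natl; exact: (periodicn pf). Qed.

Lemma periodic_int f (n : int) x : periodic f (2 * pi) -> f (x + n%:~R * (2 * pi)) = f x.
Proof.
move=> pf; case: n => n; first exact: periodic_shift.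
by rewrite -(periodic_shift f n.+1)// NegzE mulrNz mulNr subrK.
Qed.

Lemma period_reduce x : exists n : int, 0 <= x + n%:~R * (2 * pi) < 2 * pi.
Proof.
have p0 : 0 < 2 * pi :> R by rewrite mulr_gt0 ?pi_gt0.
exists (- Num.floor (x / (2 * pi))).
have /andP[] := floor_itv (x / (2 * pi)).
rewrite ler_pdivlMr// ltr_pdivrMr// mulrNz mulNr intrD mulrDl mul1r => ? ?.
by apply/andP; split; lra.
Qed.

(** After reducing [a] to [b] in [[0, 2 pi)], the interval is cut at [2 pi] and the part beyond is
    moved back to the interval from 0 to [b]. *)
Lemma integral_period f a : measurable_fun setT f -> periodic f (2 * pi) ->
  (\int[leb]_(x in `]a, (a + 2 * pi)%R[) (f x)%:E = \int[leb]_(x in I2pi) (f x)%:E)%E.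
Proof.
move=> mf pf; have p0 : 0 < 2 * pi :> R by rewrite mulr_gt0 ?pi_gt0.
have mEf : measurable_fun setT (EFin \o f) by exact/measurable_EFinP.
have [n] := period_reduce a; set b := a + _ => /andP[b0 b1].
have -> : (\int[leb]_(x in `]a, (a + 2 * pi)%R[) (f x)%:E =
    \int[leb]_(x in `]b, (b + 2 * pi)%R[) (f x)%:E)%E.
  rewrite (integral_translation (EFin \o f) b _ (n%:~R * (2 * pi)))//.
  have -> : b - n%:~R * (2 * pi) = a by rewrite /b addrK.
  have -> : b + 2 * pi - n%:~R * (2 * pi) = a + 2 * pi by rewrite /b; ring.
  by apply: eq_integral => x _ /=; rewrite periodic_int.
have [->|b0'] := eqVneq b 0; first by rewrite add0r.
have {b0 b0'}b0 : 0 < b by rewrite lt_neqAle eq_sym b0'.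
rewrite (integral_split (EFin \o f) _ (2 * pi))//; last by rewrite ltrDr.
rewrite [RHS](integral_split (EFin \o f) _ b)// [RHS]addeC; congr (_ + _)%E.
rewrite (integral_translation (EFin \o f) _ _ (2 * pi))// subrr addrK.
by apply: eq_integral => x _ /=; rewrite pf.
Qed.

Lemma J_translation f a : measurable_fun setT f -> periodic f (2 * pi) ->
  J (fun t => f (t + a)) = J f.
Proof.
move=> mf pf; have mEf : measurable_fun setT (EFin \o f) by exact/measurable_EFinP.
rewrite /J /Rintegral -(integral_period f a)//.
by rewrite (integral_translation (EFin \o f) a _ a)// subrr addrAC subrr add0r.
Qed.

Lemma J_reflection f a : measurable_fun setT f -> periodic f (2 * pi) ->
  J (fun t => f (a - t)) = J f.
Proof.
move=> mf pf; have mEf : measurable_fun setT (EFin \o f) by exact/measurable_EFinP.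
rewrite /J /Rintegral -(integral_period f (a - 2 * pi))// subrK.
by rewrite (integral_reflection (EFin \o f) _ _ a)// subrr subKr.
Qed.

End lebesgue_invariance.

(** * A maximum principle for the singular operator *)

Section weights.
Context {R : realType}.
Implicit Types (f g : R -> R) (x y z t a b c : R).
Local Notation leb := (@lebesgue_measure R).
Local Notation I2pi := (`]0, 2 * pi[%classic : set R).

Definition wt (c t : R) : R := chord t `^ (- c).

Lemma wt_ge0 c t : 0 <= wt c t.
Proof. exact: powR_ge0. Qed.

Lemma pi2_gt0 : 0 < 2 * pi :> R.
Proof. by rewrite mulr_gt0 ?pi_gt0. Qed.

Lemma measurable_wt c : measurable_fun setT (wt c).
Proof.
exact: (measurableT_comp (measurable_powR (- c))
  (continuous_measurable _ continuous_chord)).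
Qed.

Lemma powRN_anti a b c : 0 <= c -> 0 < a -> a <= b -> b `^ (- c) <= a `^ (- c).
Proof.
move=> c0 a0 ab; have b0 : 0 < b by exact: lt_le_trans ab.
rewrite !powRN lef_pV2 ?posrE ?powR_gt0//.
by apply: ge0_ler_powR => //; rewrite nnegrE ltW.
Qed.

(** The chord is at least half the distance to the nearer end, so the weight is below a sum of two
    pure powers, whose primitive is explicit and bounded since [c < 1]. *)
Lemma intg_wt c : 0 <= c < 1 -> intg (wt c).
Proof.
move=> /andP[c0 c1].
have p0 := pi2_gt0; have c1' : 0 < 1 - c by rewrite subr_gt0.
pose f t := (t / 2) `^ (- c) + ((2 * pi - t) / 2) `^ (- c).
pose F t := (t / 2) `^ (1 - c) * (2 / (1 - c)) - ((2 * pi - t) / 2) `^ (1 - c) * (2 / (1 - c)).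
have dh (t : R) : is_derive t 1 (fun t => (2 * pi - t) / 2) (- 2^-1).
  have H := is_deriveBr _ _ t _ _ (is_derive_cst (2 * pi : R) t 1) (is_derive_id t 1).
  have := is_deriveMr _ _ t _ _ H (is_derive_cst (2^-1 : R) t 1).
  by rewrite mulr0 addr0 sub0r mulN1r.
have i : intg f.
  apply: (@integrable_primitive _ f F 0 (2 * pi)
     (pi `^ (1 - c) * (2 / (1 - c)) + pi `^ (1 - c) * (2 / (1 - c)))) => //.
  - move=> t /andP[t0 t1].
    have h1 : 0 < t / 2 by lra.
    have h2 : 0 < (2 * pi - t) / 2 by lra.
    have d1 := is_derive_powR _ t _ (1 - c) h1 (is_derive_half t).
    have d2 := is_derive_powR (fun t => (2 * pi - t) / 2) t _ (1 - c) h2 (dh t).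
    have e1 := is_deriveMr _ _ t _ _ d1 (is_derive_cst (2 / (1 - c)) t 1).
    have e2 := is_deriveMr _ _ t _ _ d2 (is_derive_cst (2 / (1 - c)) t 1).
    have := is_deriveBr _ _ t _ _ e1 e2.
    have E : 1 - c - 1 = - c by ring.
    have E2 (p q : R) : (1 - c) * p * 2^-1 * (2 / (1 - c)) + p * 0 -
        ((1 - c) * q * - 2^-1 * (2 / (1 - c)) + q * 0) = p + q.
      by field; rewrite gt_eqF.
    have E3 (p q r s : R) : (1 - c) * p * 2^-1 * (2 / (1 - c)) + r * 0 -
        ((1 - c) * q * - 2^-1 * (2 / (1 - c)) + s * 0) = p + q.
      by rewrite -E2 !mulr0.
    by rewrite E E3.
  - move=> t /andP[t0 t1].
    have h1 : 0 < t / 2 by lra.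
    have h2 : 0 < (2 * pi - t) / 2 by lra.
    have d1 := is_derive_powR _ t _ (- c) h1 (is_derive_half t).
    have d2 := is_derive_powR (fun t => (2 * pi - t) / 2) t _ (- c) h2 (dh t).
    have := is_deriveDr _ _ t _ _ d1 d2 => d.
    by apply: differentiable_continuous; apply/derivable1_diffP; case: d.
  - by move=> t _; rewrite addr_ge0// powR_ge0.
  - have k0 : 0 <= 2 / (1 - c) by rewrite divr_ge0// ltW.
    move=> t /andP[t0 t1]; rewrite (le_trans (ler_normB _ _))//.
    have B s : 0 <= s <= pi -> `|s `^ (1 - c) * (2 / (1 - c))| <= pi `^ (1 - c) * (2 / (1 - c)).
      move=> /andP[s0 s1].
      have e : s `^ (1 - c) <= pi `^ (1 - c).
        by apply: ge0_ler_powR => //; rewrite ?nnegrE ?pi_ge0// ltW.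
      have p1 : 0 <= s `^ (1 - c) * (2 / (1 - c)) by rewrite mulr_ge0// powR_ge0.
      by rewrite (ger0_norm p1); exact: ler_wpM2r.
    by apply: lerD; apply: B; apply/andP; split; lra.
apply: le_integrable i => //.
- by apply/measurable_EFinP; apply: measurable_funTS; exact: measurable_wt.
- move=> t; rewrite /= in_itv/= => /andP[t0 t1].
  rewrite lee_fin !ger0_norm ?wt_ge0 ?addr_ge0 ?powR_ge0//.
  have [tpi|tpi] := leP t pi.
    rewrite /f -[leLHS]addr0 lerD ?powR_ge0// powRN_anti//; first by lra.
    by have := @le_chord _ t; rewrite tpi ltW// => /(_ isT); lra.
  rewrite /f -[leLHS]add0r lerD ?powR_ge0// powRN_anti//; first by lra.
  have := @le_chord _ (2 * pi - t); rewrite chord_2pi.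
  have -> : (0 <= 2 * pi - t <= pi) by apply/andP; split; lra.
  by move/(_ isT); lra.
Qed.

(** A bounded Lipschitz regularization from below of [1 / chord]. The absolute value makes it
    [2 pi]-periodic: the chord itself changes sign from one period to the next. *)
Definition qker (c t : R) : R := (`|chord t| + c)^-1.

Lemma chord_lipschitz t h : `|chord (t + h) - chord t| <= `|h|.
Proof.
have := derive_bound_lipschitz chord _ 1 is_derive_chord (fun x => cos_max _) t h.
by rewrite mul1r.
Qed.

Lemma periodic_abs_chord : periodic (fun t => `|chord t|) (2 * pi).
Proof.
move=> t; rewrite /chord /=.
have -> : (t + 2 * pi) / 2 = t / 2 + pi by field.
by rewrite sinDpi mulrN normrN.
Qed.

Lemma qker_bound c t : 0 < c -> 0 <= qker c t <= c^-1.
Proof.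
move=> c0; have h : 0 < `|chord t| + c by rewrite ltr_wpDl.
by rewrite /qker invr_ge0 (ltW h)/= lef_pV2 ?posrE// lerDr.
Qed.

Lemma qker_lipschitz c t h : 0 < c -> `|qker c (t + h) - qker c t| <= c^-1 * c^-1 * `|h|.
Proof.
move=> c0; rewrite /qker; set p := `|chord (t + h)|; set q := `|chord t|.
have hp : 0 < p + c by rewrite ltr_wpDl ?normr_ge0.
have hq : 0 < q + c by rewrite ltr_wpDl ?normr_ge0.
have -> : (p + c)^-1 - (q + c)^-1 = (p + c)^-1 * (q + c)^-1 * (q - p).
  by field; rewrite !gt_eqF.
have /andP[p1 p2] := qker_bound c (t + h) c0.
have /andP[q1 q2] := qker_bound c t c0.
rewrite normrM ger0_norm ?mulr_ge0// ler_pM ?mulr_ge0//; first exact: ler_pM.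
rewrite distrC (le_trans (ler_dist_dist _ _))//.
exact: chord_lipschitz.
Qed.

Lemma continuous_qker c : 0 < c -> continuous (qker c).
Proof.
move=> c0; apply: (@lips_continuous _ (c^-1 * c^-1)) => t h.
exact: qker_lipschitz.
Qed.

Lemma intg_qker c : 0 < c -> intg (qker c).
Proof.
move=> c0; apply: (@intg_bounded _ _ c^-1).
  exact: continuous_measurable (continuous_qker c c0).
by move=> t; have /andP[q0 q1] := qker_bound c t c0; rewrite ger0_norm.
Qed.

(* The integral of 1/(chord + c) over the circle grows like ln(1/c). *)
Lemma J_qker_unbounded M : exists2 c, 0 < c & M <= J (qker c).
Proof.
(* Then [- ln c = M], and the integral of [1 / (t + c)] over the unit interval is already at least
   [M]. *)
pose c : R := expR (- M); have c0 : 0 < c by exact: expR_gt0.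
exists c => //.
have lnc : ln c = - M by rewrite expRK.
have h t : 0 <= t <= 1 -> 0 < t + c by move=> /andP[t0 _]; rewrite ltr_wpDl.
have d t : 0 <= t <= 1 -> is_derive (t : R) (1 : R) (fun t => ln (t + c)) ((t + c)^-1).
  move=> /h t0; exact: (is_derive_shift_arg (@ln R) _ _ _ (is_derive1_ln t0)).
have cinv t : 0 <= t <= 1 -> {for t, continuous (fun t => (t + c)^-1)}.
  move=> /h t0; apply: cvgV; first by rewrite gt_eqF.
  by apply: cvgD; [exact: cvg_id|exact: cvg_cst].
have E := @integral_primitive _ (fun t => (t + c)^-1) (fun t => ln (t + c)) 0 1 ltr01 d.
have {}E := E _.
have {}E : (\int[leb]_(x in `[0%R, 1%R]) ((x + c)^-1)%:E = (ln (1 + c) - ln (0 + c))%:E)%E.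
  by apply: E => t /cinv.
have i01 : leb.-integrable `]0, 1[ (EFin \o qker c).
  apply: integrableS (intg_qker c c0); [exact: measurable_itv|exact: measurable_itv|].
  by apply: subset_itvl; rewrite bnd_simp; have := pi_ge2 R; lra.
have mq : measurable_fun setT (EFin \o qker c).
  by apply/measurable_EFinP; exact: continuous_measurable (continuous_qker c c0).
have le1 : (\int[leb]_(x in `]0%R, 1%R[) (qker c x)%:E <= \int[leb]_(x in I2pi) (qker c x)%:E)%E.
  apply: ge0_subset_integral => //.
  - exact: measurable_funTS.
  - by move=> x _; rewrite lee_fin; have /andP[] := qker_bound c x c0.
  - by apply: subset_itvl; rewrite bnd_simp; have := pi_ge2 R; lra.
have le2 : (\int[leb]_(x in `[0%R, 1%R]) ((x + c)^-1)%:E <= \int[leb]_(x in `]0%R, 1%R[) (qker c x)%:E)%E.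
  rewrite -(@integral_itv_bndoo _ 0 1 (EFin \o qker c) true false); last exact: measurable_funTS.
  apply: ge0_le_integral => //.
  - by move=> x; rewrite /= in_itv/= => xi; rewrite lee_fin invr_ge0 ltW// h.
  - apply/measurable_EFinP; apply: subspace_continuous_measurable_fun => //.
    apply: continuous_in_subspaceT => t; rewrite inE/= in_itv/=.
    exact: cinv.
  - exact: measurable_funTS.
  - move=> x; rewrite /= in_itv/= => xi; rewrite lee_fin /qker.
    have /andP[x0 x1] := xi.
    have cx : 0 <= chord x.
      have [->|xn] := eqVneq x 0; first by rewrite /chord mul0r sin0 mulr0.
      apply/ltW/chord_gt0; rewrite lt_neqAle eq_sym xn x0/=.
      by have := pi_ge2 R; lra.
    have a0 : 0 < `|chord x| + c by rewrite ltr_wpDl.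
    have b0 := h _ xi.
    have le3 : `|chord x| + c <= x + c by rewrite (ger0_norm cx) lerD2r chord_le.
    by rewrite lef_pV2 ?posrE.
have := le_trans le2 le1; rewrite E.
have /integrable_fin_num := intg_qker c c0.
rewrite /J /Rintegral => /(_ (measurable_itv _)) fJ.
rewrite -(fineK fJ) lee_fin => /(le_trans _); apply.
rewrite add0r lnc opprK lerDr ln_ge0//.
by rewrite lerDl ltW.
Qed.

End weights.

Section maximum_principle.
Context {R : realType}.
Implicit Types (f g u : R -> R) (x y z t a b c h A B C : R).
Local Notation leb := (@lebesgue_measure R).

Lemma periodic_EVT f : continuous f -> periodic f (2 * pi) ->
  exists x, forall y, f y <= f x.
Proof.
move=> cf pf; have [x _ mx] := @EVT_max R f 0 (2 * pi) (ltW pi2_gt0) (continuous_subspaceT cf).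
exists x => y; have [n /andP[y0 y1]] := period_reduce y.
by rewrite -(periodic_int f n y pf) mx// in_itv/= y0 ltW.
Qed.

Lemma diff2_continuous f a h : continuous f -> continuous (diff2 f a h).
Proof.
move=> cf x.
have c1 b y : {for y, continuous (fun z => f (z + b))}.
  apply: (@continuous_comp R R R (fun z => z + b) f); last exact: cf.
  by apply: cvgD; [exact: cvg_id|exact: cvg_cst].
have c2 : {for x, continuous (fun z => f (z + a + h))}.
  apply: (@continuous_comp R R R (fun z => z + a) (fun z => f (z + h))); last exact: c1.
  by apply: cvgD; [exact: cvg_id|exact: cvg_cst].
by apply: cvgB; apply: cvgB; [exact: c2|exact: c1|exact: c1|exact: cf].
Qed.

Lemma lips_shift_diff C f h : lips C f -> lips (2 * C) (fun z => f (z + h) - f z).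
Proof.
move=> lf x b.
have -> : f (x + b + h) - f (x + b) - (f (x + h) - f x) =
    (f (x + h + b) - f (x + h)) - (f (x + b) - f x) by rewrite (addrAC x h); ring.
by rewrite (le_trans (ler_normB _ _))// mulr_natl mulr2n mulrDl lerD.
Qed.

Lemma diff2_periodic f a h p : periodic f p -> periodic (diff2 f a h) p.
Proof. by move=> pf x; rewrite /diff2 !(addrAC _ p) !pf. Qed.

Lemma dq_diff2 f a h x t : diff2 ((dq f) ^~ t) a h x = dq (diff2 f a h) x t.
Proof. by rewrite /diff2 /dq !(addrAC _ (- t)); ring. Qed.

(** A discrete integration by parts: translation invariance moves the increment of step [a] from [f]
    to the Lipschitz kernel, which gains the factor [|a|] using only a sup bound on [f]. *)
Lemma J_qker_by_parts f c B x a : 0 < c -> 0 <= B -> continuous f ->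
  periodic f (2 * pi) -> (forall y, `|f y| <= B) ->
  `|J (fun t => (f (x + a - t) - f (x - t)) * qker c t)|
     <= B * (c^-1 * c^-1 * `|a|) * J (fun=> 1).
Proof.
move=> c0 B0 cf pf bf.
have pq : periodic (qker c) (2 * pi).
  by move=> t; rewrite /qker; have := periodic_abs_chord t => /= ->.
have mq := continuous_measurable _ (continuous_qker c c0).
have mf b : measurable_fun setT (fun t => f (b - t)).
  apply: (measurableT_comp (continuous_measurable f cf)).
  exact: measurable_funB.
have iq := intg_qker c c0.
have iqa : intg (fun t => qker c (t + a)).
  apply: (@intg_bounded _ _ c^-1).
    by apply: (measurableT_comp mq); exact: measurable_funD.
  by move=> t; have /andP[q0 q1] := qker_bound c (t + a) c0; rewrite ger0_norm.
have i1 b : intg (fun t => f (b - t) * qker c t) by exact: (@intgM _ _ _ B).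
have i2 : intg (fun t => f (x - t) * qker c (t + a)) by exact: (@intgM _ _ _ B).
have -> : J (fun t => (f (x + a - t) - f (x - t)) * qker c t) =
    J (fun t => f (x - t) * (qker c (t + a) - qker c t)).
  transitivity (J (fun t => f (x + a - t) * qker c t) - J (fun t => f (x - t) * qker c t)).
    by rewrite -JB//; apply: eq_J => t _; rewrite mulrBl.
  have -> : J (fun t => f (x + a - t) * qker c t) = J (fun t => f (x - t) * qker c (t + a)).
    rewrite -(J_translation (fun t => f (x + a - t) * qker c t) a).
    - by apply: eq_J => t _; congr (f _ * _); ring.
    - exact: measurable_funM.
    - move=> t; rewrite pq; congr (_ * _).
      have -> : x + a - t = x + a - (t + 2 * pi) + 2 * pi by ring.
      by rewrite pf.
  by rewrite -JB//; apply: eq_J => t _; rewrite mulrBr.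
have i1' : intg (fun=> 1 : R) by apply: (@intg_bounded _ _ 1) => // t; rewrite normr1.
rewrite -JZ//; apply: abs_J_le.
- apply: (@intgM _ _ _ B) => //; exact: intgB.
- exact: intgZ.
- move=> t _; rewrite mulr1 normrM ler_pM// ?mulr_ge0//.
  exact: qker_lipschitz.
Qed.

Lemma geometric_closure (A0 B w : R) : 0 <= A0 ->
  (forall n : nat, w <= (A0 / 2 ^+ n + B)) -> w <= B.
Proof.
move=> A00 H; rewrite leNgt; apply/negP => Bw.
have e0 : 0 < w - B by rewrite subr_gt0.
pose n := (Num.trunc (A0 / (w - B))).+1.
have nP : A0 / (w - B) < n%:R by rewrite truncnS_gt// divr_ge0// ltW.
have n2 : (n%:R : R) <= 2 ^+ n by rewrite -natrX ler_nat ltnW// ltn_expl.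
have p2 : 0 < 2 ^+ n :> R by rewrite exprn_gt0.
have := H n; rewrite -lerBlDr ler_pdivlMr// => H1.
have := lt_le_trans nP n2; rewrite ltr_pdivrMr// mulrC => H2.
by have := le_lt_trans H1 H2; rewrite ltxx.
Qed.

(* At a maximum [x0] of [W = diff2 u a h] the quotient [dq W x0] is nonnegative,
   so the kernel may be replaced by the smaller one [c0 / 2 * qker eta - D0],
   whose integral is as large as wanted, while the integral of [W] against this
   Lipschitz kernel is [O(|a| |h|)] since [W] is a difference of step [a].  The
   equation, differenced twice, improves a bound [A] valid for [h] to [A / 2 + B],
   and iterating gives [2 B]. *)
Theorem second_difference_bound u (kap : R -> R -> R) g L gam dl Cm c0 s0 :
  0 <= L -> lips L u -> periodic u (2 * pi) -> 0 <= gam -> 0 <= dl -> gam + dl < 1 ->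
  let P h A := forall x a, `|diff2 u a h x| <= A * `|a| * `|h| in
  Ycls P 0 kap -> Ycls P 0 (fun x _ => g x) ->
  (forall x, J (fun t => dq u x t * kap x t * wt gam t) = g x) ->
  0 <= Cm ->
  (forall a h x y t, 0 < t < 2 * pi ->
     `|dq (fun z => u (z + a) - u z) x t * (kap (y + h) t - kap y t)|
       <= Cm * `|a| * `|h| * wt dl t) ->
  0 < c0 -> 0 < s0 ->
  (forall x t, 0 < t < 2 * pi -> chord t < s0 -> c0 <= kap x t) ->
  exists2 C, 0 <= C & forall a h x, `|diff2 u a h x| <= C * `|a| * `|h|.
Proof.
move=> L0 lu pu gam0 dl0 gd1 P Yk Yg E Cm0 Hmix c00 s00 kpos.
have cu : continuous u := lips_continuous _ _ lu.
have [mk [C1 C10 [bk lk dk]]] := Yk.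
have [_ [C2 C20 [_ _ dg]]] := Yg.
have iw : intg (wt gam) by apply: intg_wt; rewrite gam0/=; lra.
have igd : intg (wt (gam + dl)) by apply: intg_wt; rewrite addr_ge0.
have i1 : intg (fun=> 1 : R) by apply: (@intg_bounded _ _ 1) => // t; rewrite normr1.
pose T := J (wt gam); pose T2 := J (wt (gam + dl)); pose S := J (fun=> 1 : R).
have T0 : 0 <= T by apply: J_ge0 => t _; exact: wt_ge0.
have T20 : 0 <= T2 by apply: J_ge0 => t _; exact: wt_ge0.
have S0 : 0 <= S by apply: J_ge0.
(* Per unit of [|a| |h|], [K1 * (1 + A) + K2] bounds all that remains of the differenced equation
   besides the integral of [dq W x0 * kap x0]. *)
pose K1 := C2 + 2 * L * C1 * T; pose K2 := 2 * Cm * T2.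
have K10 : 0 <= K1 by rewrite addr_ge0// !mulr_ge0.
have K20 : 0 <= K2 by rewrite !mulr_ge0.
(* Subtracting [D0] covers the region [chord t >= s0], where the sign of [kap] is unknown: its first
   term bounds the true kernel there, its second the part [c0 / 2 * qker eta]. *)
pose D0 := C1 * (s0^-1 * s0 `^ (- gam)) + c0 / 2 / s0.
have D00 : 0 <= D0.
  apply: addr_ge0; first by rewrite !mulr_ge0 ?powR_ge0// invr_ge0 ltW.
  by rewrite !divr_ge0// ltW.
(* The value is chosen to make the integral of [q] at least [2 * K1 + 1], so that the coefficient of
   [A] becomes at most one half. *)
have [eta eta0 etaP] := J_qker_unbounded ((2 * K1 + 1 + D0 * S) * 2 / c0).
pose K3 := L * (c0 / 2) * (eta^-1 * eta^-1) * S.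
have c20 : 0 <= c0 / 2 by rewrite divr_ge0// ltW.
have ei0 : 0 <= eta^-1 by rewrite invr_ge0 ltW.
have K30 : 0 <= K3 by apply: mulr_ge0 => //; apply: mulr_ge0; exact: mulr_ge0.
pose B := K1 + K2 + K3.
have B0 : 0 <= B := addr_ge0 (addr_ge0 K10 K20) K30.
pose q t := c0 / 2 * qker eta t - D0.
have iq : intg q.
  apply: intgB; first by apply: intgZ; exact: intg_qker.
  by apply: (@intg_bounded _ _ `|D0|).
have mq : measurable_fun setT q.
  apply: measurable_funB => //; apply: measurable_funM => //.
  exact: continuous_measurable (continuous_qker eta eta0).
have Jq : 2 * K1 + 1 <= J q.
  rewrite JB; [|by apply: intgZ; exact: intg_qker|by apply: (@intg_bounded _ _ `|D0|)].
  rewrite JZ; last exact: intg_qker.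
  have -> : J (fun=> D0) = D0 * S.
    by rewrite -JZ//; apply: eq_J => t _; rewrite mulr1.
  have c2 : 0 <= c0 / 2 by rewrite divr_ge0// ltW.
  have := ler_wpM2l c2 etaP.
  have -> : c0 / 2 * ((2 * K1 + 1 + D0 * S) * 2 / c0) = 2 * K1 + 1 + D0 * S.
    by field; rewrite gt_eqF.
  lra.
have kq x t : 0 < t < 2 * pi -> q t <= kap x t * (chord t)^-1 * wt gam t.
  move=> tI; have ct := chord_gt0 _ tI.
  have ic0 : 0 < (chord t)^-1 by rewrite invr_gt0.
  have cq : c0 / 2 * qker eta t <= c0 / 2 * (chord t)^-1.
    apply: ler_wpM2l => //; rewrite /qker (gtr0_norm ct).
    by rewrite lef_pV2 ?posrE ?addr_gt0// lerDl ltW.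
  have [cs|sc] := ltP (chord t) s0.
    have kc := kpos x t tI cs.
    (* Since [chord t <= 2] and [gam <= 1]; this is where [c0] loses a factor 2. *)
    have w2 : 2^-1 <= wt gam t.
      rewrite -powR_inv1// /wt (@le_trans _ _ (2 `^ (- gam)))//.
        by apply: ler_powR; rewrite ?ler1n//; lra.
      by apply: powRN_anti => //; exact: chord_le2.
    have h1 : c0 * 2^-1 <= kap x t * wt gam t.
      by apply: ler_pM => //; exact: ltW.
    have h2 : c0 / 2 * (chord t)^-1 <= kap x t * wt gam t * (chord t)^-1.
      by rewrite ler_wpM2r// ltW.
    have h3 : kap x t * wt gam t * (chord t)^-1 = kap x t * (chord t)^-1 * wt gam t by ring.
    by move: cq h2 D00; rewrite h3 /q; clear; lra.
  have h1 : (chord t)^-1 <= s0^-1 by rewrite lef_pV2 ?posrE.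
  have h2 : wt gam t <= s0 `^ (- gam) by exact: powRN_anti.
  have h3 : (chord t)^-1 * wt gam t <= s0^-1 * s0 `^ (- gam).
    by apply: ler_pM => //; rewrite ?wt_ge0 ?ltW.
  have h4 : `|kap x t * ((chord t)^-1 * wt gam t)| <= C1 * (s0^-1 * s0 `^ (- gam)).
    by apply: ler_prod_norm => //; rewrite ger0_norm// mulr_ge0 ?wt_ge0// ltW.
  have h5 := ler_wpM2l (divr_ge0 (ltW c00) (ler0n R 2)) h1.
  move: h4; rewrite ler_norml mulrA => /andP[h4 _].
  by move: cq h4 h5; rewrite /q /D0; clear; lra.
have step h A : 0 <= A -> P h A -> forall a x, diff2 u a h x <= (A / 2 + B) * `|a| * `|h|.
  move=> A0 PA a.
  have ah0 : 0 <= `|a| * `|h| by rewrite mulr_ge0.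
  pose W := diff2 u a h.
  have cW : continuous W by exact: diff2_continuous.
  have pW : periodic W (2 * pi) by exact: diff2_periodic.
  have [x0 mx0] := periodic_EVT W cW pW.
  move=> x; rewrite (le_trans (mx0 x))// -mulrA.
  have [W0|W0] := leP (W x0) 0.
    by rewrite (le_trans W0)// mulr_ge0// addr_ge0// divr_ge0.
  pose k y t := dq u y t * kap y t.
  have bdq y t : `|dq u y t| <= 2 * L by exact: dq_le.
  have mdq y : measurable_fun setT (dq u y) by exact: measurable_dq.
  have mkk y : measurable_fun setT (k y) by exact: measurable_funM.
  have bkk y t : `|k y t| <= 2 * L * C1 by exact: ler_prod_norm.
  have ikk y := intgM _ _ _ (mkk y) (bkk y) iw.
  have lW : lips (2 * (2 * L)) W.
    apply: (lips_shift_diff _ (fun z => u (z + h) - u z) a) => y b.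
    exact: (lips_shift_diff L u h lu y b).
  have mW y : measurable_fun setT (dq W y) by exact: measurable_dq.
  have bW y t : `|dq W y t| <= 2 * (2 * (2 * L)) by apply: dq_le => //; rewrite !mulr_ge0.
  pose e y t := diff2 (k ^~ t) a h y - dq W y t * kap y t.
  have Jd : diff2 g a h x0 = J (fun t => diff2 (k ^~ t) a h x0 * wt gam t).
    have ik y : intg (fun t => dq u y t * kap y t * wt gam t) by exact: ikk.
    rewrite /diff2 -!E.
    rewrite -(JB _ _ (ik (x0 + a + h)) (ik (x0 + a))) -(JB _ _ (ik (x0 + h)) (ik x0)).
    rewrite -JB; [|exact: intgB|exact: intgB].
    by apply: eq_J => t _; rewrite /k; ring.
  have mdk : measurable_fun setT (fun t => diff2 (k ^~ t) a h x0).
    by rewrite /diff2; apply: measurable_funB; apply: measurable_funB; exact: mkk.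
  have iWk : intg (fun t => dq W x0 t * kap x0 t * wt gam t).
    apply: (@intgM _ _ _ (2 * (2 * (2 * L)) * C1)) => //.
      exact: measurable_funM.
    by move=> t; exact: ler_prod_norm.
  have idk : intg (fun t => diff2 (k ^~ t) a h x0 * wt gam t).
    have H := intgB _ _ (intgB _ _ (ikk (x0 + a + h)) (ikk (x0 + a)))
      (intgB _ _ (ikk (x0 + h)) (ikk x0)).
    by apply: eq_intg H => t _; rewrite /diff2; ring.
  have bE t : 0 < t < 2 * pi -> `|e x0 t * wt gam t| <=
     `|a| * `|h| * (2 * L * C1 * (1 + A)) * wt gam t
     + `|a| * `|h| * (2 * Cm) * wt (gam + dl) t.
    move=> tI; have ct := chord_gt0 _ tI.
    (* Leibniz: two products of first increments, controlled by [Hmix] and integrable against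
       [wt (gam + dl)], and one second difference of [kap], which is the only term to bring in
       [A]. *)
    have -> : e x0 t =
        dq (fun z => u (z + h) - u z) (x0 + a) t * (kap (x0 + a) t - kap x0 t)
      + dq (fun z => u (z + a) - u z) (x0 + h) t * (kap (x0 + h) t - kap x0 t)
      + dq u (x0 + a + h) t * diff2 (kap ^~ t) a h x0.
      rewrite /e /k diff2M dq_diff2 -/W.
      have dE b z : dq (fun z => u (z + b) - u z) z t = dq u (z + b) t - dq u z t.
        by rewrite /dq (addrAC z b); ring.
      by rewrite !dE; ring.
    have wE : wt gam t * wt dl t = wt (gam + dl) t.
      by rewrite /wt opprD powRD// (gt_eqF ct) implybT.
    have f1 := Hmix h a (x0 + a) x0 t tI.
    have f2 := Hmix a h (x0 + h) x0 t tI.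
    have f3 := ler_prod_norm _ _ _ _ (bdq (x0 + a + h) t) (dk h A A0 PA x0 a t).
    rewrite normrM (ger0_norm (wt_ge0 gam t)) -wE.
    have H := ler_wpM2r (wt_ge0 gam t) (le_trans (ler_normD _ _)
      (lerD (le_trans (ler_normD _ _) (lerD f1 f2)) f3)).
    by apply: (le_trans H); rewrite le_eqVlt; apply/orP; left; apply/eqP; ring.
  have ibE : intg (fun t => `|a| * `|h| * (2 * L * C1 * (1 + A)) * wt gam t
     + `|a| * `|h| * (2 * Cm) * wt (gam + dl) t).
    by apply: intgD; exact: intgZ.
  have ie : intg (fun t => e x0 t * wt gam t).
    by apply: eq_intg (intgB _ _ idk iWk) => t _; rewrite /e [RHS]mulrBl.
  have JE := abs_J_le _ _ ie ibE bE.
  rewrite JD in JE; [|exact: intgZ|exact: intgZ].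
  rewrite !JZ// -/T -/T2 in JE.
  have JW : J (fun t => dq W x0 t * kap x0 t * wt gam t) =
      diff2 g a h x0 - J (fun t => e x0 t * wt gam t).
    by rewrite Jd -JB//; apply: eq_J => t _; rewrite /e; ring.
  have up : J (fun t => dq W x0 t * kap x0 t * wt gam t) <= `|a| * `|h| * (K1 * (1 + A) + K2).
    have := dg h A A0 PA x0 a 0; rewrite JW ler_norml => /andP[_ d1].
    move: JE; rewrite ler_norml => /andP[j1 _].
    move: d1 j1; rewrite /K1 /K2; clear; lra.
  have iWq : intg (fun t => W (x0 - t) * q t).
    have [z bz] := periodic_EVT (fun y => `|W y|)
      (fun y => cvg_norm (cW y)) (fun y => congr1 _ (pW y)).
    apply: (@intgM _ _ _ `|W z|) => //.
    apply: (measurableT_comp (continuous_measurable W cW)).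
    exact: measurable_funB.
  have low : W x0 * J q - J (fun t => W (x0 - t) * q t) <=
      J (fun t => dq W x0 t * kap x0 t * wt gam t).
    rewrite -JZ// -JB//; last exact: intgZ.
    apply: le_J => //; first by apply: intgB => //; exact: intgZ.
    move=> t tI; rewrite -mulrBl.
    have -> : dq W x0 t * kap x0 t * wt gam t =
        (W x0 - W (x0 - t)) * (kap x0 t * (chord t)^-1 * wt gam t).
      by rewrite /dq ichordE//; ring.
    by apply: ler_wpM2l; [rewrite subr_ge0|exact: kq].
  pose V y := u (y + h) - u y.
  have cV : continuous V.
    by apply: (@lips_continuous _ (2 * L)); exact: lips_shift_diff.
  have pV : periodic V (2 * pi) by move=> y; rewrite /V addrAC !pu.
  have Lh0 : 0 <= L * `|h| by rewrite mulr_ge0.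
  have par := J_qker_by_parts V eta (L * `|h|) x0 a eta0 Lh0 cV pV (fun y => lu y h).
  have iVq : intg (fun t => (V (x0 + a - t) - V (x0 - t)) * qker eta t).
    apply: (@intgM _ _ _ (L * `|h| + L * `|h|)); last exact: intg_qker.
      apply: measurable_funB; apply: (measurableT_comp (continuous_measurable V cV));
        exact: measurable_funB.
    by move=> t; rewrite (le_trans (ler_normB _ _))// lerD//; exact: lu.
  have WV t : W (x0 - t) = V (x0 + a - t) - V (x0 - t).
    by rewrite /W /diff2 /V !(addrAC _ (- t)).
  have iVV : intg (fun t => V (x0 + a - t) - V (x0 - t)).
    apply: (@intg_bounded _ _ (L * `|h| + L * `|h|)).
      apply: measurable_funB; apply: (measurableT_comp (continuous_measurable V cV));
        exact: measurable_funB.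
    by move=> t; rewrite (le_trans (ler_normB _ _))// lerD//; exact: lu.
  (* The constant [- D0] in [q] contributes nothing to the integral of [W * q], since [W] is an
     increment of the periodic [V] and integrates to zero. *)
  have JVV : J (fun t => V (x0 + a - t) - V (x0 - t)) = 0.
    have iV b : intg (fun t => V (b - t)).
      apply: (@intg_bounded _ _ (L * `|h|)); last by move=> t; exact: lu.
      apply: (measurableT_comp (continuous_measurable V cV)).
      exact: measurable_funB.
    have mV := continuous_measurable V cV.
    by rewrite JB// !J_reflection// subrr.
  have JWq : J (fun t => W (x0 - t) * q t) =
      c0 / 2 * J (fun t => (V (x0 + a - t) - V (x0 - t)) * qker eta t).
    rewrite -[RHS](addr0 _) -[in RHS](mulr0 (- D0)) -JVV -!JZ// -JD; last 2 first.
    - exact: intgZ.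
    - exact: intgZ.
    by apply: eq_J => t _; rewrite WV /q; ring.
  have JWq2 : J (fun t => W (x0 - t) * q t) <= `|a| * `|h| * K3.
    rewrite JWq; have c2 : 0 <= c0 / 2 by rewrite divr_ge0// ltW.
    move: par; rewrite ler_norml => /andP[_ par].
    move: (ler_wpM2l c2 par); rewrite /K3 -/S; clear; lra.
  have main : W x0 * (2 * K1 + 1) <= `|a| * `|h| * (K1 * A + B).
    move: (ler_wpM2l (ltW W0) Jq) low up JWq2; rewrite /B; clear; lra.
  have k1 : 0 < 2 * K1 + 1 by apply: ltr_wpDl => //; exact: mulr_ge0.
  rewrite -(ler_pM2r k1) (le_trans main)//.
  have q1 : 0 <= `|a| * `|h| * A by rewrite mulr_ge0.
  have q2 : 0 <= `|a| * `|h| * B * K1 by apply: mulr_ge0 => //; exact: mulr_ge0.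
  move: q1 q2; clear; lra.
(* The second difference for [- h] is minus a translate of the one for [h], so the upper bound for
   [- h] is the lower bound for [h]. *)
have half h A : 0 <= A -> P h A -> P h (A / 2 + B).
  move=> A0 PA x a; rewrite ler_norml; apply/andP; split; last exact: step.
  have PA' : P (- h) A.
    move=> y b; have -> : diff2 u b (- h) y = - diff2 u b h (y - h).
      by rewrite /diff2 subrK (addrAC y (- h)) subrK; ring.
    by rewrite !normrN; exact: PA.
  have := step (- h) A A0 PA' a (x + h).
  have -> : diff2 u a (- h) (x + h) = - diff2 u a h x.
    by rewrite /diff2 (addrAC x h) !addrK; ring.
  by rewrite normrN lerNl.
exists (2 * B); first by rewrite mulr_ge0.
move=> a h x; have [->|h0] := eqVneq h 0.
  by rewrite /diff2 !addr0 !subrr normr0 mulr0.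
have [->|a0] := eqVneq a 0.
  by rewrite /diff2 !addr0 subrr normr0 mulr0 mul0r.
have h0' : 0 < `|h| by rewrite normr_gt0.
have a0' : 0 < `|a| by rewrite normr_gt0.
(* The only bound available at the start. It blows up as [h] tends to 0, but contributes
   [A0 / 2 ^+ n] after [n] rounds, while [2 * B] does not depend on [h]. *)
pose A0 := 2 * L / `|h|.
have A00 : 0 <= A0 by rewrite divr_ge0// mulr_ge0.
have PA0 : P h A0.
  move=> y b; have -> : A0 * `|b| * `|h| = L * `|b| + L * `|b|.
    by rewrite /A0; field; rewrite gt_eqF.
  have -> : diff2 u b h y = (u (y + h + b) - u (y + h)) - (u (y + b) - u y).
    by rewrite /diff2 -/(u _) (addrAC y b h) addrAC; ring.
  by rewrite (le_trans (ler_normB _ _))// lerD.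
have PAn n : P h (A0 / 2 ^+ n + 2 * B).
  elim: n => [|n IH].
    move=> y b; rewrite (le_trans (PA0 y b))// ler_wpM2r// ler_wpM2r//.
    by rewrite expr0 divr1 lerDl mulr_ge0.
  have An : 0 <= A0 / 2 ^+ n + 2 * B.
    by rewrite addr_ge0 ?mulr_ge0// invr_ge0 exprn_ge0.
  have := half h _ An IH.
  have -> : (A0 / 2 ^+ n + 2 * B) / 2 + B = A0 / 2 ^+ n.+1 + 2 * B => //.
  by rewrite exprS; field; rewrite expf_neq0.
rewrite -ler_pdivrMr// -ler_pdivrMr//.
apply: (geometric_closure A0) => // n.
by rewrite ler_pdivrMr// ler_pdivrMr//; exact: PAn.
Qed.

End maximum_principle.

(** * From second differences to one more derivative *)

Section regularity_step.
Context {R : realType}.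
Implicit Types (f g u p : R -> R) (x y z t a b c h A B C L : R).
Implicit Types (P : R -> R -> Prop) (k kap : R -> R -> R).

(** Passing from [n] to [n + 1] steps adds the second difference with steps [n h] and [h], at most
    [C (n h) h]; the sum stays below [C (n h)^2]. *)
Lemma telescoped_diff2 u C x h (n : nat) : 0 <= C ->
  (forall a h x, `|diff2 u a h x| <= C * `|a| * `|h|) -> 0 <= h ->
  `|u (x + n%:R * h) - u x - n%:R * (u (x + h) - u x)| <= C * (n%:R * h) ^+ 2.
Proof.
move=> C0 d2 h0; elim: n => [|n IH].
  by rewrite !mul0r addr0 subrr subr0 normr0 expr2 !mul0r mulr0.
have -> : u (x + n.+1%:R * h) - u x - n.+1%:R * (u (x + h) - u x) =
   (u (x + n%:R * h) - u x - n%:R * (u (x + h) - u x)) + diff2 u (n%:R * h) h x.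
  by rewrite /diff2 -natr1 mulrDl mul1r addrA; ring.
have n0 : 0 <= n%:R * h by rewrite mulr_ge0.
have := d2 (n%:R * h) h x; rewrite (ger0_norm n0) (ger0_norm h0) => d.
rewrite (le_trans (ler_normD _ _))// (le_trans (lerD IH d))//.
have -> : n.+1%:R * h = n%:R * h + h by rewrite -natr1; ring.
have q1 : 0 <= C * (n%:R * h) * h by rewrite !mulr_ge0.
have q2 : 0 <= C * h * h by rewrite !mulr_ge0.
rewrite !expr2; move: q1 q2; clear; lra.
Qed.

(** Divide [h = n h' + r] with [0 <= r <= h']: the [n] whole steps cost [C h^2] by telescoping, and
    each of the two terms with [r] costs at most [L h']. *)
Lemma quotient_compare u C L x h h' : 0 <= C -> 0 <= L -> lips L u ->
  (forall a h x, `|diff2 u a h x| <= C * `|a| * `|h|) -> 0 < h' -> h' <= h ->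
  `|(u (x + h) - u x) / h - (u (x + h') - u x) / h'| <= C * h + 2 * L * (h' / h).
Proof.
move=> C0 L0 lu d2 h'0 h'h; have h0 : 0 < h by exact: lt_le_trans h'h.
pose n := Num.trunc (h / h'); pose r := h - n%:R * h'.
have hh0 : 0 <= h / h' by rewrite divr_ge0// ltW.
have r0 : 0 <= r by rewrite subr_ge0 -ler_pdivlMr// truncn_le.
have r1 : r <= h'.
  have := truncnS_gt (h / h'); rewrite -/n ltr_pdivrMr// -natr1 mulrDl mul1r => ?.
  by rewrite /r lerBlDl ltW.
have E : (u (x + h) - u x) / h - (u (x + h') - u x) / h' =
   ((u (x + n%:R * h' + r) - u (x + n%:R * h'))
    + (u (x + n%:R * h') - u x - n%:R * (u (x + h') - u x))
    - r / h' * (u (x + h') - u x)) / h.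
  have -> : x + n%:R * h' + r = x + h by rewrite /r; ring.
  by rewrite /r; field; rewrite !gt_eqF.
rewrite E normrM normfV (gtr0_norm h0) ler_pdivrMr//.
have e1 := lu (x + n%:R * h') r; rewrite (ger0_norm r0) in e1.
have e2 := telescoped_diff2 u C x h' n C0 d2 (ltW h'0).
have e3 := lu x h'; rewrite (gtr0_norm h'0) in e3.
have e1' : L * r <= L * h' by rewrite ler_wpM2l.
have e2' : C * (n%:R * h') ^+ 2 <= C * h ^+ 2.
  rewrite ler_wpM2l// ler_sqr ?nnegrE ?(ltW h0) ?mulr_ge0 ?(ltW h'0)//.
  by rewrite -subr_ge0.
have rh : 0 <= r / h' <= 1 by rewrite divr_ge0 ?(ltW h'0)//= ler_pdivrMr// mul1r.
have e3' : `|r / h' * (u (x + h') - u x)| <= L * h'.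
  rewrite normrM (ger0_norm (andP rh).1) (le_trans _ e3)// ler_piMl//.
  by case/andP: rh.
have -> : (C * h + 2 * L * (h' / h)) * h = C * h ^+ 2 + L * h' + L * h'.
  by field; rewrite gt_eqF.
apply: (le_trans (ler_normB _ _)); apply: lerD => //.
apply: (le_trans (ler_normD _ _)); rewrite addrC; apply: lerD.
  exact: le_trans e2 e2'.
exact: le_trans e1 e1'.
Qed.

(** The difference quotients are Cauchy: they are compared at a fixed small [h0] and at steps much
    smaller than [h0]. A negative step differs from the opposite one by the second difference with
    steps [- h] and [h]. *)
Lemma derivable_diff2 u C L : 0 <= C -> 0 <= L -> lips L u ->
  (forall a h x, `|diff2 u a h x| <= C * `|a| * `|h|) ->
  forall x : R, derivable u x 1.
Proof.
move=> C0 L0 lu d2 x; rewrite /derivable.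
have -> : (fun h : R => h^-1 *: ((u \o shift x) (h *: (1 : R)) - u x)) =
    fun h : R => (u (x + h) - u x) / h.
  by apply/funext => h; rewrite /= /GRing.scale /= mulr1 mulrC (addrC h).
apply/cauchy_cvgP/cauchy_exP => e e0.
have C1 : 0 < C + 1 by rewrite ltr_wpDl.
have L1 : 0 < L + 1 by rewrite ltr_wpDl.
(* The budget is [e / 8] for [C * h0], [2 e / 8] for [2 * L * (h' / h0)], and [e / 8] for the change
   of sign of the step. *)
pose h0 := e / (8 * (C + 1)).
have h00 : 0 < h0 by rewrite divr_gt0// mulr_gt0.
have Ch : C * h0 <= e / 8.
  have -> : C * h0 = (e / 8) * (C / (C + 1)) by rewrite /h0; field; rewrite gt_eqF.
  rewrite ler_piMr//; first by rewrite divr_ge0// ltW.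
  by rewrite ler_pdivrMr// mul1r lerDl.
have Le0 : 0 < h0 * e / (8 * (L + 1)) by apply: divr_gt0; exact: mulr_gt0.
exists ((u (x + h0) - u x) / h0).
exists (Num.min h0 (h0 * e / (8 * (L + 1)))) => /=; first by rewrite lt_min h00.
have key h' y : 0 < h' -> h' < h0 -> h' < h0 * e / (8 * (L + 1)) ->
  `|(u (y + h0) - u y) / h0 - (u (y + h') - u y) / h'| <= e * 3 / 8.
  move=> h'0 h'h h'e.
  have := quotient_compare u C L y h0 h' C0 L0 lu d2 h'0 (ltW h'h).
  move/le_trans; apply.
  have : 2 * L * (h' / h0) <= e * 2 / 8.
    have i0 : 0 < h0^-1 by rewrite invr_gt0.
    have h'1 : h' / h0 <= e / (8 * (L + 1)).
      by rewrite ler_pdivrMr// mulrC mulrA ltW.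
    have l2 : 0 <= 2 * L by rewrite mulr_ge0.
    have := ler_wpM2l l2 h'1.
    have -> : 2 * L * (e / (8 * (L + 1))) = (e * 2 / 8) * (L / (L + 1)).
      by field; rewrite gt_eqF.
    move/le_trans; apply; rewrite ler_piMr//; first by rewrite divr_ge0// mulr_ge0// ltW.
    by rewrite ler_pdivrMr// mul1r lerDl.
  by move: Ch; clear; lra.
move=> h /=; rewrite sub0r normrN lt_min => /andP[hh he] hn0.
rewrite /ball/=.
have [hp|hneg|h0e] := ltgtP 0 h; last by rewrite -h0e eqxx in hn0.
  rewrite (gtr0_norm hp) in hh he.
  have := key h x hp hh he => /le_lt_trans; apply; lra.
rewrite (ltr0_norm hneg) in hh he.
have nh : 0 < - h by rewrite oppr_gt0.
have := key (- h) x nh hh he => k1.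
have k2 : `|(u (x - h) - u x) / - h - (u (x + h) - u x) / h| <= e / 8.
  have -> : (u (x - h) - u x) / - h - (u (x + h) - u x) / h =
      diff2 u (- h) h x / h.
    by rewrite /diff2 subrK; field; rewrite lt_eqF.
  rewrite normrM normfV ler_pdivrMr ?normr_gt0//.
  rewrite (le_trans (d2 _ _ _))// ler_wpM2r// normrN (le_trans _ Ch)// ler_wpM2l//.
  by rewrite ltr0_norm// ltW.
have := ler_distD ((u (x - h) - u x) / - h) ((u (x + h0) - u x) / h0) ((u (x + h) - u x) / h).
by move=> /le_lt_trans; apply; move: k1 k2 e0; clear; lra.
Qed.

Lemma lips_derive_le L f (x df : R) : lips L f -> is_derive x (1 : R) f df -> `|df| <= L.
Proof.
move=> lf [d <-].
have H : (fun h : R => `|h^-1 *: ((f \o shift x) (h *: (1 : R)) - f x)|) @ 0^' -->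
  `|'D_1 f x| by exact: (cvg_norm d).
apply: (cvgr_to_le H); near=> h.
have h0 : h != 0 by near: h; exact: nbhs_dnbhs_neq.
rewrite /= /GRing.scale /= mulr1 normrM normfV mulrC (addrC h).
by rewrite ler_pdivrMr ?normr_gt0.
Unshelve. all: by end_near. Qed.

(** An increment of step [a] of [u] is Lipschitz with constant [C |a|], which therefore bounds its
    derivative, the increment of [u']. *)
Lemma diff2_C11 u C L : 0 <= C -> 0 <= L -> lips L u ->
  (forall a h x, `|diff2 u a h x| <= C * `|a| * `|h|) ->
  exists2 u', (forall x : R, is_derive x (1 : R) u (u' x)) & lips C u'.
Proof.
move=> C0 L0 lu d2; exists (fun x => 'D_1 u x).
  by move=> x; apply: DeriveDef => //; exact: (derivable_diff2 u C L C0 L0 lu d2).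
have du (x : R) : is_derive x (1 : R) u ('D_1 u x).
  by apply: DeriveDef => //; exact: (derivable_diff2 u C L C0 L0 lu d2).
move=> x a.
apply: (lips_derive_le _ (fun z => u (z + a) - u z) x).
  move=> z h; have := d2 a h z.
  have -> : diff2 u a h z = u (z + h + a) - u (z + h) - (u (z + a) - u z).
    by rewrite /diff2 (addrAC z a); ring.
  by [].
by apply: is_deriveBr => //; exact: is_derive_shift_arg.
Qed.

(** A relation rather than a function: it records that every intermediate derivative exists. *)
Fixpoint nder (n : nat) (p u : R -> R) : Prop :=
  if n is n'.+1 then
    exists2 p', (forall x : R, is_derive x (1 : R) p (p' x)) & nder n' p' u
  else p = u.

(** With a predicate that no [A] satisfies, the class is C^(n,1) in [x], uniformly in [t]. *)
Definition lipcls := Ycls (fun _ _ : R => False).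

(** The last clause connects the two uses of [Ycls]: any [P] controlling the second differences of
    the top derivative [u] puts [p], and then every kernel built from [p], in the class for that
    [P]. *)
Lemma nder_exists n p : lipcls n (fun x _ => p x) ->
  exists u, [/\ nder n p u, exists2 L, 0 <= L & lips L u
   & forall P, (forall h A, 0 <= A -> P h A -> forall x a, `|diff2 u a h x| <= A * `|a| * `|h|) ->
     Ycls P n (fun x _ => p x)].
Proof.
elim: n p => [|n IH] p Yp.
  exists p; split=> //; first by have [L L0 lp] := Ycls_lipschitz _ _ _ Yp; exists L => // x h; exact: lp _ _ 0.
  move=> P PP; move: Yp => [mp [C C0 [bp lp _]]]; split=> //.
  exists (C + 1); first by rewrite addr_ge0.
  split.
  - by move=> x t; rewrite (le_trans (bp x t))// lerDl.
  - by move=> x h t; rewrite (le_trans (lp x h t))// ler_wpM2r// lerDl.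
  - move=> h A A0 PA x a t; rewrite (le_trans (PP h A A0 PA x a))//.
    rewrite ler_wpM2r// ler_wpM2r// mulrDl mul1r.
    have : 0 <= C * (1 + A) by rewrite mulr_ge0// addr_ge0.
    by clear; lra.
have [p' dp Yp'] := Ycls_derive _ _ _ Yp.
have [u [nu lu Pu]] := IH p' Yp'.
have [C C0 bp] := Ycls_bounded _ _ _ Yp.
exists u; split=> //; first by exists p'.
by move=> P PP; apply: (Ycls_primitive _ _ _ _ C dp (bp ^~ 0)); exact: Pu.
Qed.

Lemma nder_step n p u u' C : nder n p u -> lipcls n (fun x _ => p x) ->
  (forall x : R, is_derive x (1 : R) u (u' x)) -> 0 <= C -> lips C u' ->
  lipcls n.+1 (fun x _ => p x).
Proof.
elim: n p => [|n IH] p.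
  move=> -> Yu du C0 lu'.
  have [D D0 bu] := Ycls_bounded _ _ _ Yu.
  have [L L0 lu] := Ycls_lipschitz _ _ _ Yu.
  apply: (Ycls_primitive _ _ _ _ D du (bu ^~ 0)).
  split; first by move=> x; exact: measurable_cst.
  exists (L + C); first exact: addr_ge0.
  split=> //.
  - move=> x _; rewrite (@le_trans _ _ L) ?lerDl//.
    by apply: (lips_derive_le _ u x) => // y h; exact: lu y h 0.
  - by move=> x h _; rewrite (le_trans (lu' x h))// ler_wpM2r// lerDr.
move=> [p' dp nu] Yp du C0 lu'.
have [D D0 bp] := Ycls_bounded _ _ _ Yp.
have [q' dq' Yq'] := Ycls_derive _ _ _ Yp.
have E : q' = p'.
  apply/funext => x; have d1 := dq' x; have d2 := dp x.
  by rewrite -(@derive_val _ _ _ _ _ _ _ d1) (@derive_val _ _ _ _ _ _ _ d2).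
rewrite E in Yq'.
exact: (Ycls_primitive _ _ _ _ D dp (bp ^~ 0) (IH p' nu Yq' du C0 lu')).
Qed.

Lemma nder_periodic n p u T : nder n p u -> periodic p T -> periodic u T.
Proof.
elim: n p => [|n IH] p; first by move=> ->.
move=> [p' dp nu] pp; apply: (IH p') => // x.
have := is_derive_shift_arg p _ x T (dp (x + T)).
have -> : (fun z => p (z + T)) = p by apply/funext => z; exact: pp.
by move=> d; rewrite -(@derive_val _ _ _ _ _ _ _ d) (@derive_val _ _ _ _ _ _ _ (dp x)).
Qed.

(** A derivative falling on [dq p] keeps the form of the equation; one falling on [kap] gives a term
    that moves to the right-hand side and stays in the class needed at the next level. *)
Lemma nder_equation P n p u kap g w : intg w -> periodic p (2 * pi) ->
  Ycls P n (fun x _ => p x) -> Ycls P n kap -> Ycls P n (fun x _ => g x) ->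
  (forall x, J (fun t => dq p x t * kap x t * w t) = g x) -> nder n p u ->
  exists2 g0, Ycls P 0 (fun x _ => g0 x) &
    forall x, J (fun t => dq u x t * kap x t * w t) = g0 x.
Proof.
move=> iw; elim: n p g => [|n IH] p g pp Yp Yk Yg E; first by move=> <-; exists g.
move=> [p' dp nu].
have Yk1 := Ycls_S _ _ _ Yk.
have [Ck Ck0 bk] := Ycls_bounded _ _ _ Yk.
have mk := Ycls_measurable _ _ _ Yk.
have [g' dg Yg'] := Ycls_derive _ _ _ Yg.
have [q' dq' Yq'] := Ycls_derive _ _ _ Yp.
have Eq : q' = p'.
  apply/funext => x; have d1 := dq' x; have d2 := dp x.
  by rewrite -(@derive_val _ _ _ _ _ _ _ d1) (@derive_val _ _ _ _ _ _ _ d2).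
rewrite {q' dq'}Eq in Yq'.
have [_ [_ [k' dk Yk']]] := Yk.
have [Ck' Ck'0 bk'] := Ycls_bounded _ _ _ Yk'.
have mk' := Ycls_measurable _ _ _ Yk'.
have Ydq := Ycls_dq P n p p' dp pp Yq'.
have [D D0 bdq] := Ycls_bounded _ _ _ Ydq.
have mdq := Ycls_measurable _ _ _ Ydq.
have pp' := periodic_derive _ _ dp pp.
have [L L0 lp'] := Ycls_lipschitz _ _ _ Yq'.
have cp' := Ycls_continuous _ _ _ Yq'.
have mdq' x : measurable_fun setT (dq p' x) by exact: measurable_dq.
have bdq' x t : `|dq p' x t| <= 2 * L by apply: dq_le => // y h; exact: lp' y h 0.
have dJ (x : R) : is_derive x (1 : R) (fun z => J (fun t => dq p z t * kap z t * w t))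
    (J (fun t => (dq p' x t * kap x t + dq p x t * k' x t) * w t)).
  apply: (is_derive_J (fun y t => dq p y t * kap y t)
    (fun y t => dq p' y t * kap y t + dq p y t * k' y t) w (2 * L * Ck + D * Ck')) => //.
  - by move=> y; exact: measurable_funM.
  - by exists (D * Ck) => y t; exact: ler_prod_norm.
  - move=> y t; apply: is_deriveMr => //.
    have d1 := is_derive_shift_arg p _ y (- t) (dp (y - t)).
    have := is_deriveMr _ _ y _ _ (is_deriveBr _ _ y _ _ (dp y) d1) (is_derive_cst (ichord t) y 1).
    by rewrite mulr0 addr0.
  - by move=> y t; rewrite (le_trans (ler_normD _ _))// lerD//; exact: ler_prod_norm.
apply: (IH p' (fun x => g' x - J (fun t => dq p x t * k' x t * w t))) => //.
  by apply: YclsB => //; apply: Ycls_J => //; exact: YclsM.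
move=> x; have d1 := dJ x; have d2 := dg x.
have Eg : g = fun z => J (fun t => dq p z t * kap z t * w t).
  by apply/funext => z; rewrite E.
rewrite Eg in d2.
rewrite -(@derive_val _ _ _ _ _ _ _ d2) (@derive_val _ _ _ _ _ _ _ d1).
have i1 : intg (fun t => dq p' x t * kap x t * w t).
  by apply: (@intgM _ _ _ (2 * L * Ck)) => // [|t]; [exact: measurable_funM|exact: ler_prod_norm].
have i2 : intg (fun t => dq p x t * k' x t * w t).
  by apply: (@intgM _ _ _ (D * Ck')) => // [|t]; [exact: measurable_funM|exact: ler_prod_norm].
have -> : J (fun t => (dq p' x t * kap x t + dq p x t * k' x t) * w t) =
  J (fun t => dq p' x t * kap x t * w t) + J (fun t => dq p x t * k' x t * w t).
  by rewrite -JD//; apply: eq_J => t _; rewrite mulrDl.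
by rewrite addrK.
Qed.

(** The hypotheses on [kap] and [g] are quantified over [P] because the predicate used here speaks
    of the [n]-th derivative of [p], produced only in the proof. The last hypothesis concerns the
    products of first increments, which the maximum principle does not absorb. *)
Theorem regularity_gain n p kap g gam dl c0 s0 :
  lipcls n (fun x _ => p x) -> periodic p (2 * pi) ->
  0 <= gam -> 0 <= dl -> gam + dl < 1 ->
  (forall P, Ycls P n (fun x _ => p x) -> Ycls P n kap) ->
  (forall P, Ycls P n (fun x _ => p x) -> Ycls P n (fun x _ => g x)) ->
  (forall x, J (fun t => dq p x t * kap x t * wt gam t) = g x) ->
  0 < c0 -> 0 < s0 ->
  (forall x t, 0 < t < 2 * pi -> chord t < s0 -> c0 <= kap x t) ->
  (forall u L, nder n p u -> 0 <= L -> lips L u -> exists2 Cm, 0 <= Cm &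
   forall a h x y t, 0 < t < 2 * pi ->
     `|dq (fun z => u (z + a) - u z) x t * (kap (y + h) t - kap y t)|
       <= Cm * `|a| * `|h| * wt dl t) ->
  lipcls n.+1 (fun x _ => p x).
Proof.
move=> Yp pp gam0 dl0 gd Yk Yg E c00 s00 kpos Hmix.
have [u [nu [L L0 lu] PY]] := nder_exists n p Yp.
pose P h A := forall x a, `|diff2 u a h x| <= A * `|a| * `|h|.
have YpP : Ycls P n (fun x _ => p x) by exact: PY.
have iw : intg (wt gam) by apply: intg_wt; rewrite gam0/=; move: gd dl0; clear; lra.
have [g0 Yg0 E0] := nder_equation P n p u kap g _ iw pp YpP (Yk P YpP) (Yg P YpP) E nu.
have pu := nder_periodic n p u _ nu pp.
have [Cm Cm0 Hm] := Hmix u L nu L0 lu.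
have [C C0 d2] := second_difference_bound u kap g0 L gam dl Cm c0 s0 L0 lu pu
  gam0 dl0 gd (Ycls_le P 0 n kap (leq0n n) (Yk P YpP)) Yg0 E0 Cm0 Hm c00 s00 kpos.
have [u' du lu'] := diff2_C11 u C L C0 L0 lu d2.
exact: (nder_step n p u u' C).
Qed.

End regularity_step.

(** * The contour kernel *)

Section contour_kernel.
Context {R : realType}.
Implicit Types (f g u : R -> R) (x y z t h a b c C L : R).
Implicit Types (P : R -> R -> Prop) (k l : R -> R -> R).
Context (alpha : R) (r p : R -> R).
Context (alpha1 : 1 <= alpha) (alpha2 : alpha < 2).
Context (dr : forall x : R, is_derive x (1 : R) r (p x)).
Context (per : periodic r (2 * pi)).
Context (rbd : forall x, 1 / 2 <= r x <= 2) (pbd : forall x, `|p x| <= 1 / 4).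

(* In the variable [t = x - y] the denominator of the self-interaction is
   [(chord t ^+ 2 * Fker x t) `^ (alpha / 2)], and [N_0(x, y)] is the sum of
   [- (p x - p y) * (r x * cos t + p x * sin t)] and of terms of order [chord t].
   The factor [cnorm] makes [kapker x 0 = 1], so that the increments of [kapker]
   in [x] vanish at [t = 0] to the order of the regularity of [p]. *)
Definition Fker x t : R := dq r x t ^+ 2 + r x * r (x - t).
Definition rpden x : R := r x ^+ 2 + p x ^+ 2.
Definition kapker x t : R :=
  (cos t + p x / r x * sin t) * (Fker x t / rpden x) `^ (- (alpha / 2)).
Definition cnorm x : R := rpden x `^ (alpha / 2) / r x.
Definition muker x t : R :=
  cnorm x * (((r x * r (x - t) + p x ^+ 2) * cos (t / 2) + p x * dq r x t * cos t)
             * Fker x t `^ (- (alpha / 2))).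

Lemma r_ge x : 1 / 2 <= r x. Proof. by have /andP[] := rbd x. Qed.
Lemma r_gt0 x : 0 < r x. Proof. by rewrite (lt_le_trans _ (r_ge x)). Qed.

Lemma r_norm x : `|r x| <= 2.
Proof. by rewrite gtr0_norm ?r_gt0//; have /andP[] := rbd x. Qed.

Lemma r_lips : lips (1 / 4) r.
Proof. by move=> x h; exact: (derive_bound_lipschitz r p). Qed.

Lemma dq_r_le x t : `|dq r x t| <= 1 / 2.
Proof.
have := dq_le (1 / 4) r x t _ r_lips per; rewrite (_ : 2 * (1 / 4) = 1 / 2 :> R).
  by apply; lra.
by field.
Qed.

Lemma Fker_ge x t : 1 / 4 <= Fker x t.
Proof.
have := r_ge x; have := r_ge (x - t); have := sqr_ge0 (dq r x t).
by rewrite /Fker; set A := r x; set B := r _; set C := dq _ _ _ ^+ 2; nra.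
Qed.

Lemma Fker_le x t : Fker x t <= 5.
Proof.
have /andP[_ h1] := rbd x; have /andP[_ h2] := rbd (x - t).
have h3 : r x * r (x - t) <= 2 * 2 by apply: ler_pM => //; exact/ltW/r_gt0.
have h4 := ler_prod_norm _ _ _ _ (dq_r_le x t) (dq_r_le x t).
by move: (le_trans (ler_norm _) h4) h3; rewrite /Fker expr2; lra.
Qed.

Lemma rpden_ge x : 1 / 4 <= rpden x.
Proof.
have := r_ge x; have := sqr_ge0 (p x); rewrite /rpden (expr2 (r x)).
by set A := r x; set C := p x ^+ 2; nra.
Qed.

Lemma Y_r P n : Ycls P n (fun x _ => p x) -> Ycls P n.+1 (fun x _ => r x).
Proof. by move=> Yp; exact: (Ycls_primitive _ _ _ _ 2 dr r_norm). Qed.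

Lemma Y_dqr P n : Ycls P n (fun x _ => p x) -> Ycls P n (dq r).
Proof. exact: Ycls_dq. Qed.

Lemma Y_Fker P n : Ycls P n (fun x _ => p x) -> Ycls P n Fker.
Proof.
move=> Yp; have Yr := Ycls_S _ _ _ (Y_r _ _ Yp); have Yq := Y_dqr _ _ Yp.
have -> : Fker = fun x t => dq r x t * dq r x t + r x * r (x - t).
  by apply/funext => x; apply/funext => t; rewrite /Fker expr2.
apply: YclsD; first exact: YclsM.
by apply: (YclsM _ _ (fun x _ => r x)) => //; exact: Ycls_reflect.
Qed.

Lemma Y_rpden P n : Ycls P n (fun x _ => p x) -> Ycls P n (fun x _ => rpden x).
Proof.
move=> Yp; have Yr := Ycls_S _ _ _ (Y_r _ _ Yp).
have -> : (fun x (_ : R) => rpden x) = fun x _ => r x * r x + p x * p x.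
  by apply/funext => x; apply/funext => t; rewrite /rpden !expr2.
apply: YclsD; first exact: (YclsM _ _ (fun x _ => r x) (fun x _ => r x)).
exact: (YclsM _ _ (fun x _ => p x) (fun x _ => p x)).
Qed.

Lemma q14 : 0 < 1 / 4 :> R. Proof. by lra. Qed.

Lemma Y_cnorm P n : Ycls P n (fun x _ => p x) -> Ycls P n (fun x _ => cnorm x).
Proof.
move=> Yp; have Yr := Ycls_S _ _ _ (Y_r _ _ Yp).
apply: (YclsM _ _ (fun x _ => rpden x `^ (alpha / 2)) (fun x _ => (r x)^-1)).
  exact: (Ycls_powR P n (fun x _ => rpden x) _ _ q14 (fun x _ => rpden_ge x) (Y_rpden _ _ Yp)).
apply: (Ycls_inv P n (fun x _ => r x) (1 / 2) _ (fun x _ => r_ge x) Yr); lra.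
Qed.

Lemma Fn_ge x t : 1 / 20 <= Fker x t / rpden x.
Proof.
have h1 := Fker_ge x t; have h2 := rpden_ge x.
have h3 : rpden x <= 5.
  have /andP[_ h5] := rbd x.
  have h3 : r x * r x <= 2 * 2 by apply: ler_pM => //; exact/ltW/r_gt0.
  have h4 := ler_prod_norm _ _ _ _ (pbd x) (pbd x).
  by move: (le_trans (ler_norm _) h4) h3; rewrite /rpden !expr2; lra.
rewrite ler_pdivlMr; last by rewrite (lt_le_trans q14).
by move: h1 h2 h3; lra.
Qed.

Lemma Fn_le x t : Fker x t / rpden x <= 20.
Proof.
have h1 := Fker_le x t; have h2 := rpden_ge x.
rewrite ler_pdivrMr; last by rewrite (lt_le_trans q14).
by move: h1 h2; lra.
Qed.

Lemma q20 : 0 < 1 / 20 :> R. Proof. by lra. Qed.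

Lemma Y_Fn P n : Ycls P n (fun x _ => p x) -> Ycls P n (fun x t => Fker x t / rpden x).
Proof.
move=> Yp; apply: YclsM; first exact: Y_Fker.
exact: (Ycls_inv P n (fun x _ => rpden x) _ q14 (fun x _ => rpden_ge x) (Y_rpden _ _ Yp)).
Qed.

Lemma measurable_half f : continuous f -> measurable_fun setT (fun t => f (t / 2)).
Proof.
move=> cf; apply: (measurableT_comp (continuous_measurable f cf)).
exact: measurable_funM.
Qed.

Lemma Y_t P n f : continuous f -> (forall t, `|f t| <= 1) -> Ycls P n (fun _ t => f t).
Proof. by move=> cf bf; apply: Ycls_cst => //; exact: continuous_measurable. Qed.

Lemma Y_kapker P n : Ycls P n (fun x _ => p x) -> Ycls P n kapker.
Proof.
move=> Yp; have Yr := Ycls_S _ _ _ (Y_r _ _ Yp).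
apply: YclsM; last first.
  exact: (Ycls_powR P n _ _ _ q20 Fn_ge (Y_Fn _ _ Yp)).
apply: YclsD; first exact: (Y_t _ _ cos (@continuous_cos R) (@cos_max R)).
apply: (YclsM _ _ (fun x _ => p x / r x)); last first.
  exact: (Y_t _ _ sin (@continuous_sin R) (@sin_max R)).
apply: (YclsM _ _ (fun x _ => p x) (fun x _ => (r x)^-1)) => //.
apply: (Ycls_inv P n (fun x _ => r x) (1 / 2) _ (fun x _ => r_ge x) Yr); lra.
Qed.

Lemma Y_muker P n : Ycls P n (fun x _ => p x) -> Ycls P n muker.
Proof.
move=> Yp; have Yr := Ycls_S _ _ _ (Y_r _ _ Yp).
apply: (YclsM _ _ (fun x _ => cnorm x)); first exact: Y_cnorm.
apply: YclsM; last exact: (Ycls_powR P n _ _ _ q14 Fker_ge (Y_Fker _ _ Yp)).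
apply: YclsD.
  apply: YclsM; last first.
    apply: (Ycls_cst _ _ (fun t => cos (t / 2)) 1); last by move=> t; exact: cos_max.
    exact: (measurable_half cos (@continuous_cos R)).
  apply: YclsD; first by apply: (YclsM _ _ (fun x _ => r x)) => //; exact: Ycls_reflect.
  by have := YclsM _ _ _ _ Yp Yp; under eq_fun do under eq_fun do rewrite -expr2.
apply: YclsM; last exact: (Y_t _ _ cos (@continuous_cos R) (@cos_max R)).
by apply: (YclsM _ _ (fun x _ => p x)) => //; exact: Y_dqr.
Qed.

Lemma sinE_chord t : sin t = chord t * cos (t / 2).
Proof.
rewrite /chord; have -> : sin t = sin ((t / 2) *+ 2) by congr sin; rewrite mulr2n; field.
by rewrite sin_mulr2n mulr2n; ring.
Qed.

Lemma cosE_chord t : cos t = 1 - chord t ^+ 2 / 2.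
Proof.
rewrite /chord; have -> : cos t = cos ((t / 2) *+ 2) by congr cos; rewrite mulr2n; field.
by rewrite cos_mulr2n cos2sin2 mulr2n; field.
Qed.

(** For a chord below [1 / 2], [cos t >= 7 / 8] and the sine term is at most [1 / 4], so the first
    factor exceeds [1 / 2]; the second is at least [20 ^ (- alpha / 2)] by [Fn_le]. *)
Lemma kapker_pos x t : 0 < t < 2 * pi -> chord t < 1 / 2 ->
  1 / 2 * 20 `^ (- (alpha / 2)) <= kapker x t.
Proof.
move=> tI ct; have c0 := chord_gt0 _ tI.
apply: ler_pM; [by lra|exact: powR_ge0| |]; last first.
  apply: powRN_anti; last exact: Fn_le.
    by rewrite divr_ge0//; move: alpha1; lra.
  by rewrite (lt_le_trans q20)// Fn_ge.
have b1 : `|p x / r x * sin t| <= 1 / 4.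
  have h1 : `|p x / r x| <= 1 / 2.
    rewrite normrM normfV (gtr0_norm (r_gt0 x)) ler_pdivrMr ?r_gt0//.
    by have := pbd x; have := r_ge x; lra.
  have h2 : `|sin t| <= 1 / 2.
    rewrite sinE_chord normrM (gtr0_norm c0) (le_trans _ (ltW ct))//.
    by rewrite ler_piMr ?cos_max// ltW.
  by rewrite (le_trans (ler_prod_norm _ _ _ _ h1 h2))//; lra.
move: b1; rewrite ler_norml => /andP[b1 _].
have : chord t ^+ 2 <= 1 / 4.
  by rewrite expr2 (_ : 1 / 4 = (1 / 2) * (1 / 2) :> R); [apply: ler_pM; rewrite ?ltW|field].
by move: b1; rewrite cosE_chord; lra.
Qed.

Lemma rpden_gt0 x : 0 < rpden x.
Proof. by rewrite (lt_le_trans q14)// rpden_ge. Qed.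

Lemma Fker_gt0 x t : 0 < Fker x t.
Proof. by rewrite (lt_le_trans q14)// Fker_ge. Qed.

Lemma derive1_r : derive1 r = p.
Proof. by apply/funext => x; rewrite derive1E (@derive_val _ _ _ _ _ _ _ (dr x)). Qed.

(** Each term of [Nker] carries a factor [chord t]: [sin t = chord t * cos (t / 2)], and
    [r x p (x - t) - p x r (x - t)] is a combination of increments, that is of [dq] times the chord.
    Against [chord ^ alpha] this leaves the integrable weight. *)
Lemma self_integrand x t : 0 < t < 2 * pi ->
  cnorm x * (Nker r 0 x (x - t) /
      ((r x - r (x - t)) ^+ 2
       + 4 * r x * r (x - t) * sin ((x - (x - t)) / 2) ^+ 2) `^ (alpha / 2))
  = (muker x t - dq p x t * kapker x t) * wt (alpha - 1) t.
Proof.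
move=> tI; have c0 := chord_gt0 _ tI.
have E0 : x - (x - t) = t by ring.
rewrite /Nker derive1_r E0 subr0.
have dqE f : dq f x t * chord t = f x - f (x - t).
  by rewrite /dq ichordE// divfK// gt_eqF.
have -> : (r x - r (x - t)) ^+ 2 + 4 * r x * r (x - t) * sin (t / 2) ^+ 2 =
    chord t ^+ 2 * Fker x t.
  by rewrite /Fker -dqE /chord; ring.
rewrite powRM ?sqr_ge0//; last exact/ltW/Fker_gt0.
have -> : (chord t ^+ 2) `^ (alpha / 2) = chord t `^ alpha.
  rewrite -powR_mulrn; last exact: ltW.
  by rewrite -powRrM; congr powR; field.
have -> : wt (alpha - 1) t = chord t * (chord t `^ alpha)^-1.
  rewrite /wt opprB powRB; last by rewrite (gt_eqF c0) implybT.
  by rewrite powRr1// ltW.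
have -> : kapker x t = (cos t + p x / r x * sin t) * (Fker x t `^ (alpha / 2))^-1
    * rpden x `^ (alpha / 2).
  rewrite /kapker powRM ?invr_ge0 ?ltW ?Fker_gt0 ?rpden_gt0// mulrA; congr (_ * _ * _).
    by rewrite powRN.
  rewrite -powR_inv1; last exact/ltW/rpden_gt0.
  by rewrite -powRrM; congr powR; ring.
rewrite /muker /cnorm powRN.
have a0 : chord t `^ alpha != 0 by rewrite gt_eqF// powR_gt0.
have f0 : Fker x t `^ (alpha / 2) != 0 by rewrite gt_eqF// powR_gt0// Fker_gt0.
have r0 : r x != 0 by rewrite gt_eqF// r_gt0.
have Ep : p (x - t) = p x - dq p x t * chord t by rewrite dqE; ring.
have Er : r (x - t) = r x - dq r x t * chord t by rewrite dqE; ring.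
rewrite Ep Er sinE_chord.
by field; rewrite a0 f0 r0.
Qed.

End contour_kernel.

(** * Expansions at the diagonal, uniform on the circle *)

Section chord_vanishing.
Context {R : realType}.
Implicit Types (f g u : R -> R) (x y z t s h a b c C D L B : R).
Implicit Types (k l : R -> R -> R).

Lemma mean_value_between f f' : (forall x, is_derive (x : R) (1 : R) f (f' x)) ->
  forall x y, exists2 c, `|c - x| <= `|y - x| & f y - f x = f' c * (y - x).
Proof.
move=> df x y; have cf := is_derive_continuous f f' df.
have [xy|yx|->] := ltgtP x y; last by exists y => //; rewrite !subrr mulr0.
  have [|c] := @MVT R f f' x y xy (fun z _ => df z); first exact: continuous_subspaceT.
  rewrite in_itv/= => /andP[xc cy] ->; exists c => //.
  by rewrite !gtr0_norm ?subr_gt0// lerD2r ltW.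
have [|c] := @MVT R f f' y x yx (fun z _ => df z); first exact: continuous_subspaceT.
rewrite in_itv/= => /andP[yc cx] e; exists c.
  by rewrite !ltr0_norm ?subr_lt0// lerN2 lerD2r ltW.
by rewrite -[LHS]opprB e -mulrN opprB.
Qed.

Lemma taylor1 f f' L x s : (forall x, is_derive (x : R) (1 : R) f (f' x)) ->
  0 <= L -> lips L f' -> `|f x - f (x - s) - f' x * s| <= L * s ^+ 2.
Proof.
move=> df L0 lf'; have [c cP] := mean_value_between f f' df x (x - s).
rewrite addrAC subrr sub0r normrN in cP *.
move=> E; have -> : f x - f (x - s) - f' x * s = (f' c - f' x) * s.
  by rewrite -(opprB (f (x - s))) E; ring.
rewrite normrM expr2 -[s in leRHS]/s.
have -> : L * (s * s) = L * `|s| * `|s| by rewrite -mulrA -normrM ger0_norm// sqr_ge0.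
rewrite ler_wpM2r//; have := lf' x (c - x); rewrite subrKC => /le_trans; apply.
by rewrite ler_wpM2l.
Qed.

Lemma sin_taylor s : `|s - sin s| <= s ^+ 2.
Proof.
have [c cP] := mean_value_between sin cos (@is_derive_sin R) 0 s.
rewrite sin0 !subr0 in cP * => ->.
have -> : s - cos c * s = (1 - cos c) * s by ring.
have := derive_bound_lipschitz cos _ 1 (@is_derive_cos R) _ 0 c.
rewrite add0r cos0 mul1r distrC => H.
have {}H : `|1 - cos c| <= `|c| by apply: H => x; rewrite normrN sin_max.
rewrite normrM -real_normK ?num_real// expr2 ler_wpM2r//.
exact: le_trans H cP.
Qed.

(** The representative of [t] modulo [2 pi] nearest to 0 turns Taylor bounds in powers of [|s|] into
    bounds in powers of the chord on the whole circle. *)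
Lemma reduced_angle t : 0 < t < 2 * pi -> exists s : R,
  [/\ `|s| <= 2 * chord t, sin s = sin t &
      forall f, periodic f (2 * pi) -> forall x, f (x - t) = f (x - s)].
Proof.
move=> /andP[t0 t1]; have [tpi|tpi] := leP t pi.
  by exists t; split=> //; rewrite gtr0_norm// le_chord// ltW.
exists (t - 2 * pi); split.
- rewrite ltr0_norm ?subr_lt0// opprB -chord_2pi le_chord//.
  by apply/andP; split; lra.
- by rewrite -[in RHS](subrK (2 * pi) t) mulr_natl sinD2pi.
- by move=> f pf x; rewrite -[RHS](periodicB f)//; congr f; ring.
Qed.

(** The factor [cos (t / 2)] comes from [sin t = chord t * cos (t / 2)]. It tends to 1 at [t = 0]
    and to -1 at [t = 2 pi], where [dq f x t] tends to [- f' x]: one formula serves both ends. *)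
Lemma dq_taylor f f' B L x t : (forall x, is_derive (x : R) (1 : R) f (f' x)) ->
  periodic f (2 * pi) -> 0 <= L -> lips L f' -> 0 <= B -> (forall x, `|f' x| <= B) ->
  0 < t < 2 * pi -> `|dq f x t - f' x * cos (t / 2)| <= 4 * (L + B) * chord t.
Proof.
move=> df pf L0 lf' B0 bf' tI; have c0 := chord_gt0 _ tI.
rewrite -(ler_pM2r c0) -[X in _ * X](gtr0_norm c0) -normrM mulrBl.
have -> : dq f x t * chord t = f x - f (x - t) by rewrite /dq ichordE// divfK// gt_eqF.
have -> : f' x * cos (t / 2) * chord t = f' x * sin t by rewrite sinE_chord; ring.
have [s [s1 s2 s3]] := reduced_angle t tI; rewrite -s2 s3//.
have -> : f x - f (x - s) - f' x * sin s =
  f x - f (x - s) - f' x * s + f' x * (s - sin s) by ring.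
have ss : s ^+ 2 <= 4 * (chord t * chord t).
  rewrite -real_normK ?num_real// expr2.
  have -> : 4 * (chord t * chord t) = (2 * chord t) * (2 * chord t) by ring.
  exact: ler_pM.
have e1 := taylor1 f f' L x s df L0 lf'.
have e2 := ler_prod_norm _ _ _ _ (bf' x) (sin_taylor s).
apply: (le_trans (ler_normD _ _)); apply: (le_trans (lerD e1 e2)).
by have := ler_wpM2l (addr_ge0 L0 B0) ss; lra.
Qed.

(** First-order vanishing on the diagonal, for the kernel and for its increments in [x];
    [chord_smallM] makes such kernels an ideal over [lipcls 0]. *)
Definition chord_small k := exists2 C, 0 <= C &
  forall x t, 0 < t < 2 * pi -> `|k x t| <= C * chord t /\
    forall h, `|k (x + h) t - k x t| <= C * `|h| * chord t.

Lemma chord_smallD k l : chord_small k -> chord_small l ->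
  chord_small (fun x t => k x t + l x t).
Proof.
move=> [C C0 HC] [D D0 HD]; exists (C + D); first exact: addr_ge0.
move=> x t tI; have [h1 h2] := HC x t tI; have [h3 h4] := HD x t tI; split.
  by rewrite (le_trans (ler_normD _ _))// mulrDl lerD.
move=> h; rewrite opprD addrACA (le_trans (ler_normD _ _))// !mulrDl.
by rewrite lerD.
Qed.

Lemma chord_smallM k l : chord_small k -> lipcls 0 l ->
  chord_small (fun x t => k x t * l x t).
Proof.
move=> [C C0 HC] [_ [D D0 [bl ll _]]]; exists (2 * (C * D)); first by rewrite !mulr_ge0.
move=> x t tI; have [h1 h2] := HC x t tI; have c0 := chord_gt0 _ tI.
have CDc : 0 <= C * D * chord t := mulr_ge0 (mulr_ge0 C0 D0) (ltW c0).
split.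
  by have := ler_prod_norm _ _ _ _ h1 (bl x t); move/le_trans; apply; move: CDc; lra.
move=> h; have -> : k (x + h) t * l (x + h) t - k x t * l x t =
   (k (x + h) t - k x t) * l (x + h) t + k x t * (l (x + h) t - l x t) by ring.
have e1 := ler_prod_norm _ _ _ _ (h2 h) (bl (x + h) t).
have e2 := ler_prod_norm _ _ _ _ h1 (ll x h t).
apply: (le_trans (ler_normD _ _)); apply: (le_trans (lerD e1 e2)).
by rewrite le_eqVlt; apply/orP; left; apply/eqP; ring.
Qed.

Lemma chord_small_chord l : lipcls 0 l -> chord_small (fun x t => chord t * l x t).
Proof.
move=> Yl; apply: (chord_smallM (fun _ t => chord t) l) => //.
exists 1 => // x t tI; rewrite (gtr0_norm (chord_gt0 _ tI)) mul1r; split=> // h.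
by rewrite subrr normr0 mul1r mulr_ge0// ltW// chord_gt0.
Qed.

End chord_vanishing.

(** * The induction on the regularity of the slope *)

Section bootstrap.
Context {R : realType}.
Implicit Types (f g u : R -> R) (x y z t h a b c C L : R).
Implicit Types (P : R -> R -> Prop) (k l : R -> R -> R).
Context (alpha : R) (r p : R -> R).
Context (alpha1 : 1 <= alpha) (alpha2 : alpha < 2).
Context (dr : forall x : R, is_derive x (1 : R) r (p x)).
Context (per : periodic r (2 * pi)).
Context (rbd : forall x, 1 / 2 <= r x <= 2) (pbd : forall x, `|p x| <= 1 / 4).
Local Notation kap := (kapker alpha r p).

(** The diagonal value of the kernel does not depend on [x], so increments in [x] vanish there. In
    the first factor only [p / r * sin t] depends on [x], and [sin t] is at most the chord; the
    second factor is a power of [1 + w] with [w] vanishing at the diagonal. *)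
Lemma kapker_chord_lipschitz : lipcls 1 (fun x _ => p x) ->
  exists2 C, 0 <= C & forall y h t, 0 < t < 2 * pi ->
    `|kap (y + h) t - kap y t| <= C * `|h| * chord t.
Proof.
move=> Yp1; have Yp0 : lipcls 0 (fun x _ => p x) := Ycls_S (fun _ _ => False) 0 _ Yp1.
have [p' dp Yp'] := Ycls_derive (fun _ _ => False) 0 _ Yp1.
have [B B0 bp'] := Ycls_bounded _ _ _ Yp'.
have [L L0 lp'] := Ycls_lipschitz _ _ _ Yp'.
have [Lp Lp0 lp] := Ycls_lipschitz _ _ _ Yp0.
have pp := periodic_derive _ _ dr per.
have Yr : lipcls 0 (fun x _ => r x) := Ycls_S _ _ _ (Y_r r p dr rbd _ _ Yp0).
have Ydq : lipcls 0 (dq r) := Y_dqr r p dr per _ _ Yp0.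
have Yi : lipcls 0 (fun x _ => (rpden r p x)^-1).
  apply: (Ycls_inv _ 0 (fun x _ => rpden r p x) (1 / 4)); first exact: q14.
    by move=> x _; exact: rpden_ge.
  exact: (Y_rpden r p dr rbd).
have Yt f : continuous f -> (forall t, `|f t| <= 1) -> lipcls 0 (fun _ t => f t).
  by move=> cf bf; exact: Y_t.
have Yc2 : lipcls 0 (fun _ t => cos (t / 2)).
  apply: (Ycls_cst _ _ (fun t => cos (t / 2)) 1); last by move=> t; exact: cos_max.
  exact: (measurable_half cos (@continuous_cos R)).
pose e x t := dq r x t - p x * cos (t / 2).
have Ye : lipcls 0 e.
  apply: (YclsB _ _ (dq r) (fun x t => p x * cos (t / 2))) => //.
  exact: (YclsM _ _ (fun x _ => p x) (fun _ t => cos (t / 2))).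
have Se : chord_small e.
  exists (4 * (Lp + 1 / 4) + 4 * (L + B)).
    by rewrite addr_ge0// mulr_ge0// addr_ge0//; lra.
  move=> x t tI; have c0 := chord_gt0 _ tI.
  have c1 : 0 <= 4 * (Lp + 1 / 4) * chord t.
    by rewrite mulr_ge0 ?(ltW c0)// mulr_ge0// addr_ge0//; lra.
  have c2 : 0 <= 4 * (L + B) * chord t.
    by rewrite mulr_ge0 ?(ltW c0)// mulr_ge0// addr_ge0.
  split.
    have q0 : 0 <= 1 / 4 :> R by lra.
    have := dq_taylor r p (1 / 4) Lp x t dr per Lp0 (fun y h => lp y h 0) q0 pbd tI.
    by move/le_trans; apply; move: c2; lra.
  move=> h; have de (z : R) : is_derive z (1 : R) (e ^~ t) (dq p z t - p' z * cos (t / 2)).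
    apply: is_deriveBr.
      have d1 := is_derive_shift_arg r _ z (- t) (dr (z - t)).
      have := is_deriveMr _ _ z _ _ (is_deriveBr _ _ z _ _ (dr z) d1) (is_derive_cst (ichord t) z 1).
      by rewrite mulr0 addr0.
    have := is_deriveMr _ _ z _ _ (dp z) (is_derive_cst (cos (t / 2)) z 1).
    by rewrite mulr0 addr0.
  have := derive_bound_lipschitz _ _ (4 * (L + B) * chord t) de _ x h.
  move=> H; have {}H : `|e (x + h) t - e x t| <= 4 * (L + B) * chord t * `|h|.
    apply: H => z.
    exact: (dq_taylor p p' B L z t dp pp L0 (fun y h => lp' y h 0) B0 (bp' ^~ 0) tI).
  have := mulr_ge0 c1 (normr_ge0 h).
  by move: H; lra.
(* [w = Fker / rpden - 1]. After inserting [dq r = e + p cos (t / 2)],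
   [r (x - t) = r - dq r * chord t] and [cos^2 = 1 - sin^2], every term has a factor [e] or
   [chord t]. *)
pose w x t := (e x t * (e x t + 2 * (p x * cos (t / 2)))
   + chord t * (- (p x * p x * (sin (t / 2) / 2)) - r x * dq r x t)) * (rpden r p x)^-1.
have Sw : chord_small w.
  apply: (chord_smallM _ (fun x _ => (rpden r p x)^-1)) => //.
  apply: chord_smallD.
    apply: chord_smallM => //; apply: YclsD => //.
    apply: YclsM; first exact: YclsC.
    exact: (YclsM _ _ (fun x _ => p x) (fun _ t => cos (t / 2))).
  apply: chord_small_chord; apply: YclsB.
    apply: YclsN; apply: (YclsM _ _ (fun x _ => p x * p x) (fun _ t => sin (t / 2) / 2)).
      exact: (YclsM _ _ (fun x _ => p x) (fun x _ => p x)).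
    apply: (YclsM _ _ (fun _ t => sin (t / 2)) (fun _ _ => 2^-1)); last exact: YclsC.
    apply: (Ycls_cst _ _ (fun t => sin (t / 2)) 1); last by move=> t; exact: sin_max.
    exact: (measurable_half sin (@continuous_sin R)).
  exact: (YclsM _ _ (fun x _ => r x) (dq r)).
have FnE x t : 0 < t < 2 * pi -> Fker r x t / rpden r p x = 1 + w x t.
  move=> tI; have c0 := chord_gt0 _ tI.
  have Er : r (x - t) = r x - dq r x t * chord t.
    by rewrite /dq ichordE// divfK ?gt_eqF//; ring.
  have r0 : rpden r p x != 0 by rewrite gt_eqF// rpden_gt0.
  have c2 := cos2sin2 (t / 2).
  apply: (mulIf r0); rewrite divfK// mulrDl /w -!mulrA mulVf// mulr1 mul1r.
  rewrite /Fker Er /rpden /e /chord.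
  have -> : dq r x t = e x t + p x * cos (t / 2) by rewrite /e; ring.
  rewrite addrK; set E := e x t.
  have -> : (E + p x * cos (t / 2)) ^+ 2 =
    E * (E + 2 * (p x * cos (t / 2))) + p x ^+ 2 * cos (t / 2) ^+ 2 by ring.
  by rewrite c2; field.
have [Cw Cw0 HCw] := Sw.
have lips_B : exists2 D, 0 <= D & forall y h t, 0 < t < 2 * pi ->
  `|(Fker r (y + h) t / rpden r p (y + h)) `^ (- (alpha / 2)) -
    (Fker r y t / rpden r p y) `^ (- (alpha / 2))| <= D * `|h| * chord t.
  pose M := `|- (alpha / 2)| * ((1 / 20) `^ (- (alpha / 2) - 1) + 20 `^ (- (alpha / 2) - 1)).
  have M0 : 0 <= M by rewrite mulr_ge0// addr_ge0// powR_ge0.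
  exists (M * Cw); first exact: mulr_ge0.
  move=> y h t tI.
  have i z : 1 / 20 <= Fker r z t / rpden r p z <= 20 by rewrite Fn_ge//= Fn_le.
  have q : 0 < 1 / 20 :> R by lra.
  have eF : `|Fker r (y + h) t / rpden r p (y + h) - Fker r y t / rpden r p y| <=
      Cw * `|h| * chord t.
    rewrite !FnE//; have -> : 1 + w (y + h) t - (1 + w y t) = w (y + h) t - w y t by ring.
    by have [_] := HCw y t tI; exact.
  apply: (le_trans (powR_lipschitz _ _ _ _ (- (alpha / 2)) q (i (y + h)) (i y))).
  rewrite -/M (_ : M * Cw * `|h| * chord t = M * (Cw * `|h| * chord t)); last by ring.
  exact: ler_wpM2l.
have [D D0 HD] := lips_B.
pose A x t := cos t + p x / r x * sin t.
have Ypr : lipcls 0 (fun x _ => p x / r x).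
  apply: (YclsM _ _ (fun x _ => p x) (fun x _ => (r x)^-1)) => //.
  apply: (Ycls_inv _ 0 (fun x _ => r x) (1 / 2)); [by lra| |exact: Yr].
  by move=> x _; have /andP[] := rbd x.
have [Lq Lq0 lq] := Ycls_lipschitz _ _ _ Ypr.
have [Bq Bq0 bq] := Ycls_bounded _ _ _ Ypr.
have YB : lipcls 0 (fun x t => (Fker r x t / rpden r p x) `^ (- (alpha / 2))).
  apply: (Ycls_powR _ 0 _ _ (1 / 20)); first by lra.
    by move=> x t; exact: Fn_ge.
  exact: Y_Fn.
have [BB BB0 bB] := Ycls_bounded _ _ _ YB.
exists (Lq * BB + (1 + Bq) * D).
  by rewrite addr_ge0 ?mulr_ge0// addr_ge0.
move=> y h t tI; have c0 := chord_gt0 _ tI.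
rewrite /kapker; set b1 := (_ / _) `^ _; set b0 := (_ / _) `^ _.
have -> : (cos t + p (y + h) / r (y + h) * sin t) * b1 - (cos t + p y / r y * sin t) * b0 =
  ((p (y + h) / r (y + h) - p y / r y) * sin t) * b1
  + (cos t + p y / r y * sin t) * (b1 - b0) by ring.
have s1 : `|sin t| <= chord t.
  by rewrite sinE_chord normrM (gtr0_norm c0) ler_piMr ?cos_max// ltW.
have e1 := ler_prod_norm _ _ _ _ (ler_prod_norm _ _ _ _ (lq y h 0) s1) (bB (y + h) t).
have e2 : `|cos t + p y / r y * sin t| <= 1 + Bq.
  rewrite (le_trans (ler_normD _ _))// lerD ?cos_max//.
  by have := ler_prod_norm _ _ _ _ (bq y 0) (sin_max t); rewrite mulr1.
have e3 := ler_prod_norm _ _ _ _ e2 (HD y h t tI).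
apply: (le_trans (ler_normD _ _)); apply: (le_trans (lerD e1 e3)).
by rewrite le_eqVlt; apply/orP; left; apply/eqP; ring.
Qed.

(** The second derivative of [r] is only Hoelder at the start, so the first gain runs with the loss
    [dl = 1 - b], and all later ones with [dl = 0]. *)
Theorem bootstrap p' b H g :
  (forall x : R, is_derive x (1 : R) p (p' x)) -> (exists B, forall x, `|p' x| <= B) ->
  alpha - 1 < b -> b <= 1 -> 0 <= H ->
  (forall x t, 0 < t < 2 * pi -> `|p' x - p' (x - t)| <= H * chord t `^ b) ->
  (forall P n, Ycls P n (fun x _ => p x) -> Ycls P n (fun x _ => g x)) ->
  (forall x, J (fun t => dq p x t * kap x t * wt (alpha - 1) t) = g x) ->
  forall n, lipcls n (fun x _ => p x).
Proof.
move=> dp [B bp'] b1 b2 H0 hp' Yg E.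
have pp := periodic_derive _ _ dr per.
have a10 : 0 <= alpha - 1 by rewrite subr_ge0.
have B0 : 0 <= B by rewrite (le_trans _ (bp' 0)).
have c0 : 0 < 1 / 2 * 20 `^ (- (alpha / 2)) :> R by rewrite mulr_gt0 ?powR_gt0//; lra.
have s0 : 0 < 1 / 2 :> R by lra.
have Yk P n : Ycls P n (fun x _ => p x) -> Ycls P n kap.
  exact: Y_kapker.
have kp x t : 0 < t < 2 * pi -> chord t < 1 / 2 -> 1 / 2 * 20 `^ (- (alpha / 2)) <= kap x t.
  exact: kapker_pos.
have Y0 : lipcls 0 (fun x _ => p x).
  split; first by move=> x; exact: measurable_cst.
  exists (1 / 4 + B); first by rewrite addr_ge0//; lra.
  split=> //.
  - by move=> x _; rewrite (le_trans (pbd x))// lerDl.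
  - move=> x h _; rewrite (le_trans (derive_bound_lipschitz p p' B dp bp' x h))//.
    by rewrite ler_wpM2r// lerDr; lra.
have Y1 : lipcls 1 (fun x _ => p x).
  apply: (regularity_gain 0 p kap g (alpha - 1) (1 - b) _ _ Y0 pp a10 _ _
     (Yk ^~ 0%N) (Yg ^~ 0%N) E c0 s0 kp).
  - by rewrite subr_ge0.
  - by move: b1; lra.
  move=> u L /= <- L0 lu.
  have [Lk Lk0 lk] := Ycls_lipschitz _ _ _ (Yk _ 0%N Y0).
  exists (H * Lk); first exact: mulr_ge0.
  move=> a h x y t tI; have ct := chord_gt0 _ tI.
  have -> : wt (1 - b) t = chord t `^ b * (chord t)^-1.
    rewrite /wt opprB powRB; last by rewrite (gt_eqF ct) implybT.
    by rewrite powRr1// ltW.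
  (* Differentiating in [x] turns the increment of step [a] into [|a|] times an increment of [p'] of
     step [t]; the Hoelder bound then leaves [chord ^ (b - 1)] after division by the chord. *)
  have dd : `|p (x + a) - p x - (p (x - t + a) - p (x - t))| <= H * chord t `^ b * `|a|.
    pose f z := p z - p (z - t).
    have df (z : R) : is_derive z (1 : R) f (p' z - p' (z - t)).
      by apply: is_deriveBr => //; exact: is_derive_shift_arg.
    have := derive_bound_lipschitz f _ _ df (fun z => hp' z t tI) x a.
    by congr (`|_| <= _); rewrite /f (addrAC x a); ring.
  rewrite /dq ichordE//.
  have e1 := ler_prod_norm _ _ _ _ dd (lk y h t).
  have -> : (p (x + a) - p x - (p (x - t + a) - p (x - t))) * (chord t)^-1 *
     (kap (y + h) t - kap y t) = (p (x + a) - p x - (p (x - t + a) - p (x - t))) *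
     (kap (y + h) t - kap y t) * (chord t)^-1 by ring.
  rewrite normrM (gtr0_norm (_ : 0 < (chord t)^-1)) ?invr_gt0//.
  apply: (@le_trans _ _ (H * chord t `^ b * `|a| * (Lk * `|h|) * (chord t)^-1)).
    by apply: ler_wpM2r e1; rewrite invr_ge0 ltW.
  by rewrite le_eqVlt; apply/orP; left; apply/eqP; ring.
elim=> [//|[//|n] IH].
apply: (regularity_gain n.+1 p kap g (alpha - 1) 0 _ _ IH pp a10 (lexx _) _
     (Yk ^~ n.+1) (Yg ^~ n.+1) E c0 s0 kp).
  by rewrite addr0; move: alpha2; lra.
move=> u L _ L0 lu.
(* The factor [chord t] gained here cancels the denominator of [dq], so a merely Lipschitz [u]
   suffices. *)
have [Ck Ck0 lk] := kapker_chord_lipschitz Y1.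
exists (2 * L * Ck); first by rewrite !mulr_ge0.
move=> a h x y t tI; have ct := chord_gt0 _ tI.
rewrite /wt oppr0 powRr0 mulr1 /dq ichordE//.
have dd : `|u (x + a) - u x - (u (x - t + a) - u (x - t))| <= 2 * L * `|a|.
  rewrite (le_trans (ler_normB _ _))// (le_trans (lerD (lu x a) (lu (x - t) a)))//.
  by rewrite le_eqVlt; apply/orP; left; apply/eqP; ring.
have e1 := ler_prod_norm _ _ _ _ dd (lk y h t tI).
have -> : (u (x + a) - u x - (u (x - t + a) - u (x - t))) * (chord t)^-1 *
   (kap (y + h) t - kap y t) = (u (x + a) - u x - (u (x - t + a) - u (x - t))) *
   (kap (y + h) t - kap y t) / chord t by ring.
rewrite normrM normfV (gtr0_norm ct) ler_pdivrMr//.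
apply: (le_trans e1).
by rewrite le_eqVlt; apply/orP; left; apply/eqP; ring.
Qed.

End bootstrap.

(** * The self-interaction integral and the kernels of the other patches *)

Section contour_equation.
Context {R : realType}.
Implicit Types (f g u : R -> R) (x y z t h a b c C L : R).
Implicit Types (P : R -> R -> Prop) (k l : R -> R -> R).
Local Notation leb := (@lebesgue_measure R).
Context (alpha : R) (r p : R -> R).
Context (alpha1 : 1 <= alpha) (alpha2 : alpha < 2).
Context (dr : forall x : R, is_derive x (1 : R) r (p x)).
Context (per : periodic r (2 * pi)).
Context (rbd : forall x, 1 / 2 <= r x <= 2) (pbd : forall x, `|p x| <= 1 / 4).
Context (cp : continuous p).

Lemma Rintegral_J f : measurable_fun setT f ->
  \int[leb]_(x in `[0, 2 * pi]) f x = J f.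
Proof.
move=> mf; rewrite /J /Rintegral; congr fine.
rewrite (@integral_itv_bndoo _ 0 (2 * pi) (EFin \o f) true false)//.
by apply: measurable_funTS; apply/measurable_EFinP.
Qed.

Let cr : continuous r := is_derive_continuous r p dr.

Lemma measurable_comp_sub f x : continuous f -> measurable_fun setT (fun y => f (x - y)).
Proof.
move=> cf; apply: (measurableT_comp (continuous_measurable f cf)).
exact: measurable_funB.
Qed.

Lemma measurable_scale f c : measurable_fun setT f -> measurable_fun setT (fun y => c * f y).
Proof. by move=> mf; apply: measurable_funM => //; exact: mf. Qed.

Lemma measurable_Nker th x : measurable_fun setT (Nker r th x).
Proof.
have mr := continuous_measurable r cr; have mp := continuous_measurable p cp.
rewrite /Nker (derive1_r r p dr).
have e f : continuous f -> measurable_fun setT (fun y => f (x - y - th)).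
  move=> cf; under eq_fun do rewrite addrAC; exact: measurable_comp_sub.
apply: measurable_funD; apply: measurable_funM.
- by apply: measurable_funD; exact: measurable_scale.
- exact: (e sin (@continuous_sin R)).
- by apply: measurable_funB; exact: measurable_scale.
- exact: (e cos (@continuous_cos R)).
Qed.

Definition self_integral x : R := \int[leb]_(y in `[0, 2 * pi])
  (Nker r 0 x y /
   ((r x - r y) ^+ 2 + 4 * r x * r y * sin ((x - y) / 2) ^+ 2) `^ (alpha / 2)).

Lemma self_integralE P x : Ycls P 0 (fun x _ => p x) ->
  cnorm alpha r p x * self_integral x =
  J (fun t => muker alpha r p x t * wt (alpha - 1) t)
  - J (fun t => dq p x t * kapker alpha r p x t * wt (alpha - 1) t).
Proof.
move=> Yp.
pose D y := (r x - r y) ^+ 2 + 4 * r x * r y * sin ((x - y) / 2) ^+ 2.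
have mr := continuous_measurable r cr.
have ms2 : measurable_fun setT (fun y => sin ((x - y) / 2)).
  apply: (measurableT_comp (measurable_half sin (@continuous_sin R))).
  exact: measurable_funB.
have mD : measurable_fun setT D.
  have -> : D = fun y => (r x - r y) * (r x - r y) +
      4 * r x * r y * (sin ((x - y) / 2) * sin ((x - y) / 2)).
    by apply/funext => y; rewrite /D !expr2.
  have m1 : measurable_fun setT (fun y => r x - r y).
    by apply: measurable_funB => //; exact: mr.
  apply: measurable_funD; first by apply: measurable_funM; exact: m1.
  apply: measurable_funM; first exact: measurable_scale.
  by apply: measurable_funM; exact: ms2.
pose f y := Nker r 0 x y / D y `^ (alpha / 2).
have mf : measurable_fun setT f.
  apply: measurable_funM; first exact: measurable_Nker.
  have -> : (fun y => (D y `^ (alpha / 2))^-1) = fun y => D y `^ (- (alpha / 2)).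
    by apply/funext => y; rewrite powRN.
  exact: (measurableT_comp (measurable_powR _) mD).
have pp := periodic_derive _ _ dr per.
have pf : periodic f (2 * pi).
  move=> y; rewrite /f /D /Nker (derive1_r r p dr) !per !pp !subr0 opprD addrA.
  have e : (x - y - 2 * pi) / 2 = (x - y) / 2 - pi by field.
  have s2 : sin ((x - y) / 2 - pi) ^+ 2 = sin ((x - y) / 2) ^+ 2.
    by rewrite sinB sinpi cospi mulr0 subr0 mulrN1 sqrrN.
  have s1 : sin (x - y - 2 * pi) = sin (x - y).
    by rewrite -[in RHS](subrK (2 * pi) (x - y)) mulr_natl sinD2pi.
  have c1 : cos (x - y - 2 * pi) = cos (x - y).
    by rewrite -[in RHS](subrK (2 * pi) (x - y)) mulr_natl cosD2pi.
  by rewrite e s2 s1 c1.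
have -> : self_integral x = J f by rewrite -Rintegral_J.
have iw : intg (wt (alpha - 1)).
  by apply: intg_wt; rewrite subr_ge0 alpha1/=; move: alpha2; lra.
have Ym := Y_muker alpha r p dr per rbd P 0 Yp.
have Yk := Y_kapker alpha r p dr per rbd pbd P 0 Yp.
have [Cm _ bm] := Ycls_bounded _ _ _ Ym.
have [Ck Ck0 bk] := Ycls_bounded _ _ _ Yk.
have [L L0 lp] := Ycls_lipschitz _ _ _ Yp.
have i1 : intg (fun t => muker alpha r p x t * wt (alpha - 1) t).
  by apply: (@intgM _ _ _ Cm) => //; exact: (Ycls_measurable _ _ _ Ym).
have i2 : intg (fun t => dq p x t * kapker alpha r p x t * wt (alpha - 1) t).
  apply: (@intgM _ _ _ (2 * L * Ck)) => //.
    apply: measurable_funM; first exact: measurable_dq.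
    exact: (Ycls_measurable _ _ _ Yk).
  by move=> t; apply: ler_prod_norm => //; apply: dq_le => // y h; exact: lp y h 0.
have E t : 0 < t < 2 * pi -> cnorm alpha r p x * f (x - t) =
    muker alpha r p x t * wt (alpha - 1) t - dq p x t * kapker alpha r p x t * wt (alpha - 1) t.
  by move=> tI; rewrite /f /D self_integrand// mulrBl.
have c0 : 0 < cnorm alpha r p x.
  by rewrite divr_gt0 ?powR_gt0 ?(rpden_gt0 r p rbd)// (r_gt0 r rbd).
rewrite -JB// -(J_reflection f x)//.
(* Integrability of the original integrand is read off the identity [E], after division by [cnorm],
   which is positive. *)
have ifx : intg (fun t => f (x - t)).
  apply: (@eq_intg _ (fun t => (cnorm alpha r p x)^-1 *
    (muker alpha r p x t * wt (alpha - 1) t - dq p x t * kapker alpha r p x t * wt (alpha - 1) t))).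
    by move=> t tI; rewrite -E// mulKf// gt_eqF.
  by apply: intgZ; exact: intgB.
by rewrite -JZ//; apply: eq_J => t tI; rewrite E.
Qed.

(** The form shared by both equations: [G] gathers everything but the self-interaction, and only has
    to be as regular as [p]. *)
Theorem contour_regularity p' b H G c1 :
  (forall x : R, is_derive x (1 : R) p (p' x)) -> (exists B, forall x, `|p' x| <= B) ->
  alpha - 1 < b -> b <= 1 -> 0 <= H ->
  (forall x t, 0 < t < 2 * pi -> `|p' x - p' (x - t)| <= H * chord t `^ b) ->
  (forall P n, Ycls P n (fun x _ => p x) -> Ycls P n (fun x _ => G x)) ->
  c1 != 0 -> (forall x, G x + c1 * self_integral x = 0) ->
  forall n, lipcls n (fun x _ => p x).
Proof.
move=> dp [B bp'] b1 b2 H0 hp' YG c10 E.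
have Y0 : lipcls 0 (fun x _ => p x).
  have B0 : 0 <= B by rewrite (le_trans _ (bp' 0)).
  split; first by move=> x; exact: measurable_cst.
  exists (1 / 4 + B); first by rewrite addr_ge0//; lra.
  split=> //.
  - by move=> x _; rewrite (le_trans (pbd x))// lerDl.
  - move=> x h _; rewrite (le_trans (derive_bound_lipschitz p p' B dp bp' x h))//.
    by rewrite ler_wpM2r// lerDr; lra.
apply: (bootstrap alpha r p alpha1 alpha2 dr per rbd pbd p' b H
  (fun x => J (fun t => muker alpha r p x t * wt (alpha - 1) t)
            + c1^-1 * (cnorm alpha r p x * G x))) => //.
- by exists B.
- move=> P n Yp; apply: YclsD.
    apply: Ycls_J; last exact: Y_muker.
    by apply: intg_wt; rewrite subr_ge0 alpha1/=; move: alpha2; lra.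
  apply: YclsM; first exact: YclsC.
  apply: (YclsM _ _ (fun x _ => cnorm alpha r p x) (fun x _ => G x)); first exact: Y_cnorm.
  exact: YG.
- move=> x; have e := self_integralE _ x Y0.
  have -> : G x = - (c1 * self_integral x) by apply/eqP; rewrite -addr_eq0 E.
  have -> : c1^-1 * (cnorm alpha r p x * - (c1 * self_integral x)) =
     - (cnorm alpha r p x * self_integral x) by field.
  by rewrite e; ring.
Qed.

(** A positive lower bound on the squared distance makes the kernel a smooth function of entries in
    the class. Dependence on the integration variable needs only to be measurable and bounded, since
    regularity is asked in [x] alone. *)
Lemma Y_external (th : R) (a1 a2 b1 b2 : R -> R) (c B : R) P n :
  Ycls P n (fun x _ => p x) ->
  Ycls P n (fun x _ => a1 x) -> Ycls P n (fun x _ => a2 x) ->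
  continuous b1 -> continuous b2 -> (forall y, `|b1 y| <= B) -> (forall y, `|b2 y| <= B) ->
  0 < c -> (forall x y, c <= (a1 x + b1 y) ^+ 2 + (a2 x + b2 y) ^+ 2) ->
  Ycls P n (fun x _ => \int[leb]_(y in `[0, 2 * pi])
    (Nker r th x y / enorm (a1 x + b1 y, a2 x + b2 y) `^ alpha)).
Proof.
move=> Yp Ya1 Ya2 cb1 cb2 bb1 bb2 c0 Qc.
pose Q x y := (a1 x + b1 y) ^+ 2 + (a2 x + b2 y) ^+ 2.
pose k x y := Nker r th x y * Q x y `^ (- (alpha / 2)).
have mb1 := continuous_measurable b1 cb1; have mb2 := continuous_measurable b2 cb2.
have Yb1 : Ycls P n (fun _ y => b1 y) by exact: (Ycls_cst _ _ b1 B).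
have Yb2 : Ycls P n (fun _ y => b2 y) by exact: (Ycls_cst _ _ b2 B).
have Yr := Ycls_S _ _ _ (Y_r r p dr rbd _ _ Yp).
have mr := continuous_measurable r cr; have mp := continuous_measurable p cp.
have Yry : Ycls P n (fun _ y => r y) by apply: (Ycls_cst _ _ r 2) => //; exact: r_norm.
have Ypy : Ycls P n (fun _ y => p y) by exact: (Ycls_cst _ _ p (1 / 4)).
have YQ : Ycls P n Q.
  have -> : Q = fun x y => (a1 x + b1 y) * (a1 x + b1 y) + (a2 x + b2 y) * (a2 x + b2 y).
    by apply/funext => x; apply/funext => y; rewrite /Q !expr2.
  have Y1 : Ycls P n (fun x y => a1 x + b1 y) by exact: YclsD.
  have Y2 : Ycls P n (fun x y => a2 x + b2 y) by exact: YclsD.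
  by apply: YclsD; exact: YclsM.
have YN : Ycls P n (Nker r th).
  have mw : measurable_fun setT (fun y : R => - y - th).
    by apply: measurable_funB => //; exact: measurableT_comp.
  have [Ys Yc] := Ycls_sincos P n _ mw.
  have -> : Nker r th = fun x y =>
      (r x * r y + p x * p y) * sin (x + (- y - th))
      + (r x * p y - p x * r y) * cos (x + (- y - th)).
    apply/funext => x; apply/funext => y; rewrite /Nker (derive1_r r p dr).
    by rewrite addrA.
  apply: YclsD; apply: YclsM => //.
    by apply: YclsD; [exact: (YclsM _ _ (fun x _ => r x))|exact: (YclsM _ _ (fun x _ => p x))].
  by apply: YclsB; [exact: (YclsM _ _ (fun x _ => r x))|exact: (YclsM _ _ (fun x _ => p x))].
have Yk : Ycls P n k by apply: YclsM => //; exact: (Ycls_powR _ _ _ _ c).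
have i1 : intg (fun=> 1 : R) by apply: (@intg_bounded _ _ 1) => // t; rewrite normr1.
congr Ycls: (Ycls_J P n k _ i1 Yk); apply/funext => x; apply/funext => _.
have -> : (fun y => Nker r th x y / enorm (a1 x + b1 y, a2 x + b2 y) `^ alpha) = k x.
  apply/funext => y; rewrite /k /enorm /= -powR12_sqrt; last first.
    by rewrite addr_ge0 ?sqr_ge0.
  by rewrite -powRrM powRN; congr (_ / _ `^ _); field.
rewrite Rintegral_J; last exact: (Ycls_measurable _ _ _ Yk).
by apply: eq_J => y _; rewrite mulr1.
Qed.

End contour_equation.

(** * The two contour equations *)

Section patch_equations.
Context {R : realType}.
Implicit Types (x y z t h a b c : R) (P : R -> R -> Prop).
Local Notation leb := (@lebesgue_measure R).
Local Notation plane := (R^o * R^o)%type.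
Context (alpha : R) (r p : R -> R).
Context (dr : forall x : R, is_derive x (1 : R) r (p x)).
Context (rbd : forall x, 1 / 2 <= r x <= 2) (pbd : forall x, `|p x| <= 1 / 4).
Context (cp : continuous p).
Context (eps d : R) (eps0 : 0 < eps) (d1 : 1 < d).

(** The right side minus the left side is half of [|v + 2 w|^2]. Here [v] will be the displacement
    between the centres of two patches and [w] a vector of size [eps]. *)
Lemma sqr_sum_lower (v1 v2 w1 w2 : R) :
  (v1 ^+ 2 + v2 ^+ 2) / 2 - (w1 ^+ 2 + w2 ^+ 2) <= (v1 + w1) ^+ 2 + (v2 + w2) ^+ 2.
Proof.
have := sqr_ge0 (v1 + 2 * w1); have := sqr_ge0 (v2 + 2 * w2).
by rewrite !expr2; lra.
Qed.

Lemma polar_dist_le (A B x y : R) : 0 <= A <= 2 -> 0 <= B <= 2 ->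
  (A * cos x - B * cos y) ^+ 2 + (A * sin x - B * sin y) ^+ 2 <= 16.
Proof.
move=> /andP[A0 A2] /andP[B0 B2].
have A4 : A * A <= 2 * 2 by exact: ler_pM.
have B4 : B * B <= 2 * 2 by exact: ler_pM.
have e1 := sqr_ge0 (A * cos x + B * cos y); have e2 := sqr_ge0 (A * sin x + B * sin y).
have c1 : A * A * (cos x ^+ 2 + sin x ^+ 2) = A * A by rewrite cos2Dsin2 mulr1.
have c2 : B * B * (cos y ^+ 2 + sin y ^+ 2) = B * B by rewrite cos2Dsin2 mulr1.
by move: e1 e2 c1 c2; rewrite !expr2; lra.
Qed.

Lemma r_interval x : 0 <= r x <= 2.
Proof. by have /andP[h1 h2] := rbd x; rewrite h2 andbT; lra. Qed.

Lemma Y_sin P n : Ycls P n (fun x (_ : R) => sin x).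
Proof.
have [+ _] := Ycls_sincos P n (fun=> 0) (measurable_cst _).
by under eq_fun do under eq_fun do rewrite addr0.
Qed.

Lemma Y_cos P n : Ycls P n (fun x (_ : R) => cos x).
Proof.
have [_ +] := Ycls_sincos P n (fun=> 0) (measurable_cst _).
by under eq_fun do under eq_fun do rewrite addr0.
Qed.

Lemma Ycls1M P n (f g : R -> R) : Ycls P n (fun x _ => f x) -> Ycls P n (fun x _ => g x) ->
  Ycls P n (fun x _ => f x * g x).
Proof. exact: (YclsM P n (fun x _ => f x) (fun x _ => g x)). Qed.

Lemma Ycls_sum P n (I : Type) (s : seq I) (Q : pred I) (f : I -> R -> R) :
  (forall i, Q i -> Ycls P n (fun x _ => f i x)) ->
  Ycls P n (fun x (_ : R) => \sum_(i <- s | Q i) f i x).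
Proof.
move=> Yf; elim: s => [|i s IH].
  by under eq_fun do under eq_fun do rewrite big_nil; exact: YclsC.
under eq_fun do under eq_fun do rewrite big_cons.
case: (boolP (Q i)) => // Qi.
by apply: (YclsD P n (fun x _ => f i x) (fun x _ => _)) => //; exact: Yf.
Qed.

Let cr : continuous r := is_derive_continuous r p dr.

Lemma continuous_polar (c s : R) :
  continuous (fun y => eps * r y * (c * cos y + s * sin y)).
Proof.
move=> y; apply: cvgM; first by apply: cvgM; [exact: cvg_cst|exact: cr].
by apply: cvgD; apply: cvgM; do 1?[exact: cvg_cst]; [exact: continuous_cos|exact: continuous_sin].
Qed.

Lemma polar_bound (c s y : R) : `|c| <= 1 -> `|s| <= 1 ->
  `|eps * r y * (c * cos y + s * sin y)| <= eps * 2 * 2.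
Proof.
move=> c1 s1; apply: ler_prod_norm.
  by apply: ler_prod_norm; [rewrite gtr0_norm|exact: r_norm].
rewrite (le_trans (ler_normD _ _))// (_ : 2 = 1 * 1 + 1 * 1); last by ring.
by apply: lerD; apply: ler_prod_norm => //; [exact: cos_max|exact: sin_max].
Qed.

(** The other patch is the rotation of the first one by the angle of cosine [c] and sine [s],
    translated by [v]. Both points lie within [2 eps] of their centres, whence [16 eps^2], and [b]
    bounds the squared distance from below. *)
Lemma Y_patch_term (th : R) (v1 v2 b c s : R) P n :
  Ycls P n (fun x _ => p x) -> `|c| <= 1 -> `|s| <= 1 -> c ^+ 2 + s ^+ 2 = 1 ->
  16 * eps ^+ 2 + b <= (v1 ^+ 2 + v2 ^+ 2) / 2 -> 0 < b ->
  Ycls P n (fun x _ => \int[leb]_(y in `[0, 2 * pi])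
    (Nker r th x y / enorm (eps * r x * cos x + (v1 - eps * r y * (c * cos y - s * sin y)),
                            eps * r x * sin x + (v2 - eps * r y * (s * cos y + c * sin y)))
       `^ alpha)).
Proof.
move=> Yp c1 s1 cs vb b0.
have Yr := Ycls_S _ _ _ (Y_r r p dr rbd _ _ Yp).
have cN1 : `|- s| <= 1 by rewrite normrN.
have E1 : (fun y => v1 - eps * r y * (c * cos y - s * sin y)) =
          fun y => v1 - eps * r y * (c * cos y + - s * sin y).
  by apply/funext => y; rewrite mulNr.
have [al [ca sa]] : exists al : R, cos al = c /\ sin al = s.
  have cI : -1 <= c <= 1 by rewrite -ler_norml.
  have sc : Num.sqrt (1 - c ^+ 2) = `|s|.
    by rewrite -cs addrAC subrr add0r sqrtr_sqr.
  have [s0|s0] := leP 0 s.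
    exists (acos c); split; first by rewrite acosK// in_itv.
    by rewrite sin_acos// sc ger0_norm.
  exists (- acos c); split; first by rewrite cosN acosK// in_itv.
  by rewrite sinN sin_acos// sc ltr0_norm// opprK.
apply: (Y_external alpha r p dr rbd pbd cp th (fun x => eps * r x * cos x)
  (fun x => eps * r x * sin x) (fun y => v1 - eps * r y * (c * cos y - s * sin y))
  (fun y => v2 - eps * r y * (s * cos y + c * sin y)) b
  (`|v1| + `|v2| + eps * 2 * 2)) => //.
- by apply: Ycls1M; [apply: (Ycls1M _ _ (fun=> eps)) => //; exact: YclsC|exact: Y_cos].
- by apply: Ycls1M; [apply: (Ycls1M _ _ (fun=> eps)) => //; exact: YclsC|exact: Y_sin].
- by rewrite E1 => y; apply: cvgB; [exact: cvg_cst|exact: continuous_polar].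
- by move=> y; apply: cvgB; [exact: cvg_cst|exact: continuous_polar].
- move=> y; have -> : c * cos y - s * sin y = c * cos y + - s * sin y by rewrite mulNr.
  rewrite (le_trans (ler_normB _ _))// lerD//; last exact: polar_bound.
  by rewrite lerDl.
- move=> y; rewrite (le_trans (ler_normB _ _))// lerD//; last exact: polar_bound.
  by rewrite lerDr.
move=> x y.
have := sqr_sum_lower v1 v2 (eps * (r x * cos x - r y * cos (y + al)))
  (eps * (r x * sin x - r y * sin (y + al))).
have := polar_dist_le (r x) (r y) x (y + al) (r_interval x) (r_interval y).
rewrite cosD sinD ca sa.
set U := (_ - _) ^+ 2; set V := (_ - _) ^+ 2 => UV.
have e2 : 0 <= eps ^+ 2 by rewrite sqr_ge0.
have := ler_wpM2l e2 UV; rewrite !exprMn -/U -/V => H1 H2.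
have := vb; have -> : eps * r x * cos x + (v1 - eps * r y * (c * cos y - s * sin y)) =
   v1 + eps * (r x * cos x - r y * (cos y * c - sin y * s)) by ring.
have -> : eps * r x * sin x + (v2 - eps * r y * (s * cos y + c * sin y)) =
   v2 + eps * (r x * sin x - r y * (sin y * c + cos y * s)) by ring.
by move: H1 H2; lra.
Qed.

Lemma enorm_rotated (th x y : R) :
  enorm ((curve eps r x - ((d, 0) : plane))
         - rotation th (curve eps r y - ((d, 0) : plane))) =
  enorm (eps * r x * cos x + (d * cos th - d - eps * r y * (cos th * cos y - sin th * sin y)),
         eps * r x * sin x + (d * sin th - eps * r y * (sin th * cos y + cos th * sin y))).
Proof.
rewrite /enorm /rotation /curve /=; congr (Num.sqrt (_ ^+ 2 + _ ^+ 2)).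
  by set A := cos th; set B := sin th; ring.
by set A := cos th; set B := sin th; ring.
Qed.

Lemma enorm_reflected (x y : R) :
  enorm (curve eps r x + curve eps r y - ((2 * d, 0) : plane)) =
  enorm (eps * r x * cos x + (- (2 * d) - eps * r y * (-1 * cos y - 0 * sin y)),
         eps * r x * sin x + (0 - eps * r y * (0 * cos y + -1 * sin y))).
Proof. by rewrite /enorm /curve /=; congr (Num.sqrt (_ ^+ 2 + _ ^+ 2)); ring. Qed.

Lemma CR_equation m Om (s : R) : 0 < Calpha alpha -> 0 < s ->
  (forall i, (1 <= i < m)%N -> s <= sin (pi * i%:R / m%:R)) -> 4 * eps <= s ->
  CR alpha eps d r m Om ->
  exists G c1, [/\ c1 != 0,
    forall P n, Ycls P n (fun x _ => p x) -> Ycls P n (fun x _ => G x) &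
    forall x, G x + c1 * self_integral alpha r x = 0].
Proof.
move=> C0 s0 sP es eqn.
pose th i : R := 2 * pi * i%:R / m%:R.
pose X i x := \int[leb]_(y in `[0, 2 * pi])
    (Nker r (th i) x y /
     enorm (eps * r x * cos x + (d * cos (th i) - d - eps * r y * (cos (th i) * cos y - sin (th i) * sin y)),
            eps * r x * sin x + (d * sin (th i) - eps * r y * (sin (th i) * cos y + cos (th i) * sin y)))
       `^ alpha).
(* The equation multiplied by [r x], which removes the quotients by [r x] and makes the coefficient
   of the self-interaction constant. *)
exists (fun x => Om * (eps * (p x * r x) - d * (p x * cos x) + d * (sin x * r x))
   + \sum_(1 <= i < m) Calpha alpha / eps * ((2 * pi)^-1 * X i x)).
exists (Calpha alpha / eps `^ (1 + alpha) * (2 * pi)^-1); split.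
- rewrite mulf_neq0 ?invr_eq0 ?(gt_eqF pi2_gt0)// mulf_neq0 ?invr_eq0 ?gt_eqF//.
  exact: powR_gt0.
- move=> P n Yp; have Yr := Ycls_S _ _ _ (Y_r r p dr rbd _ _ Yp).
  have YC c := YclsC P n c.
  apply: (YclsD P n (fun x _ => Om * _) (fun x _ => \sum_(1 <= i < m) _)).
    apply: (Ycls1M _ _ (fun=> Om)) => //.
    apply: (YclsD P n (fun x _ => _ - _) (fun x _ => d * _)).
      apply: (YclsB P n (fun x _ => eps * _) (fun x _ => d * _)).
        by apply: (Ycls1M _ _ (fun=> eps)) => //; exact: Ycls1M.
      by apply: (Ycls1M _ _ (fun=> d)) => //; apply: Ycls1M => //; exact: Y_cos.
    by apply: (Ycls1M _ _ (fun=> d)) => //; apply: Ycls1M => //; exact: Y_sin.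
  under eq_fun do under eq_fun do rewrite big_nat.
  apply: Ycls_sum => i im.
  apply: (Ycls1M _ _ (fun=> Calpha alpha / eps)) => //.
  apply: (Ycls1M _ _ (fun=> (2 * pi)^-1)) => //.
  apply: (Y_patch_term _ _ _ (s ^+ 2)) => //; [exact: cos_max|exact: sin_max|exact: cos2Dsin2| |].
    (* The centres are at distance [2 d sin (pi i / m)]. With [d > 1] and [4 eps <= s], half its
       square is at least [2 s^2 >= 16 eps^2 + s^2]. *)
    have -> : ((d * cos (th i) - d) ^+ 2 + (d * sin (th i)) ^+ 2) / 2 =
        2 * d ^+ 2 * sin (pi * i%:R / m%:R) ^+ 2.
      have -> : th i = (pi * i%:R / m%:R) *+ 2 by rewrite /th mulr2n; ring.
      rewrite cos_mulr2n sin_mulr2n; set S := sin _; set K := cos _.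
      have cK : K ^+ 2 = 1 - S ^+ 2 by exact: cos2sin2.
      have -> : (d * (K ^+ 2 *+ 2 - 1) - d) ^+ 2 + (d * ((K * S) *+ 2)) ^+ 2 =
        (d * (K ^+ 2 *+ 2 - 1) - d) ^+ 2 + 4 * d ^+ 2 * K ^+ 2 * S ^+ 2.
        by rewrite -mulr_natl; ring.
      by rewrite cK -mulr_natl; field.
    have sS := sP i im.
    have q1 : s * s <= sin (pi * i%:R / m%:R) * sin (pi * i%:R / m%:R).
      by apply: ler_pM => //; exact: ltW.
    have q2 : (4 * eps) * (4 * eps) <= s * s.
      by apply: ler_pM => //; rewrite mulr_ge0// ltW.
    have q3 : 1 * 1 <= d * d by apply: ler_pM => //; exact: ltW.
    have q4 : 0 <= s * s by exact: mulr_ge0 (ltW s0) (ltW s0).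
    have q5 := ler_pM q4 ler01.
    have q6 : s * s * (1 * 1) <= sin (pi * i%:R / m%:R) * sin (pi * i%:R / m%:R) * (d * d).
      by apply: ler_pM => //.
    by move: q2 q6 q4; rewrite !expr2; lra.
  by rewrite exprn_gt0.
move=> x.
have r0 : r x != 0 by rewrite gt_eqF// (r_gt0 r rbd).
have e0 : eps != 0 by rewrite gt_eqF.
have {}eqn : Om * (eps * derive1 r x - d * derive1 r x * cos x / r x + d * sin x)
  + self_term alpha eps r x
  + \sum_(1 <= i < m) Calpha alpha / (eps * r x) * ((2 * pi)^-1 * X i x) = 0.
  apply: (eq_trans _ (eqn x)).
  apply: (congr2 +%R (erefl _)).
  apply: eq_bigr => i _.
  apply: (congr2 *%R (erefl _)).
  apply: (congr2 *%R (erefl _)).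
  apply: eq_Rintegral => y _.
  apply: (congr2 *%R (erefl _)).
  apply: (congr1 (fun z : R => (z `^ alpha)^-1)).
  exact/esym/enorm_rotated.
have sumE : \sum_(1 <= i < m) Calpha alpha / (eps * r x) * ((2 * pi)^-1 * X i x) =
    \sum_(1 <= i < m) (r x)^-1 * (Calpha alpha / eps * ((2 * pi)^-1 * X i x)).
  apply: eq_bigr => i _; move: (X i x) ((2 * pi)^-1) => Xi q.
  by field; rewrite r0 e0.
move: eqn; rewrite /self_term (derive1_r r p dr).
have ea : eps `^ (1 + alpha) != 0 by rewrite gt_eqF// powR_gt0.
have pi0 : 2 * pi != 0 :> R by rewrite gt_eqF// pi2_gt0.
rewrite -/(self_integral alpha r x).
set S := self_integral alpha r x.
rewrite sumE -mulr_sumr.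
set T := \sum_(1 <= i < m) _ => H.
have E : Om * (eps * (p x * r x) - d * (p x * cos x) + d * (sin x * r x)) + T +
   Calpha alpha / eps `^ (1 + alpha) / (2 * pi) * S =
   r x * (Om * (eps * p x - d * p x * cos x / r x + d * sin x) +
     Calpha alpha / (eps `^ (1 + alpha) * r x) * ((2 * pi)^-1 * S) + (r x)^-1 * T).
  move: ((2 * pi)^-1) (eps `^ _) ea => q w ea.
  by field; rewrite r0 ea.
by rewrite E H mulr0.
Qed.

Lemma TR_equation W : 0 < Calpha alpha -> 4 * eps <= 1 -> TR alpha eps d r W ->
  exists G c1, [/\ c1 != 0,
    forall P n, Ycls P n (fun x _ => p x) -> Ycls P n (fun x _ => G x) &
    forall x, G x + c1 * self_integral alpha r x = 0].
Proof.
move=> C0 es eqn.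
pose X x := \int[leb]_(y in `[0, 2 * pi])
    (Nker r 0 x y /
     enorm (eps * r x * cos x + (- (2 * d) - eps * r y * (-1 * cos y - 0 * sin y)),
            eps * r x * sin x + (0 - eps * r y * (0 * cos y + -1 * sin y)))
       `^ alpha).
exists (fun x => - W * (sin x * r x - p x * cos x)
   + Calpha alpha / eps * ((2 * pi)^-1 * X x)).
exists (Calpha alpha / eps `^ (1 + alpha) * (2 * pi)^-1); split.
- rewrite mulf_neq0 ?invr_eq0 ?(gt_eqF pi2_gt0)// mulf_neq0 ?invr_eq0 ?gt_eqF//.
  exact: powR_gt0.
- move=> P n Yp; have Yr := Ycls_S _ _ _ (Y_r r p dr rbd _ _ Yp).
  have YC c := YclsC P n c.
  apply: (YclsD P n (fun x _ => - W * _) (fun x _ => _ * _)).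
    apply: (Ycls1M _ _ (fun=> - W)) => //.
    apply: (YclsB P n (fun x _ => _ * _) (fun x _ => _ * _)).
      by apply: Ycls1M => //; exact: Y_sin.
    by apply: Ycls1M => //; exact: Y_cos.
  apply: (Ycls1M _ _ (fun=> Calpha alpha / eps)) => //.
  apply: (Ycls1M _ _ (fun=> (2 * pi)^-1)) => //.
  (* The rotation by [pi], with centres at distance [2 d]: half the square is
     [2 d^2 >= 2 >= 16 eps^2 + 1]. *)
  apply: (Y_patch_term _ _ _ 1) => //.
  + by rewrite normrN normr1.
  + by rewrite normr0.
  + by rewrite sqrrN expr1n expr0n/= addr0.
  + have q2 : (4 * eps) * (4 * eps) <= 1 * 1.
      by apply: ler_pM => //; rewrite mulr_ge0// ltW.
    have q3 : 1 * 1 <= d * d by apply: ler_pM => //; exact: ltW.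
    by move: q2 q3; rewrite !expr2; lra.
move=> x.
have r0 : r x != 0 by rewrite gt_eqF// (r_gt0 r rbd).
have e0 : eps != 0 by rewrite gt_eqF.
have ea : eps `^ (1 + alpha) != 0 by rewrite gt_eqF// powR_gt0.
have {}eqn : - W * (sin x - derive1 r x / r x * cos x) + self_term alpha eps r x
   + Calpha alpha / (eps * r x) * ((2 * pi)^-1 * X x) = 0.
  apply: (eq_trans _ (eqn x)).
  apply: (congr2 +%R (erefl _)).
  apply: (congr2 *%R (erefl _)).
  apply: (congr2 *%R (erefl _)).
  apply: eq_Rintegral => y _.
  apply: (congr2 *%R (erefl _)).
  apply: (congr1 (fun z : R => (z `^ alpha)^-1)).
  exact/esym/enorm_reflected.
move: eqn; rewrite /self_term (derive1_r r p dr).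
rewrite -/(self_integral alpha r x).
set S := self_integral alpha r x.
move=> H.
have E : - W * (sin x * r x - p x * cos x) + Calpha alpha / eps * ((2 * pi)^-1 * X x) +
   Calpha alpha / eps `^ (1 + alpha) / (2 * pi) * S =
   r x * (- W * (sin x - p x / r x * cos x) +
     Calpha alpha / (eps `^ (1 + alpha) * r x) * ((2 * pi)^-1 * S) +
     Calpha alpha / (eps * r x) * ((2 * pi)^-1 * X x)).
  move: ((2 * pi)^-1) (eps `^ _) ea (X x) => q w ea Xx.
  by field; rewrite r0 ea e0.
by rewrite E H mulr0.
Qed.

End patch_equations.

Section smoothness.
Context {R : realType}.

(** Depends on [m] alone, so it may enter the choice of [eps0]. *)
Lemma sin_min m : exists2 s : R, 0 < s &
  forall i, (1 <= i < m)%N -> s <= sin (pi * i%:R / m%:R).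
Proof.
suff H j : exists2 s : R, 0 < s & forall i, (1 <= i < m)%N -> (i < j)%N -> s <= sin (pi * i%:R / m%:R).
  by have [s s0 sP] := H m; exists s => // i im; apply: sP => //; case/andP: im.
elim: j => [|j [s s0 IH]]; first by exists 1.
case: (boolP (1 <= j < m)%N) => [jm|jm]; last first.
  exists s => // i im; rewrite ltnS leq_eqVlt => /orP[/eqP ij|ij]; last exact: IH.
  by rewrite -ij im in jm.
exists (Num.min s (sin (pi * j%:R / m%:R))).
  rewrite lt_min s0 sin_gt0_pi//; move/andP: jm => [j1 jm].
  have m0 : 0 < m%:R :> R by rewrite ltr0n (leq_trans _ jm).
  have j0 : 0 < j%:R :> R by rewrite ltr0n.
  rewrite divr_gt0 ?mulr_gt0 ?pi_gt0//= ltr_pdivrMr// ltr_pM2l ?pi_gt0//.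
  by rewrite ltr_nat.
move=> i im; rewrite ltnS leq_eqVlt ge_min => /orP[/eqP ->|ij]; first by rewrite lexx orbT.
by rewrite IH.
Qed.

Lemma lipcls_derivable n (f : R -> R) : lipcls n.+1 (fun x _ => f x) ->
  forall x, derivable (derive1n n f) x 1.
Proof.
elim: n f => [|n IH] f Yf x.
  by have [f' df _] := Ycls_derive (fun _ _ => False) 0 f Yf; case: (df x).
have [f' df Yf'] := Ycls_derive (fun _ _ => False) n.+1 f Yf.
have -> : derive1n n.+1 f = derive1n n f'.
  rewrite derive1Sn; congr derive1n; apply/funext => y.
  by rewrite derive1E (@derive_val _ _ _ _ _ _ _ (df y)).
exact: IH.
Qed.

Lemma lipcls_smooth (f : R -> R) : (forall n, lipcls n (fun x _ => f x)) -> smooth f.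
Proof. by move=> Yf n x; exact: lipcls_derivable. Qed.

End smoothness.

(** * Cosine series *)

Section dominated_series.
Context {R : realType}.
Implicit Types (u v w : nat -> R) (x y h b K M : R).

Lemma series_dominated_cvg u w K M : (forall j, `|u j| <= K * w j) ->
  (forall N, series w N <= M) -> 0 <= K -> cvgn (series u).
Proof.
move=> uw wM K0; apply: normed_cvg.
have nd : nondecreasing_seq (series (fun n => `|u n|)).
  apply/nondecreasing_seqP => n; rewrite /series /= [leRHS]big_mkord big_ord_recr/=.
  by rewrite -(big_mkord xpredT (fun i => `|u i|)) lerDl.
apply: (nondecreasing_is_cvgn nd).
exists (K * M) => _ [n _ <-]; rewrite /series /=.
apply: (@le_trans _ _ (\sum_(0 <= k < n) K * w k)); first exact: ler_sum.
by rewrite -mulr_sumr; exact: ler_wpM2l (wM n).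
Qed.

Lemma series_dominated_le u w K M : (forall j, `|u j| <= K * w j) ->
  (forall N, series w N <= M) -> 0 <= K -> `|limn (series u)| <= K * M.
Proof.
move=> uw wM K0; have cu := series_dominated_cvg u w K M uw wM K0.
have cn : (fun n => `|series u n|) @ \oo --> `|limn (series u)| by exact: (cvg_norm cu).
apply: (cvgr_to_le cn); apply: nearW => n.
rewrite /series /= (le_trans (ler_norm_sum _ _ _))//.
apply: (@le_trans _ _ (\sum_(0 <= k < n) K * w k)); first exact: ler_sum.
by rewrite -mulr_sumr; exact: ler_wpM2l (wM n).
Qed.

Lemma lim_seriesB u v : cvgn (series u) -> cvgn (series v) ->
  limn (series u) - limn (series v) = limn (series (fun j => u j - v j)).
Proof.
move=> cu cv; apply/esym/cvg_lim => //.
have -> : series (fun j => u j - v j) = fun n => series u n - series v n.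
  by apply/funext => n; rewrite /series /= sumrB.
exact: cvgB.
Qed.

Lemma lim_seriesZ u x : cvgn (series u) ->
  x * limn (series u) = limn (series (fun j => x * u j)).
Proof.
move=> cu; apply/esym/cvg_lim => //.
have -> : series (fun j => x * u j) = fun n => x * series u n.
  by apply/funext => n; rewrite /series /= mulr_sumr.
by apply: cvgM => //; exact: cvg_cst.
Qed.

Lemma is_derive_remainder (F : R -> R) (x G C b : R) : 0 < b ->
  (forall h, `|F (x + h) - F x - h * G| <= C * (`|h| * `|h| `^ b)) ->
  is_derive x (1 : R) F G.
Proof.
move=> b0 H.
have C0 : 0 <= C.
  by have := le_trans (normr_ge0 _) (H 1); rewrite normr1 powR1 !mulr1.
have cv : (fun h : R => h^-1 *: ((F \o shift x) (h *: (1 : R)) - F x)) @ 0^' --> G.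
  apply/cvgrPdist_le => e e0.
  have C1 : 0 < C + 1 by rewrite ltr_wpDl.
  pose dl := (e / (C + 1)) `^ (b^-1).
  have ec : 0 < e / (C + 1) by rewrite divr_gt0.
  have dl0 : 0 < dl by exact: powR_gt0.
  exists dl => // h; rewrite /ball_ /= sub0r normrN => hd hn0.
  have h0 : h != 0 by apply/eqP => E; rewrite E eqxx in hn0.
  have ha : 0 < `|h| by rewrite normr_gt0.
  rewrite /= /GRing.scale /= mulr1 (addrC h) distrC.
  have -> : h^-1 * (F (x + h) - F x) - G = (F (x + h) - F x - h * G) / h by field.
  rewrite normrM normfV ler_pdivrMr// (le_trans (H h))//.
  have hb : `|h| `^ b <= e / (C + 1).
      have -> : e / (C + 1) = dl `^ b by rewrite /dl -powRrM mulVf ?gt_eqF// powRr1// ltW.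
    by apply: ge0_ler_powR; rewrite ?nnegrE//; exact: ltW.
  rewrite (mulrC `|h|) mulrA ler_wpM2r// (le_trans (ler_wpM2l C0 hb))//.
  rewrite mulrCA ler_piMr ?ltW// ltr_pdivrMr// mul1r ltrDl//.
apply: DeriveDef; first by apply/cvg_ex; exists G.
exact: (cvg_lim _ cv).
Qed.

End dominated_series.

Section cosine_series.
Context {R : realType}.
Implicit Types (x y h : R).
Context (a : nat -> R) (b M : R) (b0 : 0 < b) (b1 : b <= 1).
Context (M0 : 0 <= M) (a0 : a 0%N = 0).
Definition cos_weight (j : nat) : R := j%:R * j%:R * j%:R `^ b * `|a j|.
Context (wM : forall N, series cos_weight N <= M).

Definition cos_series x : R := limn (series (fun j => a j * cos (j%:R * x))).
Definition cos_series1 x : R := limn (series (fun j => - (j%:R * a j * sin (j%:R * x)))).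
Definition cos_series2 x : R := limn (series (fun j => - (j%:R * j%:R * a j * cos (j%:R * x)))).

Let powR_ge1 (s : R) : 1 <= s -> 1 <= s `^ b.
Proof.
move=> s1; have /= <- := congr1 (fun F => F b) (powR1 R).
by apply: ge0_ler_powR; rewrite ?nnegrE//; [exact: ltW|exact: le_trans s1].
Qed.

Let w_ge j : j%:R * j%:R * `|a j| <= cos_weight j.
Proof.
case: j => [|j]; first by rewrite /cos_weight !mul0r.
rewrite /cos_weight -[leRHS]mulrA (mulrC (_ `^ _)) mulrA ler_peMr//.
by rewrite powR_ge1 ?ler1n.
Qed.

Let w_ge1 j : j%:R * `|a j| <= cos_weight j.
Proof.
apply: le_trans (w_ge j); rewrite -mulrA; case: j => [|j]; first by rewrite !mul0r.
by rewrite ler_peMl ?ler1n// mulr_ge0.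
Qed.

(** The weight vanishes at [j = 0]; that index is covered by [a 0 = 0]. *)
Let w_ge0 j : `|a j| <= cos_weight j.
Proof.
apply: le_trans (w_ge1 j); case: j => [|j]; first by rewrite a0 normr0 mulr0.
by rewrite ler_peMl ?ler1n.
Qed.

Let d0 x j : `|a j * cos (j%:R * x)| <= 1 * cos_weight j.
Proof. by rewrite mul1r (le_trans _ (w_ge0 j))// normrM ler_piMr// cos_max. Qed.

Let d1 x j : `|- (j%:R * a j * sin (j%:R * x))| <= 1 * cos_weight j.
Proof.
rewrite mul1r normrN (le_trans _ (w_ge1 j))// !normrM (ger0_norm (ler0n _ _)).
by rewrite ler_piMr ?sin_max// mulr_ge0.
Qed.

Let d2 x j : `|- (j%:R * j%:R * a j * cos (j%:R * x))| <= 1 * cos_weight j.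
Proof.
rewrite mul1r normrN (le_trans _ (w_ge j))// !normrM (ger0_norm (ler0n _ _)).
by rewrite ler_piMr ?cos_max// !mulr_ge0.
Qed.

Lemma cos_series_cvg x : cvgn (series (fun j => a j * cos (j%:R * x))).
Proof. exact: (series_dominated_cvg _ _ 1 M (d0 x) wM). Qed.

Let c1 x : cvgn (series (fun j => - (j%:R * a j * sin (j%:R * x)))).
Proof. exact: (series_dominated_cvg _ _ 1 M (d1 x) wM). Qed.

Let c2 x : cvgn (series (fun j => - (j%:R * j%:R * a j * cos (j%:R * x)))).
Proof. exact: (series_dominated_cvg _ _ 1 M (d2 x) wM). Qed.

Lemma cos_series_le x : `|cos_series x| <= M.
Proof. by rewrite -[leRHS]mul1r; exact: (series_dominated_le _ _ 1 M (d0 x) wM). Qed.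

Lemma cos_series1_le x : `|cos_series1 x| <= M.
Proof. by rewrite -[leRHS]mul1r; exact: (series_dominated_le _ _ 1 M (d1 x) wM). Qed.

Lemma cos_series2_le x : `|cos_series2 x| <= M.
Proof. by rewrite -[leRHS]mul1r; exact: (series_dominated_le _ _ 1 M (d2 x) wM). Qed.

Let cos_taylor (y s : R) : `|cos (y + s) - cos y + s * sin y| <= s * s.
Proof.
have := taylor1 cos (fun x => - sin x) 1 y (- s) (@is_derive_cos R) ler01 _.
move=> H; have {}H : `|cos y - cos (y + s) - s * sin y| <= s * s.
  have := H _; rewrite opprK mulrNN mul1r sqrrN expr2 (mulrC (sin y)); apply => z h.
  rewrite -opprD normrN.
  exact: (derive_bound_lipschitz sin cos 1 (@is_derive_sin R) (@cos_max R)).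
by rewrite -normrN; move: H; congr (`|_| <= _); ring.
Qed.

Let sin_taylor2 (y s : R) : `|sin (y + s) - sin y - s * cos y| <= s * s.
Proof.
have := taylor1 sin cos 1 y (- s) (@is_derive_sin R) ler01 _.
rewrite opprK mul1r sqrrN expr2 mulrN opprK => H.
have {}H : `|sin y - sin (y + s) + cos y * s| <= s * s.
  apply: H => z h.
  apply: (derive_bound_lipschitz cos (fun x => - sin x) 1 (@is_derive_cos R)) => w.
  by rewrite normrN sin_max.
by rewrite -normrN; move: H; congr (`|_| <= _); ring.
Qed.

Let lip_sin (y s : R) : `|sin (y + s) - sin y| <= `|s|.
Proof.
by have := derive_bound_lipschitz sin cos 1 (@is_derive_sin R) (@cos_max R) y s; rewrite mul1r.
Qed.

Let lip_cos (y s : R) : `|cos (y + s) - cos y| <= `|s|.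
Proof.
have := derive_bound_lipschitz cos (fun x => - sin x) 1 (@is_derive_cos R) _ y s.
by rewrite mul1r; apply => w; rewrite normrN sin_max.
Qed.

(** Interpolation between a linear bound and a trivial one: below 1 use [s <= s ^ b], above 1 use
    [1 <= s ^ b]. Applied with [s = j |h|], it spends only the power [j^b] of the weight. *)
Let powb (s c : R) : 0 <= s -> 0 <= c -> c <= s -> c <= 2 -> c <= 2 * s `^ b.
Proof.
move=> s0 c0 cs cl; have [s1|s1] := leP s 1.
  rewrite (le_trans cs)// (le_trans (_ : s <= s `^ b)).
  - by [].
  - have [->|sn] := eqVneq s 0; first by rewrite powR0// gt_eqF.
    by apply: ger1_powR; rewrite // s1 lt_neqAle eq_sym sn s0.
  - by rewrite ler_peMl ?powR_ge0// ler1n.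
rewrite (le_trans cl)// ler_peMr//.
exact/powR_ge1/ltW.
Qed.

Lemma is_derive_cos_series (x : R) : is_derive x (1 : R) cos_series (cos_series1 x).
Proof.
apply: (is_derive_remainder _ _ _ M 1) => // h; rewrite powRr1//.
have ch : cvgn (series (fun j => h * - (j%:R * a j * sin (j%:R * x)))).
  have -> : series (fun j => h * - (j%:R * a j * sin (j%:R * x))) =
      fun n => h * series (fun j => - (j%:R * a j * sin (j%:R * x))) n.
    by apply/funext => n; rewrite /series /= mulr_sumr.
  by apply: is_cvgM; [exact: is_cvg_cst|exact: c1].
rewrite /cos_series /cos_series1 lim_seriesZ// lim_seriesB; [|exact: cos_series_cvg..].
have cB : cvgn (series (fun j => a j * cos (j%:R * (x + h)) - a j * cos (j%:R * x))).
  apply: (series_dominated_cvg _ cos_weight 2 M) => // j.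
  have -> : 2 * cos_weight j = 1 * cos_weight j + 1 * cos_weight j by ring.
  by rewrite (le_trans (ler_normB _ _))// lerD.
rewrite lim_seriesB// mulrC.
apply: (series_dominated_le _ cos_weight (`|h| * `|h|) M) => //.
move=> j; have := cos_taylor (j%:R * x) (j%:R * h).
have -> : a j * cos (j%:R * (x + h)) - a j * cos (j%:R * x) -
    h * - (j%:R * a j * sin (j%:R * x)) =
  a j * (cos (j%:R * x + j%:R * h) - cos (j%:R * x) + j%:R * h * sin (j%:R * x)).
  by rewrite mulrDr; ring.
rewrite normrM => H; apply: (le_trans (ler_wpM2l (normr_ge0 (a j)) H)).
have -> : `|a j| * (j%:R * h * (j%:R * h)) = (h * h) * (j%:R * j%:R * `|a j|) by ring.
rewrite -normrM ger0_norm -?expr2 ?sqr_ge0// ler_wpM2l ?sqr_ge0//.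
by have := w_ge j; rewrite expr2.
Qed.

Lemma is_derive_cos_series1 (x : R) : is_derive x (1 : R) cos_series1 (cos_series2 x).
Proof.
apply: (is_derive_remainder _ _ _ (2 * M) b) => // h.
have ch : cvgn (series (fun j => h * - (j%:R * j%:R * a j * cos (j%:R * x)))).
  have -> : series (fun j => h * - (j%:R * j%:R * a j * cos (j%:R * x))) =
      fun n => h * series (fun j => - (j%:R * j%:R * a j * cos (j%:R * x))) n.
    by apply/funext => n; rewrite /series /= mulr_sumr.
  by apply: is_cvgM; [exact: is_cvg_cst|exact: c2].
rewrite /cos_series1 /cos_series2 lim_seriesZ// lim_seriesB; [|exact: c1..].
have cB : cvgn (series (fun j => - (j%:R * a j * sin (j%:R * (x + h))) - - (j%:R * a j * sin (j%:R * x)))).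
  apply: (series_dominated_cvg _ cos_weight 2 M) => // j.
  have -> : 2 * cos_weight j = 1 * cos_weight j + 1 * cos_weight j by ring.
  by rewrite (le_trans (ler_normB _ _))// lerD.
rewrite lim_seriesB// -mulrA (mulrC M) mulrA.
have hb0 : 0 <= 2 * (`|h| * `|h| `^ b) by rewrite !mulr_ge0 ?powR_ge0.
apply: (series_dominated_le _ cos_weight _ M) => // j.
set y := j%:R * x; set s := j%:R * h.
have -> : - (j%:R * a j * sin (j%:R * (x + h))) - - (j%:R * a j * sin y) -
    h * - (j%:R * j%:R * a j * cos y) =
  - (j%:R * a j) * (sin (y + s) - sin y - s * cos y).
  by rewrite /y /s mulrDr; ring.
have j0 : 0 <= j%:R :> R by exact: ler0n.
have sE : `|s| = j%:R * `|h| by rewrite normrM ger0_norm.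
have B : `|sin (y + s) - sin y - s * cos y| <= `|s| * (2 * `|s| `^ b).
  have [->|sn0] := eqVneq s 0.
    by rewrite addr0 subrr mul0r subr0 !normr0 mul0r.
  have s0 : 0 < `|s| by rewrite normr_gt0.
  rewrite [leRHS]mulrC -ler_pdivrMr//; apply: powb => //.
    rewrite ler_pdivrMr// (le_trans (sin_taylor2 y s))// -normrM.
    exact: ler_norm.
  have -> : 2 = 1 + 1 :> R by [].
  rewrite ler_pdivrMr// mulrDl !mul1r (le_trans (ler_normB _ _))// lerD//.
  by rewrite normrM ler_piMr// cos_max.
rewrite normrM normrN normrM (ger0_norm j0).
have jn0 : 0 <= j%:R * `|a j| by rewrite mulr_ge0.
apply: (le_trans (ler_wpM2l jn0 B)).
rewrite sE powRM// /cos_weight le_eqVlt; apply/orP; left; apply/eqP; ring.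
Qed.

Lemma cos_series2_hoelder x h : `|cos_series2 (x + h) - cos_series2 x| <= 2 * M * `|h| `^ b.
Proof.
rewrite /cos_series2 lim_seriesB; [|exact: c2..].
rewrite -mulrA (mulrC M) mulrA.
have hb0 : 0 <= 2 * `|h| `^ b by rewrite mulr_ge0 ?powR_ge0.
apply: (series_dominated_le _ cos_weight _ M) => // j.
set y := j%:R * x; set s := j%:R * h.
have -> : - (j%:R * j%:R * a j * cos (j%:R * (x + h))) - - (j%:R * j%:R * a j * cos y) =
  - (j%:R * j%:R * a j) * (cos (y + s) - cos y).
  by rewrite /y /s mulrDr; ring.
have j0 : 0 <= j%:R :> R by exact: ler0n.
have sE : `|s| = j%:R * `|h| by rewrite normrM ger0_norm.
have B : `|cos (y + s) - cos y| <= 2 * `|s| `^ b.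
  apply: powb => //.
  by rewrite (le_trans (ler_normB _ _))// (_ : 2 = 1 + 1 :> R)// lerD// cos_max.
rewrite normrM normrN !normrM (ger0_norm j0).
have jn0 : 0 <= j%:R * j%:R * `|a j| by rewrite !mulr_ge0.
apply: (le_trans (ler_wpM2l jn0 B)).
rewrite sE powRM// /cos_weight le_eqVlt; apply/orP; left; apply/eqP; ring.
Qed.

(** For [j >= N], [|a j| <= j |a j| / N]; uniform convergence at any rate is enough to identify the
    sum. *)
Lemma cos_series_tail x (N : nat) : (0 < N)%N ->
  `|cos_series x - \sum_(0 <= j < N) a j * cos (j%:R * x)| <= M / N%:R.
Proof.
move=> N0; have n0 : 0 < N%:R :> R by rewrite ltr0n.
have H (n : nat) : (N <= n)%N ->
   `|series (fun j => a j * cos (j%:R * x)) n - \sum_(0 <= j < N) a j * cos (j%:R * x)| <= M / N%:R.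
  move=> Nn; rewrite /series /= (big_cat_nat (leq0n N) Nn)//= addrAC subrr add0r.
  rewrite (le_trans (ler_norm_sum _ _ _))// ler_pdivlMr// mulr_suml.
  apply: (le_trans _ (wM n)); rewrite /series /= (big_cat_nat (leq0n N) Nn)//=.
  rewrite -[leLHS]add0r lerD//.
    by apply: sumr_ge0 => j _; rewrite (le_trans _ (w_ge0 j)).
  rewrite big_nat_cond [leRHS]big_nat_cond; apply: ler_sum => j; rewrite andbT => /andP[Nj _].
  apply: (le_trans _ (w_ge1 j)); rewrite mulrC ler_pM//.
    by rewrite ler_nat.
  by rewrite normrM ler_piMr// cos_max.
have cc := cos_series_cvg x.
have cv : (fun n => `|series (fun j => a j * cos (j%:R * x)) n -
    \sum_(0 <= j < N) a j * cos (j%:R * x)|) @ \oo -->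
    `|cos_series x - \sum_(0 <= j < N) a j * cos (j%:R * x)|.
  by apply: cvg_norm; apply: cvgB; [exact: cc|exact: cvg_cst].
apply: (cvgr_to_le cv); exists N => // n /= Nn; exact: H.
Qed.

End cosine_series.

(** * Fourier coefficients and identification of the cosine series *)

Section fourier.
Context {R : realType}.
Implicit Types (f u : R -> R) (x y e C s : R) (n m N : nat).
Local Notation leb := (@lebesgue_measure R).

Lemma periodic_cosn n : periodic (fun x => cos (n%:R * x) : R) (2 * pi).
Proof. by move=> x; rewrite mulrDr periodic_shift// => y; rewrite mulr_natl cosD2pi. Qed.

Lemma continuous_cosn n : continuous (fun x => cos (n%:R * x) : R).
Proof.
move=> x; apply: (@continuous_comp _ _ _ (fun x => n%:R * x) cos); last exact: continuous_cos.
by apply: cvgM; [exact: cvg_cst|exact: cvg_id].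
Qed.

Let bounded_cosn n x : `|cos (n%:R * x)| <= 1.
Proof. exact: cos_max. Qed.

Lemma intg_continuous f C : continuous f -> (forall x, `|f x| <= C) -> intg f.
Proof. by move=> cf bf; exact: (intg_bounded f C (continuous_measurable f cf) bf). Qed.

Lemma intg_cosn n : intg (fun x => cos (n%:R * x)).
Proof. exact: (intg_continuous _ 1 (continuous_cosn n)). Qed.

(** A translation by [pi / n] changes the sign of the integrand and preserves the integral. *)
Lemma J_cosn n : (0 < n)%N -> J (fun x => cos (n%:R * x)) = 0.
Proof.
move=> n0; have nn0 : n%:R != 0 :> R by rewrite pnatr_eq0 -lt0n.
have := J_translation _ (pi / n%:R) (continuous_measurable _ (continuous_cosn n)) (periodic_cosn n).
have -> : (fun t => cos (n%:R * (t + pi / n%:R))) = (fun t => -1 * cos (n%:R * t)) :> (R -> R).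
  by apply/funext => t; rewrite mulrDr mulrCA mulfV// mulr1 cosDpi mulN1r.
by rewrite JZ; [lra|exact: intg_cosn].
Qed.

Lemma J_cst c : J (fun _ => c) = c * (2 * pi) :> R.
Proof.
rewrite /J /Rintegral integral_cst//= lebesgue_measure_itv/= lte_fin mulr_gt0 ?pi_gt0//=.
by rewrite subr0.
Qed.

Lemma J_cosnM n m : (0 < n)%N -> (0 < m)%N ->
  J (fun x => cos (n%:R * x) * cos (m%:R * x)) = (n == m)%:R * pi :> R.
Proof.
wlog nm : n m / (m <= n)%N.
  move=> H n0 m0; have [/H->//|/ltnW/H mn] := leqP m n.
  by rewrite eq_sym -mn//; apply: eq_J => t _; rewrite mulrC.
move=> n0 m0.
have E : (fun x => cos (n%:R * x) * cos (m%:R * x)) =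
  (fun x => 1 / 2 * cos ((n - m)%:R * x) + 1 / 2 * cos ((n + m)%:R * x)) :> (R -> R).
  by apply/funext => x; rewrite natrB// natrD mulrBl mulrDl cosB cosD; lra.
rewrite E JD; [|by apply: intgZ; exact: intg_cosn..].
rewrite !JZ; [|exact: intg_cosn..].
rewrite (J_cosn (n + m)) ?addn_gt0 ?n0// mulr0 addr0.
have [->|nem] := eqVneq n m.
  rewrite subnn (_ : (fun t => cos (0%:R * t)) = fun _ => 1); last first.
    by apply/funext => t; rewrite mul0r cos0.
  by rewrite J_cst (_ : true%:R = 1)//; lra.
by rewrite J_cosn ?mulr0 ?mul0r// subn_gt0 ltn_neqAle eq_sym nem.
Qed.

Lemma L2norm_sqr u C : measurable_fun setT u -> (forall x, `|u x| <= C) ->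
  (L2norm u `^ 2 = (J (fun x => u x ^+ 2))%:E)%E.
Proof.
move=> mu bu; rewrite /L2norm powR_Lnorm//.
have mu2 : measurable_fun setT (fun x => u x ^+ 2) by exact: measurable_funX.
have i2 : intg (fun x => u x ^+ 2).
  apply: (intg_bounded _ (C ^+ 2)) => // t.
  by rewrite normrX ler_pXn2r ?nnegrE// (le_trans (normr_ge0 _) (bu t)).
rewrite /J /Rintegral fineK; last exact: (integrable_fin_num _ i2).
rewrite -(@integral_itv_bndoo _ 0 (2 * pi) (EFin \o (fun x => u x ^+ 2)) true false)//; last first.
  by apply: measurable_funTS; apply/measurable_EFinP.
rewrite [RHS]integral_mkcond; apply: eq_integral => x _.
rewrite /= /period !patchE; case: ifPn => _ /=; last by rewrite normr0 powR0.
by rewrite powR_mulrn// real_normK ?num_real.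
Qed.

Lemma L2norm_cvg0 (u : nat -> R -> R) : (forall n, measurable_fun setT (u n)) ->
  (forall n, exists C, forall x, `|u n x| <= C) ->
  (fun n => L2norm (u n)) @ \oo --> 0%E ->
  forall e, 0 < e -> exists N, forall n, (N <= n)%N -> J (fun x => u n x ^+ 2) <= e.
Proof.
move=> mu bu cv e e0.
have se0 : 0 < Num.sqrt e by rewrite sqrtr_gt0.
have nb : nbhs (0%E : \bar R) [set y | y < (Num.sqrt e)%:E]%E.
  by apply: open_ereal_lt'; rewrite lte_fin.
have [N _ HN] := cv _ nb; exists N => n Nn.
have /= H := HN n Nn; have [C bC] := bu n.
rewrite -lee_fin -(L2norm_sqr _ C)//.
have -> : e%:E = ((Num.sqrt e)%:E `^ 2)%E.
  by rewrite poweR_EFin powR_mulrn ?sqrtr_ge0// sqr_sqrtr// ltW.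
apply: gt0_ler_poweR => //; last exact: ltW.
- by rewrite in_itv/= leey andbT; exact: Lnorm_ge0.
- by rewrite in_itv/= leey andbT lee_fin ltW.
Qed.

End fourier.

Section fourier.
Context {R : realType}.
Implicit Types (f u h : R -> R) (x y e C s : R) (n m N : nat) (a : nat -> R).
Local Notation leb := (@lebesgue_measure R).

(** A translation brings the point to [pi], so that a whole neighbourhood of it lies inside the
    interval of integration. *)
Lemma J_eq0_continuous h : continuous h -> periodic h (2 * pi) -> (forall x, 0 <= h x) ->
  J h <= 0 -> forall x, h x = 0.
Proof.
move=> ch ph h0 Jh x; apply/eqP; rewrite eq_le h0 andbT leNgt; apply/negP => hx.
pose g t := h (t + (x - pi)).
have cg : continuous g.
  move=> t; apply: (@continuous_comp _ _ _ (fun t => t + (x - pi)) h); last exact: ch.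
  by apply: cvgD; [exact: cvg_id|exact: cvg_cst].
have Jg : J g <= 0 by rewrite (J_translation h)//; exact: continuous_measurable.
have gpi : h x / 2 < g pi by rewrite /g addrC subrK; lra.
have [dl0 /= dl00 Hd] : \forall t \near pi, h x / 2 < g t by exact: (cvgr_gt (g pi) (cg pi)).
pose dl := Num.min dl0 pi.
have dlp : 0 < dl by rewrite lt_min dl00 pi_gt0.
have dlpi : dl <= pi by rewrite ge_min lexx orbT.
have gbd : exists C, forall t, `|g t| <= C.
  have [z bz] := periodic_EVT h ch ph; exists (h z) => t.
  by rewrite ger0_norm; [exact: bz|exact: h0].
have [C bC] := gbd.
have ig := intg_continuous g C cg bC.
have mg : measurable_fun setT (EFin \o g).
  by apply/measurable_EFinP; exact: continuous_measurable.
have := Jg; apply/negP; rewrite -ltNge.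
pose A : set R := `]pi - dl, pi + dl[%classic.
have mA : measurable A by exact: measurable_itv.
have sub : A `<=` `]0, 2 * pi[.
  rewrite /A => t /=; rewrite !in_itv/= => /andP[t1 t2].
  by apply/andP; split; lra.
have JE : ((J g)%:E = \int[leb]_(t in `]0%R, (2 * pi)%R[) (g t)%:E)%E.
  by rewrite /J /Rintegral fineK//; exact: (integrable_fin_num _ ig).
rewrite -lte_fin JE.
apply: (@lt_le_trans _ _ (\int[leb]_(t in A) (g t)%:E)%E); last first.
  apply: ge0_subset_integral => //; first exact: measurable_funTS.
  by move=> t _; rewrite lee_fin h0.
apply: (@lt_le_trans _ _ (\int[leb]_(t in A) (h x / 2)%:E)%E); last first.
  apply: ge0_le_integral => //.
  - by move=> t _; rewrite lee_fin divr_ge0.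
  - exact: measurable_funTS.
  - rewrite /A => t /=; rewrite in_itv/= => /andP[t1 t2]; rewrite lee_fin ltW//.
    apply: Hd; rewrite /ball_ /= ltr_norml.
    have d0 : dl <= dl0 by rewrite ge_min lexx.
    by apply/andP; split; lra.
rewrite integral_cst//= /A lebesgue_measure_itv/= lte_fin.
rewrite (_ : pi - dl < pi + dl)%R; last by lra.
by rewrite -EFinD -EFinM lte_fin mulr_gt0//; lra.
Qed.

Lemma intg_sum (I : Type) (r : seq I) (F : I -> R -> R) : (forall i, intg (F i)) ->
  intg (fun x => \sum_(i <- r) F i x).
Proof.
move=> iF; elim: r => [|i r IH].
  under eq_fun do rewrite big_nil.
  by apply: (intg_bounded _ 0) => // t; rewrite normr0.
by under eq_fun do rewrite big_cons; exact: intgD.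
Qed.

Lemma J_sum (I : Type) (r : seq I) (F : I -> R -> R) : (forall i, intg (F i)) ->
  J (fun x => \sum_(i <- r) F i x) = \sum_(i <- r) J (F i).
Proof.
move=> iF; elim: r => [|i r IH].
  under eq_fun do rewrite big_nil.
  by rewrite big_nil J_cst mul0r.
under eq_fun do rewrite big_cons.
by rewrite big_cons JD ?IH//; exact: intg_sum.
Qed.

Context (f : R -> R) (a : nat -> R) (cf : continuous f) (pf : periodic f (2 * pi)).
Let S N x := \sum_(2 <= j < N) a j * cos (j%:R * x).
Context (Sf : (fun N => L2norm (fun x => f x - S N x)) @ \oo --> 0%E).

Let bf : exists C, forall t, `|f t| <= C.
Proof.
have [z bz] := periodic_EVT (fun x => `|f x|) (fun y => cvg_norm (cf y)) (fun y => congr1 _ (pf y)).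
by exists `|f z|.
Qed.

Let cS N : continuous (S N).
Proof.
rewrite /S; elim: (index_iota 2 N) => [|j r IH] x.
  by rewrite (_ : (fun _ => _) = cst 0); [exact: cvg_cst|apply/funext => y; rewrite big_nil].
rewrite (_ : (fun _ => _) = fun y => a j * cos (j%:R * y) + \sum_(i <- r) a i * cos (i%:R * y)).
  2: by apply/funext => y; rewrite big_cons.
by apply: cvgD; [apply: cvgM; [exact: cvg_cst|exact: continuous_cosn]|exact: IH].
Qed.

Let bS N : exists C, forall t, `|S N t| <= C.
Proof.
exists (\sum_(2 <= j < N) `|a j|) => t; rewrite (le_trans (ler_norm_sum _ _ _))//.
by apply: ler_sum => j _; rewrite normrM ler_piMr// cos_max.
Qed.

Let u N x := f x - S N x.

Let cu N : continuous (u N).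
Proof. by move=> x; apply: cvgB; [exact: cf|exact: cS]. Qed.

Let bu N : exists C, forall t, `|u N t| <= C.
Proof.
have [[C bC] [D bD]] := (bf, bS N); exists (C + D) => t.
by rewrite (le_trans (ler_normB _ _))// lerD.
Qed.

Let icc (g : R -> R) n : continuous g -> (exists C, forall t : R, `|g t| <= C) ->
  intg (fun x => g x * cos (n%:R * x)).
Proof.
move=> cg [C bg]; apply: (intg_continuous _ C) => [x|x].
  by apply: cvgM; [exact: cg|exact: continuous_cosn].
by rewrite normrM (le_trans _ (bg x))// ler_piMr// cos_max.
Qed.

Let iu2 N : intg (fun x => u N x ^+ 2).
Proof.
have [C bC] := bu N; apply: (intg_bounded _ (C ^+ 2)).
  by apply: measurable_funX; exact: continuous_measurable.
by move=> t; rewrite normrX ler_pXn2r ?nnegrE// (le_trans (normr_ge0 _) (bC t)).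
Qed.

Let u_cvg e : 0 < e -> exists N, forall n, (N <= n)%N -> J (fun x => u n x ^+ 2) <= e.
Proof.
by move=> e0; apply: (L2norm_cvg0 u) => // n; exact: continuous_measurable.
Qed.

Lemma J_partial_cosM n N : (2 <= n < N)%N -> J (fun x => S N x * cos (n%:R * x)) = pi * a n.
Proof.
move=> /andP[n2 nN].
rewrite (_ : (fun _ => _) = fun x => \sum_(2 <= j < N) a j * (cos (j%:R * x) * cos (n%:R * x))); last first.
  by apply/funext => x; rewrite /S mulr_suml; apply: eq_bigr => j _; rewrite mulrA.
have ij j : intg (fun x => cos (j%:R * x) * cos (n%:R * x)).
  by apply: icc; [exact: continuous_cosn|exists 1 => t; exact: cos_max].
rewrite J_sum; last by move=> j; exact: intgZ.
rewrite (bigD1_seq n) ?mem_index_iota ?n2 ?iota_uniq//= JZ//.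
have n0 : (0 < n)%N by exact: leq_trans n2.
rewrite J_cosnM// eqxx mul1r mulrC big_seq_cond big1 ?addr0// => j.
rewrite mem_index_iota => /andP[/andP[j2 _] jn].
by rewrite JZ// J_cosnM ?(negPf jn) ?mul0r ?mulr0//; exact: leq_trans j2.
Qed.

Lemma J_cos_coefficient n : (2 <= n)%N -> J (fun x => f x * cos (n%:R * x)) = pi * a n.
Proof.
move=> n2; apply/eqP; rewrite -subr_eq0 -normr_le0; apply/ler_addgt0Pr => e e0; rewrite add0r.
(* Instead of Cauchy-Schwarz, [|u| <= u^2 / (2 c) + c / 2]. If the integral of [u^2] is at most
   [c^2], the total is [c / 2 + c pi = e]. *)
pose c := e / (1 / 2 + pi).
have p0 : 0 < pi :> R := pi_gt0 R.
have p1 : 0 < 1 / 2 + pi :> R by lra.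
have c0 : 0 < c by rewrite divr_gt0.
have [N0 HN] := u_cvg (c ^+ 2) (exprn_gt0 2 c0).
pose N := maxn N0 n.+1.
have N1 : (2 <= n < N)%N by rewrite n2 leq_max ltnSn orbT.
have ufn : J (fun x => f x * cos (n%:R * x)) - pi * a n = J (fun x => u N x * cos (n%:R * x)).
  rewrite -(J_partial_cosM n N N1) -JB; [|by apply: icc..].
  by apply: eq_J => t _; rewrite /u mulrBl.
rewrite ufn.
have i1 : intg (fun x => 1 / (2 * c) * u N x ^+ 2 + c / 2).
  apply: intgD; first by apply: intgZ.
  by apply: (intg_bounded _ `|c / 2|).
apply: le_trans (abs_J_le _ (fun x => 1 / (2 * c) * u N x ^+ 2 + c / 2) _ i1 _) _.
- exact: icc.
- move=> t _; rewrite normrM (le_trans (_ : _ <= `|u N t|))//.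
    by rewrite ler_piMr// cos_max.
  have -> : 1 / (2 * c) * u N t ^+ 2 + c / 2 = (`|u N t| ^+ 2 + c ^+ 2) / (2 * c).
    by rewrite real_normK ?num_real//; field; rewrite gt_eqF.
  have c2 : 0 < 2 * c by lra.
  rewrite ler_pdivlMr; last exact: c2.
  rewrite -subr_ge0.
  by rewrite (_ : _ - _ = (`|u N t| - c) ^+ 2) ?sqr_ge0//; ring.
rewrite JD; [|by apply: intgZ|by apply: (intg_bounded _ `|c / 2|)].
rewrite JZ// J_cst.
have H := HN N (leq_maxl _ _).
have -> : e = 1 / (2 * c) * c ^+ 2 + c / 2 * (2 * pi).
  have -> : e = c * (1 / 2 + pi) by rewrite /c divfK// gt_eqF.
  by field; rewrite gt_eqF.
by rewrite lerD2r ler_pM2l// divr_gt0// mulr_gt0.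
Qed.

(** The partial sums converge to [f] in L^2 and to [S0] uniformly, so the two agree in L^2;
    continuity makes this an equality at every point. *)
Lemma uniform_L2_limit (S0 : R -> R) M : continuous S0 -> periodic S0 (2 * pi) ->
  (forall x N, (0 < N)%N -> `|S0 x - S N x| <= M / N%:R) -> f = S0.
Proof.
move=> c0 p0 H; have M0 : 0 <= M.
  by have := le_trans (normr_ge0 _) (H 0 1%N (ltn0Sn 0)); rewrite divr1.
have ch : continuous (fun x => (f x - S0 x) ^+ 2).
  have c1 : continuous (fun x => f x - S0 x) by move=> x; apply: cvgB; [exact: cf|exact: c0].
  by rewrite (_ : (fun _ => _) = fun x => (f x - S0 x) * (f x - S0 x)) => [x|//]; apply: cvgM; exact: c1.
suff E : forall x, (f x - S0 x) ^+ 2 = 0.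
  by apply/funext => x; apply/eqP; rewrite -subr_eq0 -sqrf_eq0 E.
apply: J_eq0_continuous => // [x|x|]; rewrite ?sqr_ge0//; first by rewrite pf p0.
apply/ler_addgt0Pr => e e0; rewrite add0r.
have e4 : 0 < e / 4 by lra.
have [N0 HN] := u_cvg (e / 4) e4.
have p1 : 0 < pi :> R := pi_gt0 R.
(* Beyond [K] the constant part, [4 pi (M / N)^2], is at most [e / 2]; the L^2 part is at most
   [2 * (e / 4)]. *)
pose K := 8 * pi * (M ^+ 2 + 1) / e.
have K0 : 0 < K by rewrite divr_gt0// mulr_gt0 ?mulr_gt0// ltr_wpDl// sqr_ge0.
pose N := maxn N0 (Num.truncn K).+1.
have NK : K <= N%:R.
  by rewrite (le_trans (ltW (truncnS_gt K)))// ler_nat leq_maxr.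
have N1 : (0 < N)%N by rewrite leq_max orbT.
have N1R : 1 <= N%:R :> R by rewrite ler1n.
have i2 : intg (fun x => 2 * u N x ^+ 2 + 2 * (M / N%:R) ^+ 2).
  by apply: intgD; [exact: intgZ|apply: (intg_bounded _ `|2 * (M / N%:R) ^+ 2|)].
have ih : intg (fun x => (f x - S0 x) ^+ 2).
  have [z bz] := periodic_EVT _ ch (fun y => etrans (congr1 (fun w => (w - S0 (y + 2 * pi)) ^+ 2) (pf y)) (congr1 (fun w => (f y - w) ^+ 2) (p0 y))).
  by apply: (intg_continuous _ ((f z - S0 z) ^+ 2)) => // t; rewrite ger0_norm ?sqr_ge0.
apply: (@le_trans _ _ (J (fun x => 2 * u N x ^+ 2 + 2 * (M / N%:R) ^+ 2))).
  apply: le_J => // t _.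
  have h1 : (S0 t - S N t) ^+ 2 <= (M / N%:R) ^+ 2.
    by rewrite -real_normK ?num_real// ler_pXn2r ?nnegrE ?divr_ge0// H.
  rewrite /u; have := sqr_ge0 ((f t - S N t) + (S0 t - S N t)); nra.
rewrite JD; [|exact: intgZ|by apply: (intg_bounded _ `|2 * (M / N%:R) ^+ 2|)].
rewrite JZ// J_cst.
have HJ := HN N (leq_maxl _ _).
have MN : (M / N%:R) ^+ 2 * (8 * pi) <= e.
  have h2 : (M / N%:R) ^+ 2 <= M ^+ 2 / N%:R.
    rewrite expr_div_n ler_wpM2l ?sqr_ge0// lef_pV2 ?posrE ?exprn_gt0 ?ltr0n//.
    by rewrite expr2 ler_peMl.
  have p8 : 0 <= 8 * pi :> R by lra.
  apply: (le_trans (ler_wpM2r p8 h2)).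
  rewrite mulrAC ler_pdivrMr ?ltr0n//.
  have : K * e <= N%:R * e by apply: ler_wpM2r => //; exact: ltW.
  rewrite /K divfK ?gt_eqF//; nra.
lra.
Qed.

End fourier.

Section fourier.
Context {R : realType}.
Implicit Types (f u : R -> R) (x y e h C s r alpha : R) (n m N k : nat) (a : nat -> R).
Local Notation leb := (@lebesgue_measure R).

Lemma fourier_re_cos f n : continuous f ->
  fourier_re f n = (2 * pi)^-1 * J (fun x => f x * cos (n%:R * x)).
Proof.
move=> cf; rewrite /fourier_re -Rintegral_J//.
apply: measurable_funM; first exact: continuous_measurable.
exact: (continuous_measurable _ (continuous_cosn n)).
Qed.

Lemma Hnorm_partial_sum s f N : (Hnorm s f <= 1)%E ->
  \sum_(2 <= j < N) (1 + (j%:R : R) ^+ 2) `^ s * fourier_re f j ^+ 2 <= 1.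
Proof.
rewrite /Hnorm; set E := esum _ _ => H.
have E0 : (0 <= E)%E.
  by apply: esum_ge0 => n _; rewrite lee_fin mulr_ge0 ?powR_ge0// addr_ge0 ?sqr_ge0.
have E1 : (E <= 1)%E.
  have -> : E = ((E `^ 2^-1) `^ 2)%E by rewrite -poweRrM mulVf// poweRe1.
  rewrite -[leRHS](poweR1r 2); apply: gt0_ler_poweR => //.
  - by rewrite in_itv/= leey andbT poweR_ge0.
  - by rewrite in_itv/= leey andbT.
rewrite -lee_fin; apply: le_trans E1.
apply: esum_ge; exists [set` [seq Posz j | j <- index_iota 2 N]].
  by split => //; exact: finite_seq.
rewrite -fsbig_seq; last by rewrite map_inj_uniq ?iota_uniq// => i j [].
rewrite big_map -sumEFin; apply: lee_sum => j _.
by rewrite lee_fin ler_wpM2l ?powR_ge0// lerDl sqr_ge0.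
Qed.

(** Telescoping: with [q] and [p] the square roots of consecutive integers,
    [1 / q^3 <= 2 / p - 2 / q], since [q^2 - p^2 = 1]. *)
Lemma sum_powRN32 N : \sum_(2 <= j < N) (j%:R : R) `^ (- (3 / 2)) <= 2.
Proof.
case: N => [|[|N]]; [by rewrite big_geq..|].
suff : \sum_(2 <= j < N.+2) (j%:R : R) `^ (- (3 / 2)) <= 2 - 2 / Num.sqrt N.+1%:R.
  move=> /le_trans; apply; rewrite gerBl divr_ge0// sqrtr_ge0.
elim: N => [|N IH]; first by rewrite big_geq// sqrtr1 divr1 subrr.
rewrite big_nat_recr//=.
set p := Num.sqrt N.+1%:R in IH *; set q := Num.sqrt N.+2%:R.
have p0 : 0 < p by rewrite sqrtr_gt0 ltr0n.
have q0 : 0 < q by rewrite sqrtr_gt0 ltr0n.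
have pq : p <= q by rewrite ler_wsqrtr// ler_nat.
have q2 : q ^+ 2 = N.+2%:R by rewrite sqr_sqrtr.
have p2 : p ^+ 2 = N.+1%:R by rewrite sqr_sqrtr.
have d : q ^+ 2 - p ^+ 2 = 1 by rewrite q2 p2 -natr1; ring.
have -> : (N.+2%:R : R) `^ (- (3 / 2)) = 1 / q ^+ 3.
  rewrite powRN div1r; congr (_^-1).
  rewrite -q2 -powR_mulrn ?ltW// -powRrM -powR_mulrn ?ltW//.
  by congr (_ `^ _); lra.
suff : 1 / q ^+ 3 <= 2 / p - 2 / q by lra.
have -> : 2 / p - 2 / q = 2 * (q ^+ 2 - p ^+ 2) / (p * q * (p + q)).
  by field; rewrite !gt_eqF// addr_gt0.
rewrite d mulr1 ler_pdivrMr ?exprn_gt0// mulrAC ler_pdivlMr ?mulr_gt0 ?addr_gt0//.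
have : p * q * (p + q) <= q * q * (q + q).
  apply: ler_pM; rewrite ?lerD2r//; first by apply/ltW/mulr_gt0.
    by apply/ltW/addr_gt0.
  by apply: ler_wpM2r => //; exact: ltW.
lra.
Qed.

(* The sum of [j^(2+b) |a j|] is controlled by the norm of [H^(2+alpha)] as soon
   as [b < alpha - 1/2], and the bootstrap needs [alpha - 1 < b <= 1]. *)
Definition cos_exponent alpha := 3 * alpha / 4 - 1 / 2.

(** Each weight is [X Y <= (X^2 + Y^2) / 2] with [X = j^(2 + b - s)] and [Y = j^s |a j|]. For
    [s >= alpha + 2], [X^2 <= j^(- 1 - alpha / 2) <= j^(- 3 / 2)], which sums to at most 2; the sum
    of [Y^2] is at most 4. Hence 3. The halves [a j / 2] are the Fourier coefficients. *)
Lemma cos_weight_sum alpha s N a : 1 <= alpha -> alpha + 2 <= s ->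
  (forall j, (j < 2)%N -> a j = 0) ->
  \sum_(2 <= j < N) (1 + (j%:R : R) ^+ 2) `^ s * (a j / 2) ^+ 2 <= 1 ->
  series (cos_weight a (cos_exponent alpha)) N <= 3.
Proof.
move=> a1 sa az H; set b := cos_exponent alpha.
have -> : series (cos_weight a b) N = \sum_(2 <= j < N) cos_weight a b j.
  rewrite /series /= [RHS](@big_nat_widenl _ _ _ 2 0)//= [RHS]big_mkcond/=.
  apply: eq_bigr => j _; case: ifPn => //; rewrite -ltnNge => j2.
  by rewrite /cos_weight az// normr0 mulr0.
apply: (@le_trans _ _ (\sum_(2 <= j < N) (1 / 2 * (j%:R : R) `^ (- (3 / 2)) +
    2 * ((1 + (j%:R : R) ^+ 2) `^ s * (a j / 2) ^+ 2)))); last first.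
  rewrite big_split/= -!mulr_sumr; have := sum_powRN32 N; lra.
rewrite big_seq [leRHS]big_seq; apply: ler_sum => j; rewrite mem_index_iota => /andP[j2 _].
have j1 : 1 <= j%:R :> R by rewrite ler1n (leq_trans _ j2).
have j0 : 0 < j%:R :> R by exact: lt_le_trans j1.
pose X : R := j%:R `^ (2 + b - s); pose Y : R := j%:R `^ s * `|a j|.
have jn0 : (j%:R == 0 :> R) = false by rewrite gt_eqF.
have -> : cos_weight a b j = X * Y.
  rewrite /X /Y mulrA -powRD ?jn0 ?implybT// subrK powRD ?jn0 ?implybT//.
  by rewrite powR_mulrn ?ltW// expr2.
have X2 : X ^+ 2 <= (j%:R : R) `^ (- (3 / 2)).
  rewrite -powR_mulrn ?powR_ge0// -powRrM ler_powR//.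
  by rewrite /b /cos_exponent; lra.
have Y2 : Y ^+ 2 <= 4 * ((1 + (j%:R : R) ^+ 2) `^ s * (a j / 2) ^+ 2).
  have -> : 4 * ((1 + (j%:R : R) ^+ 2) `^ s * (a j / 2) ^+ 2) = (1 + (j%:R : R) ^+ 2) `^ s * a j ^+ 2.
    by field.
  rewrite /Y exprMn real_normK ?num_real// ler_wpM2r ?sqr_ge0//.
  have -> : ((j%:R : R) `^ s) ^+ 2 = (j%:R ^+ 2) `^ s.
    by rewrite -[LHS]powR_mulrn ?powR_ge0// -powRrM mulrC powRrM powR_mulrn.
  apply: ge0_ler_powR; rewrite ?nnegrE ?addr_ge0 ?sqr_ge0// ?lerDr//.
  by lra.
have := sqr_ge0 (X - Y); rewrite sqrrB mulr2n; lra.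
Qed.

(** Both balls lie in H^(alpha + 2): the order is [k + alpha - 1], or [k] when [alpha = 1], and
    [k >= 3]. The logarithmic part of the norm is nonnegative and is dropped. *)
Lemma Vball_Hnorm alpha k r f : (3 <= k)%N -> 1 <= alpha -> r < 1 -> Vball alpha k r f ->
  exists s, [/\ alpha + 2 <= s, Xspace s f & (Hnorm s f <= 1)%E].
Proof.
move=> k3 a1 r1; have k3R : 3 <= k%:R :> R by rewrite (ler_nat _ 3).
rewrite /Vball; case: eqVneq => [->|_] /=; last first.
  move=> [Xf Hf]; exists (k%:R + alpha - 1); split => //; first by lra.
  by apply: ltW; apply: (lt_trans Hf); rewrite lte_fin.
move=> [[Xf _] [N [g [u [_ _ NE]]] Nr]]; exists k%:R; split => //.
have N1 : (N <= 1)%E by apply/ltW/(lt_trans Nr); rewrite lte_fin.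
by apply: le_trans N1; rewrite NE leeDl//; exact: Lnorm_ge0.
Qed.

(** The bounds 3 and 6 are absolute, which is what lets [eps0] be chosen before [f]. *)
Theorem Vball_C2 alpha k r f : (3 <= k)%N -> 1 <= alpha -> alpha < 2 -> r < 1 ->
  Vball alpha k r f -> continuous f -> periodic f (2 * pi) /\
  exists f1 f2 : R -> R, [/\ forall x, is_derive x (1 : R) f (f1 x),
    forall x, is_derive x (1 : R) f1 (f2 x),
    forall x, [/\ `|f x| <= 3, `|f1 x| <= 3 & `|f2 x| <= 3] &
    forall x h, `|f2 (x + h) - f2 x| <= 6 * `|h| `^ cos_exponent alpha].
Proof.
move=> k3 a1 a2 r1 /(Vball_Hnorm _ _ _ _ k3 a1 r1) [s [sa [[[_ pf _] _] [a Sf]] Hs]] cf.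
split=> //; pose a' j := if (2 <= j)%N then a j else 0.
have aS x N : \sum_(0 <= j < N) a' j * cos (j%:R * x) = \sum_(2 <= j < N) a j * cos (j%:R * x).
  rewrite [RHS](@big_nat_widenl _ _ _ 2 0)//= [RHS]big_mkcond/=.
  by apply: eq_bigr => j _; rewrite /a'; case: ifPn => //; rewrite mul0r.
pose b := cos_exponent alpha.
have b0 : 0 < b by rewrite /b /cos_exponent; lra.
have b1 : b <= 1 by rewrite /b /cos_exponent; lra.
have wM N : series (cos_weight a' b) N <= 3.
  apply: (cos_weight_sum _ s) => // [j j2|]; first by rewrite /a' leqNgt j2.
  apply: le_trans (Hnorm_partial_sum s f N Hs).
  rewrite big_seq [leRHS]big_seq; apply: ler_sum => j; rewrite mem_index_iota => /andP[j2 _].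
  rewrite fourier_re_cos// (J_cos_coefficient f a)// /a' j2.
  rewrite (_ : (2 * pi)^-1 * (pi * a j) = a j / 2)//.
  by move: (pi_gt0 R); move: (pi : R) => q q0; field; rewrite gt_eqF.
have M0 : 0 <= 3 :> R by [].
have a0 : a' 0%N = 0 by [].
have fE : f = cos_series a'.
  apply: (uniform_L2_limit f a cf pf Sf _ 3).
  - exact: is_derive_continuous (is_derive_cos_series a' b 3 b0 a0 wM).
  - move=> x; rewrite /cos_series; congr (limn (series _)); apply/funext => j.
    by rewrite (periodic_cosn j x).
  - move=> x N N0; rewrite -aS; exact: (cos_series_tail a' b 3 b0 a0 wM).
exists (cos_series1 a'), (cos_series2 a'); split.
- rewrite fE; exact: (is_derive_cos_series a' b 3 b0 a0 wM).
- exact: (is_derive_cos_series1 a' b 3 b0 b1 wM).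
- move=> x; rewrite fE; split.
  + exact: (cos_series_le a' b 3 b0 a0 wM).
  + exact: (cos_series1_le a' b 3 b0 wM).
  + exact: (cos_series2_le a' b 3 b0 wM).
- move=> x h; have -> : 6 = 2 * 3 :> R by lra.
  exact: (cos_series2_hoelder a' b 3 b0 b1 wM).
Qed.

End fourier.

(** * Positivity of the constant of the equation *)

Section gamma.
Context {R : realType}.
Implicit Types (x t alpha : R).
Local Notation leb := (@lebesgue_measure R).

Let gk x t : R := t `^ (x - 1) * expR (- t).

Let measurable_gk x : measurable_fun setT (gk x).
Proof.
apply: measurable_funM; first exact: measurable_powR.
by apply: measurableT_comp => //; exact: measurable_funN.
Qed.

Let integrable_powR x : 0 < x -> leb.-integrable `]0, 1[ (fun t => (t `^ (x - 1))%:E).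
Proof.
move=> x0; have xn : x != 0 by rewrite gt_eqF.
apply: (integrable_primitive _ (fun t => t `^ x * x^-1) 0 1 x^-1) => //.
- move=> t /andP[t0 _].
  have d1 := is_derive_powR id t 1 x t0 (is_derive_id t 1).
  have := is_deriveMr _ _ t _ _ d1 (is_derive_cst (x^-1) t 1).
  by rewrite mulr0 addr0 mulr1 -mulrA mulrCA mulfV// mulr1.
- move=> t /andP[t0 _]; have d1 := is_derive_powR id t 1 (x - 1) t0 (is_derive_id t 1).
  by apply: differentiable_continuous; apply/derivable1_diffP; case: d1.
- by move=> t _; exact: powR_ge0.
- have x1 : 0 <= x^-1 by rewrite invr_ge0 ltW.
  move=> t /andP[t0 t1]; rewrite ger0_norm; last by rewrite mulr_ge0 ?powR_ge0.
  rewrite ler_piMl// -(powRr0 t); apply: ger_powR; last exact: ltW.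
  by rewrite t0 ltW.
Qed.

(** The range [x <= 1] contains both arguments occurring in [Calpha]. There [t^(x - 1) <= 1] for
    [t >= 1], so the integrand is dominated by the exponential density, plus [t^(x - 1)] on the unit
    interval. *)
Lemma integrable_Gamma x : 0 < x <= 1 ->
  leb.-integrable `]0, +oo[ (fun t => (gk x t)%:E).
Proof.
move=> /andP[x0 x1].
pose p : R -> \bar R := (fun t : R => (t `^ (x - 1))%:E) \_ `]0, 1[%classic.
pose q (t : R) : \bar R := (exponential_pdf 1 t)%:E.
pose h t := (p t + q t)%E.
have ih : leb.-integrable `]0, +oo[ h.
  apply: (@integrableS _ _ _ leb setT) => //.
  have mI : measurable (`]0, 1[%classic : set R) by exact: measurable_itv.
  have ip : leb.-integrable setT p.
    by apply: (@integrable_mkcond _ _ R leb _ (fun t => (t `^ (x - 1))%:E) mI).1; exact: integrable_powR.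
  have iq : leb.-integrable setT q by exact: integrable_exponential_pdf.
  exact: integrableD.
have mO : measurable (`]0, +oo[%classic : set R) by exact: measurable_itv.
apply: (@le_integrable _ _ _ leb _ mO _ h _ _ ih).
  by apply: measurable_funTS; apply/measurable_EFinP; exact: measurable_gk.
move=> t /=; rewrite in_itv/= andbT => t0.
rewrite ger0_norm ?mulr_ge0 ?powR_ge0 ?expR_ge0//.
rewrite /h /p /q patchE exponential_pdfE; last exact: ltW.
rewrite mul1r mulN1r; case: ifPn => [_|]; rewrite lee_fin.
  rewrite ger0_norm ?addr_ge0 ?powR_ge0 ?expR_ge0//.
  apply: (@le_trans _ _ (t `^ (x - 1))); last by rewrite lerDl expR_ge0.
  by rewrite ler_piMr ?powR_ge0// -expR0 ler_expR; lra.
rewrite notin_setE/= in_itv/= t0/= => /negP; rewrite -leNgt => t1.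
rewrite add0r ger0_norm ?expR_ge0// ler_piMl ?expR_ge0//.
by rewrite -[leRHS](powRr0 t) ler_powR// subr_le0.
Qed.

Lemma Gamma_gt0 x : 0 < x <= 1 -> 0 < Gamma x.
Proof.
move=> xI; have [x0 x1] := andP xI; rewrite -lte_fin /Gamma /Rintegral fineK; last first.
  by apply: integrable_fin_num => //; exact: integrable_Gamma.
pose A : set R := `]0, 1[%classic.
have mA : measurable A by exact: measurable_itv.
apply: (@lt_le_trans _ _ (\int[leb]_(t in A) (gk x t)%:E)%E); last first.
  apply: ge0_subset_integral => //.
  - by apply: measurable_funTS; apply/measurable_EFinP; exact: measurable_gk.
  - by move=> t _; rewrite lee_fin mulr_ge0 ?powR_ge0 ?expR_ge0.
  - by rewrite /A => t /=; rewrite !in_itv/= andbT => /andP[].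
apply: (@lt_le_trans _ _ (\int[leb]_(t in A) (expR (- 1))%:E)%E).
  rewrite integral_cst//= /A lebesgue_measure_itv/= lte_fin ltr01.
  by rewrite -EFinD -EFinM lte_fin subr0 mulr1 expR_gt0.
apply: ge0_le_integral => //.
- by apply: measurable_funTS; apply/measurable_EFinP; exact: measurable_gk.
rewrite /A => t /=; rewrite in_itv/= => /andP[t0 t1]; rewrite lee_fin.
rewrite -[leLHS]mul1r; apply: ler_pM; rewrite ?expR_ge0//; last by rewrite ler_expR lerN2 ltW.
by rewrite -[leLHS](powRr0 t); apply: ger_powR; rewrite ?subr_le0// t0 ltW.
Qed.

Lemma Calpha_gt0 alpha : 1 <= alpha -> alpha < 2 -> 0 < Calpha alpha.
Proof.
move=> a1 a2; rewrite divr_gt0 ?mulr_gt0 ?powR_gt0//; apply: Gamma_gt0; lra.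
Qed.

End gamma.

(** * Convexity *)

Section support.
Context {R : realType}.
Implicit Types (x y th s : R).

Lemma polar_coordinates (a b : R) : exists c th, [/\ 0 <= c, 0 <= th < 2 * pi,
  a = c * cos th & b = c * sin th].
Proof.
pose c := Num.sqrt (a ^+ 2 + b ^+ 2).
have cE : c ^+ 2 = a ^+ 2 + b ^+ 2 by rewrite sqr_sqrtr// addr_ge0 ?sqr_ge0.
have c0 : 0 <= c by exact: sqrtr_ge0.
suff [th [aE bE]] : exists th, a = c * cos th /\ b = c * sin th.
  have [n nI] := period_reduce th; exists c, (th + n%:~R * (2 * pi)); split => //.
    by rewrite periodic_int// => x; rewrite mulr_natl cosD2pi.
  by rewrite periodic_int// => x; rewrite mulr_natl sinD2pi.
have [c00|cn0] := eqVneq c 0.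
  have := cE; rewrite c00 expr0n/= => /esym/eqP.
  rewrite paddr_eq0 ?sqr_ge0// !sqrf_eq0 => /andP[/eqP -> /eqP ->].
  by exists 0; rewrite !mul0r.
have cp : 0 < c by rewrite lt_neqAle eq_sym cn0.
have aI : -1 <= a / c <= 1.
  rewrite -ler_norml normrM normfV (gtr0_norm cp) ler_pdivrMr// mul1r.
  by rewrite -(ler_pXn2r (ltn0Sn 1)) ?nnegrE// real_normK ?num_real// cE lerDl sqr_ge0.
have [_ cosE] := acos_def aI.
have aE : a = c * cos (acos (a / c)) by rewrite cosE mulrC divfK.
have sE : (c * sin (acos (a / c))) ^+ 2 = b ^+ 2.
  by rewrite exprMn sin2cos2 mulrBr mulr1 -exprMn -aE cE addrAC subrr add0r.
move/eqP: sE; rewrite eqf_sqr => /orP[]/eqP sE.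
  by exists (acos (a / c)); rewrite -aE sE.
by exists (- acos (a / c)); rewrite cosN sinN mulrN sE opprK -aE.
Qed.

Lemma cos_le s : `|s| <= pi -> cos s <= 1 - s ^+ 2 / 8.
Proof.
move=> sp; have p0 := pi_gt0 R.
have H : `|s| <= 2 * chord `|s| by apply: le_chord; rewrite sp normr_ge0.
have cE : cos s = 1 - chord `|s| ^+ 2 / 2.
  have -> : cos s = cos `|s| by have [_|_] := ger0P s; rewrite ?cosN.
  rewrite [X in cos X](_ : _ = (`|s| / 2) *+ 2); last by rewrite -mulr_natr divfK.
  by rewrite cos_mulr2n cos2sin2 /chord -mulr_natl; lra.
have : `|s| ^+ 2 <= (2 * chord `|s|) ^+ 2.
  by rewrite ler_pXn2r ?nnegrE// (le_trans _ H).
rewrite real_normK ?num_real// cE exprMn; lra.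
Qed.

Context (r p p' : R -> R).
Context (dr : forall x, is_derive (x : R) (1 : R) r (p x)).
Context (dp : forall x, is_derive (x : R) (1 : R) p (p' x)).
Context (per : periodic r (2 * pi)).
Context (rbd : forall x, `|r x - 1| <= 1 / 100) (pbd : forall x, `|p x| <= 1 / 100).
Context (pbd' : forall x, `|p' x| <= 1 / 100).

(** In polar coordinates a line avoiding the origin is the graph of a radius whose inverse is a
    combination of cosine and sine, so tangency to the curve is linear in [1 / r] and its
    derivative. *)
Let g x := (r x)^-1.
Let g1 x := - (g x * (g x * p x)).
Let g2 x := - (g1 x * (g x * p x) + g x * (g1 x * p x + g x * p' x)).

Let r_bd x : 99 / 100 <= r x <= 101 / 100.
Proof. by have := rbd x; rewrite ler_norml => /andP[? ?]; apply/andP; split; lra. Qed.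

Let r_gt0 x : 0 < r x.
Proof. by have /andP[? _] := r_bd x; lra. Qed.

Let g_bd x : 9 / 10 <= g x <= 51 / 50.
Proof.
have /andP[h1 h2] := r_bd x; have h0 := r_gt0 x; rewrite /g -[(r x)^-1]mul1r.
by apply/andP; split; [rewrite ler_pdivlMr//|rewrite ler_pdivrMr//]; lra.
Qed.

Let dg x : is_derive x (1 : R) g (g1 x).
Proof.
have := is_deriveV (lt0r_neq0 (r_gt0 x)) (dr x); rewrite /GRing.scale /=.
by rewrite /g1 /g mulNr expr2 invfM mulrA.
Qed.

Let dg1 x : is_derive x (1 : R) g1 (g2 x).
Proof.
have d1 := is_deriveMr _ _ x _ _ (dg x) (dp x).
have d2 := is_deriveMr _ _ x _ _ (dg x) d1.
by have := is_deriveBr _ _ x _ _ (is_derive_cst (0 : R) x 1) d2; rewrite sub0r /g1;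
  under eq_fun do rewrite sub0r.
Qed.

Let g1_bd x : `|g1 x| <= 1 / 40.
Proof.
have /andP[h1 h2] := g_bd x; have hp := pbd x.
rewrite /g1 normrN !normrM; have g0 : 0 <= g x by lra.
rewrite !(ger0_norm g0); have := normr_ge0 (p x); nra.
Qed.

Let g2_bd x : `|g2 x| <= 1 / 20.
Proof.
have /andP[h1 h2] := g_bd x; have g0 : 0 <= g x by lra.
have G (u e : R) : `|u| <= e -> `|g x * u| <= 51 / 50 * e.
  by move=> ue; rewrite normrM (ger0_norm g0); apply: ler_pM.
have G1 (u e : R) : `|u| <= e -> `|g1 x * u| <= 1 / 40 * e.
  by move=> ue; rewrite normrM; apply: ler_pM => //; exact: g1_bd.
rewrite /g2 normrN.
have e1 := G1 _ _ (G _ _ (pbd x)); have e2 := G _ _ (le_trans (ler_normD _ _) (lerD (G1 _ _ (pbd x)) (G _ _ (pbd' x)))).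
by apply: (le_trans (ler_normD _ _)); lra.
Qed.

Let per_g : periodic g (2 * pi).
Proof. by move=> x; rewrite /g per. Qed.

(* For [r] close to [1] in [C^2], [1/r] stays above the restriction to the
   circle of the linear form having the same 1-jet at [x]: the polar curve of
   [r] lies on one side of its tangents. *)
Lemma support_line x th : g x * cos (th - x) + g1 x * sin (th - x) <= g th.
Proof.
have p0 := pi_gt0 R.
have [n /andP[n0 n1]] := period_reduce (x - th).
set u := x - th + n%:~R * (2 * pi) in n0 n1.
(* The angle from [th] to [x], reduced to an interval around 0 where [cos_le] applies. *)
pose s := if u <= pi then u else u - 2 * pi.
have sP : `|s| <= pi.
  by rewrite /s ler_norml; case: (leP u pi) => h; apply/andP; split; lra.
have sE (f : R -> R) : periodic f (2 * pi) -> f (x - th) = f s.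
  move=> pf; rewrite /s; case: (leP u pi) => _; first by rewrite periodic_int.
  by rewrite periodicB// periodic_int.
have -> : cos (th - x) = cos s.
  by rewrite -cosN opprB; apply: sE => y; rewrite mulr_natl cosD2pi.
have -> : sin (th - x) = - sin s.
  rewrite -(opprB x th) sinN; congr (- _).
  by apply: sE => y; rewrite mulr_natl sinD2pi.
have -> : g th = g (x - s).
  rewrite -(sE (fun z => g (x - z))) ?subKr// => z.
  by rewrite opprD addrA periodicB.
have T := taylor1 g g1 (1 / 20) x s dg _ _.
have {}T : `|g x - g (x - s) - g1 x * s| <= 1 / 20 * s ^+ 2.
  by apply: T; [lra|exact: (derive_bound_lipschitz g1 g2 (1 / 20) dg1 g2_bd)].
have C := cos_le s sP; have S := sin_taylor s.
have /andP[h1 h2] := g_bd x; have h3 := g1_bd x.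
have s2 : 0 <= s ^+ 2 := sqr_ge0 s.
have e1 : g x * cos s <= g x * (1 - s ^+ 2 / 8) by apply: ler_wpM2l => //; lra.
have e2 : `|g1 x * (s - sin s)| <= 1 / 40 * s ^+ 2 by rewrite normrM; apply: ler_pM.
have e3 : 9 / 10 * s ^+ 2 <= g x * s ^+ 2 by exact: ler_wpM2r.
(* The gain [g x s^2 / 8 >= 9 s^2 / 80] from the cosine exceeds the losses, [s^2 / 40] from the sine
   and [s^2 / 20] from Taylor. *)
move: T e2; rewrite !ler_norml => /andP[t1 t2] /andP[t3 t4].
lra.
Qed.

Local Notation plane := (R^o * R^o)%type.
Context (eps : R) (eps0 : 0 < eps).

(** [A x] and [B x] are the Cartesian coefficients of the linear form equal to [eps] on the tangent
    at the point of angle [x]. *)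
Let A x := g x * cos x - g1 x * sin x.
Let B x := g x * sin x + g1 x * cos x.
Let H (a b x : R) := a * A x + b * B x.

Let H_polar c th x : H (c * cos th) (c * sin th) x =
  c * (g x * cos (th - x) + g1 x * sin (th - x)).
Proof. by rewrite /H /A /B cosB sinB; ring. Qed.

Let H_polar_diag c th : H (c * cos th) (c * sin th) th = c * g th.
Proof. by rewrite H_polar subrr cos0 sin0 mulr1 mulr0 addr0. Qed.

Let H_polar_le c th x : 0 <= c -> H (c * cos th) (c * sin th) x <= c * g th.
Proof. by move=> c0; rewrite H_polar ler_wpM2l// support_line. Qed.

Let A_bd x : `|A x| <= 2.
Proof.
have /andP[h1 h2] := g_bd x; have g0 : 0 <= g x by lra.
apply: (le_trans (ler_normB _ _)); rewrite !normrM.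
have e1 : `|g x| * `|cos x| <= 51 / 50 * 1 by apply: ler_pM; rewrite ?cos_max// ger0_norm.
have e2 : `|g1 x| * `|sin x| <= 1 / 40 * 1 by apply: ler_pM; rewrite ?sin_max.
lra.
Qed.

Let B_bd x : `|B x| <= 2.
Proof.
have /andP[h1 h2] := g_bd x; have g0 : 0 <= g x by lra.
apply: (le_trans (ler_normD _ _)); rewrite !normrM.
have e1 : `|g x| * `|sin x| <= 51 / 50 * 1 by apply: ler_pM; rewrite ?sin_max// ger0_norm.
have e2 : `|g1 x| * `|cos x| <= 1 / 40 * 1 by apply: ler_pM; rewrite ?cos_max.
lra.
Qed.

Let H_lip (a b a' b' x e : R) : `|a - a'| <= e -> `|b - b'| <= e ->
  H a' b' x <= H a b x + 4 * e.
Proof.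
move=> ha hb; have e0 : 0 <= e := le_trans (normr_ge0 _) ha.
have e1 : `|(a' - a) * A x| <= e * 2 by rewrite normrM distrC; apply: ler_pM.
have e2 : `|(b' - b) * B x| <= e * 2 by rewrite normrM distrC; apply: ler_pM.
have -> : H a' b' x = H a b x + ((a' - a) * A x + (b' - b) * B x) by rewrite /H; ring.
rewrite lerD2l; apply: (le_trans (ler_norm _)); apply: (le_trans (ler_normD _ _)); lra.
Qed.

Let D : set plane := [set q | forall x, H q.1 q.2 x < eps].

(** Among all the half-planes, the one tangent at the angle [th] of the point is the most
    restrictive, so one inequality decides membership. This makes the infinite intersection open. *)
Let D_polar (c th : R) : 0 <= c -> D (c * cos th, c * sin th) <-> c * g th < eps.
Proof.
move=> c0; split => [/(_ th)|h x] /=; first by rewrite H_polar_diag.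
exact: le_lt_trans (H_polar_le c th x c0) h.
Qed.

Let D_open : open D.
Proof.
rewrite openE => -[a b] Dq; have [c [th [c0 _ aE bE]]] := polar_coordinates a b.
have h : c * g th < eps by apply/(D_polar c th c0); rewrite -aE -bE.
apply/nbhs_ballP; exists ((eps - c * g th) / 8) => [|[a' b'] [/= ha hb] x /=].
  by rewrite /= divr_gt0// subr_gt0.
have := H_lip a b a' b' x ((eps - c * g th) / 8) (ltW ha) (ltW hb).
have := H_polar_le c th x c0; rewrite -aE -bE; lra.
Qed.

Let D_bounded : bounded_set D.
Proof.
exists (2 * eps); split => [|M hM [a b] Dq]; first exact: num_real.
have [c [th [c0 _ aE bE]]] := polar_coordinates a b.
have h : c * g th < eps by apply/(D_polar c th c0); rewrite -aE -bE.
have /andP[h1 h2] := g_bd th.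
have cM : c <= M by nra.
change (Num.max `|a| `|b| <= M); rewrite ge_max aE bE !normrM (ger0_norm c0).
by apply/andP; split; apply: (le_trans _ cM); rewrite ler_piMr// ?cos_max ?sin_max.
Qed.

Let D_segment (a b t : R) : 0 <= t <= 1 -> D (a, b) -> D (t * a, t * b).
Proof.
move=> /andP[t0 t1] Dq x /=; have /= := Dq x.
have -> : H (t * a) (t * b) x = t * H a b x by rewrite /H; ring.
move: (H a b x) => h he; have [h0|h0] := leP h 0.
  by apply: le_lt_trans eps0; exact: mulr_ge0_le0.
by apply: le_lt_trans he; rewrite ler_piMl// ltW.
Qed.

Let D_convex : @convex_set R plane D.
Proof.
move=> [a b] [a' b'] t; rewrite !inE => D1 D2 x.
have t0 : 0 <= t%:inum by [].
have t1 : t%:inum <= 1 by [].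
move: (D1 x) (D2 x) => /=.
change (H a b x < eps -> H a' b' x < eps ->
  H (t%:inum * a + (1 - t%:inum) * a') (t%:inum * b + (1 - t%:inum) * b') x < eps).
move: (t%:inum) t0 t1 => s s0 s1 h1 h2.
have -> : H (s * a + (1 - s) * a') (s * b + (1 - s) * b') x = s * H a b x + (1 - s) * H a' b' x.
  by rewrite /H; ring.
have [s00|sn0] := eqVneq s 0; first by rewrite s00 mul0r add0r subr0 mul1r.
have sp : 0 < s by rewrite lt_neqAle eq_sym sn0.
have e1 : s * H a b x < s * eps by rewrite ltr_pM2l.
have e2 : (1 - s) * H a' b' x <= (1 - s) * eps by apply: ler_wpM2l; [lra|exact: ltW].
lra.
Qed.

(** A point with equality is approached along its ray by shrinking [c]; a point with a strict excess
    violates the half-plane at its own angle with some margin. *)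
Let closure_polar (c th : R) : 0 <= c ->
  closure D (c * cos th, c * sin th) <-> c * g th <= eps.
Proof.
move=> c0; split => [cl|h].
  rewrite leNgt; apply/negP => h.
  have d0 : 0 < (c * g th - eps) / 8 by rewrite divr_gt0// subr_gt0.
  have [[a b] [Dq [/= ha hb]]] := cl _ (nbhsx_ballx ((c * cos th, c * sin th) : plane) _ d0).
  have {}ha : `|a - c * cos th| <= (c * g th - eps) / 8 by rewrite distrC; exact: (ltW ha).
  have {}hb : `|b - c * sin th| <= (c * g th - eps) / 8 by rewrite distrC; exact: (ltW hb).
  have := H_lip _ _ _ _ th _ ha hb; rewrite H_polar_diag; have /= := Dq th; lra.
move=> N /nbhs_ballP[e /= e0 eN].
have [c00|cn0] := eqVneq c 0.
  exists (c * cos th, c * sin th); split; last exact/eN/ballxx.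
  by apply/(D_polar c th c0); rewrite c00 mul0r.
have cp : 0 < c by rewrite lt_neqAle eq_sym cn0.
pose c' := c - Num.min c (e / 2).
have c'I : [/\ 0 <= c', c' < c & c - c' < e].
  have m1 : Num.min c (e / 2) <= c by rewrite ge_min lexx.
  have m2 : Num.min c (e / 2) <= e / 2 by rewrite ge_min lexx orbT.
  have m3 : 0 < Num.min c (e / 2) by rewrite lt_min cp divr_gt0.
  by rewrite /c'; split; lra.
have [h1 h2 h3] := c'I.
exists (c' * cos th, c' * sin th); split.
  apply/(D_polar c' th h1); apply: lt_le_trans h.
  by rewrite ltr_pM2r//; have /andP[? _] := g_bd th; lra.
have E (u : R) : `|u| <= 1 -> `|c * u - c' * u| < e.
  move=> u1; rewrite -mulrBl normrM gtr0_norm ?subr_gt0//.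
  by apply: le_lt_trans h3; rewrite ler_piMr// subr_ge0 ltW.
by apply: eN; split; [exact: (E _ (cos_max th))|exact: (E _ (sin_max th))].
Qed.

(** [D] is star-shaped about the origin, hence a union of segments through it. *)
Let D_connected : connected D.
Proof.
have -> : D = \bigcup_(q in D) ((fun t : R => (t * q.1, t * q.2) : plane) @` `[0, 1]).
  apply/seteqP; split => [[a b] Dq|_ [[a b] Dq] [t tI <-]].
    by exists (a, b) => //; exists 1; rewrite ?mul1r//= in_itv/= lexx ler01.
  by apply: D_segment => //; move: tI; rewrite /= in_itv.
apply: bigcup_connected => [|[a b] Dq].
  exists (0, 0) => -[a b] Dq; exists 0; last by rewrite /= !mul0r.
  by rewrite /= in_itv/= lexx ler01.
have seg (F : R -> plane) : continuous F -> connected (F @` `[0, 1]%classic).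
  move=> cF; apply: connected_continuous_connected; first exact: segment_connected.
  exact: continuous_subspaceT.
apply: seg => t /=.
have cm (u : R) : (fun t : R => t * u) @ t --> t * u.
  by apply: cvgM; [exact: cvg_id|exact: cvg_cst].
exact: (cvg_pair (cm a) (cm b)).
Qed.

Lemma convex_patch_near_disk : convex_patch eps r.
Proof.
exists D; split => //.
apply/seteqP; split => [[a b] [cl nD]|_ [th thI <-]] /=.
  have [c [th [c0 thI aE bE]]] := polar_coordinates a b.
  have h1 : c * g th <= eps by apply/(closure_polar c th c0); rewrite -aE -bE.
  have h2 : ~ c * g th < eps by move/(D_polar c th c0); rewrite -aE -bE.
  have e : c * g th = eps by apply/eqP; rewrite eq_le h1 leNgt; apply/negP.
  exists th => //; rewrite /curve aE bE -e /g mulfVK ?gt_eqF//.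
have c0 : 0 <= eps * r th by rewrite mulr_ge0 ?ltW.
have e : eps * r th * g th = eps by rewrite /g mulfK ?gt_eqF.
split; first by apply/(closure_polar _ th c0); rewrite e.
by move/(D_polar _ th c0); rewrite e ltxx.
Qed.

End support.

Theorem theorem1p3 (R : realType) (alpha d : R) (m k : nat) (r : R)
    (halpha1 : 1 <= alpha) (halpha2 : alpha < 2) (hd : 1 < d)
    (hm : (2 <= m)%N) (hk : (3 <= k)%N) (hr0 : 0 < r) (hr1 : r < 1) :
  exists2 eps0 : R, 0 < eps0 &
    forall eps : R, 0 < eps -> eps < eps0 ->
    forall f : R -> R, Vball alpha k r f -> continuous f ->
    let rho : R -> R := fun x => 1 + eps `^ (1 + alpha) * f x in
    (exists Omega : R, CR alpha eps d rho m Omega)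
    \/ (exists W : R, TR alpha eps d rho W) ->
    smooth rho /\ convex_patch eps rho.
Proof.
have [s s0 sP] := @sin_min R m.
(* [eps <= 1 / 400] gives [eps^(1 + alpha) * 3 <= 1 / 100], the closeness to the unit circle in C^2;
   [eps <= s / 4] separates the co-rotating patches. *)
exists (Num.min (1 / 400) (s / 4)); first by rewrite lt_min divr_gt0// divr_gt0.
move=> eps e0; rewrite lt_min => /andP[e1 e2] f Vf cf rho eqn.
(* Elements of a Sobolev space are defined up to null sets; continuity of [f] selects the
   representative equal to its cosine series at every point. *)
have [pf [f1 [f2 [df df1 bd hol]]]] := Vball_C2 alpha k r f hk halpha1 halpha2 hr1 Vf cf.
pose c := eps `^ (1 + alpha).
have c0 : 0 <= c by exact: powR_ge0.
have c1 : c <= 1 / 400.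
  apply: le_trans (ltW e1); rewrite -[leRHS]powRr1; last exact: ltW.
  by apply: ger_powR; [apply/andP; split; lra|lra].
pose p x := c * f1 x; pose p' x := c * f2 x.
have d1 x : is_derive (x : R) (1 : R) rho (p x).
  have dcf := is_deriveMr _ _ x _ _ (is_derive_cst c x 1) (df x).
  have := is_deriveDr _ _ x _ _ (is_derive_cst (1 : R) x 1) dcf.
  by rewrite mul0r !add0r.
have d2 x : is_derive (x : R) (1 : R) p (p' x).
  have := is_deriveMr _ _ x _ _ (is_derive_cst c x 1) (df1 x).
  by rewrite mul0r add0r.
have small u : `|u| <= 3 -> `|c * u| <= 1 / 100.
  by move=> u3; rewrite normrM ger0_norm// (le_trans (ler_pM c0 (normr_ge0 u) c1 u3))//; lra.
have rbd x : `|rho x - 1| <= 1 / 100.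
  by rewrite /rho addrC addKr; apply: small; have [] := bd x.
have pbd x : `|p x| <= 1 / 100 by apply: small; have [] := bd x.
have pbd' x : `|p' x| <= 1 / 100 by apply: small; have [] := bd x.
have per : periodic rho (2 * pi) by move=> x; rewrite /rho pf.
split; last exact: (convex_patch_near_disk rho p p').
have rI x : 1 / 2 <= rho x <= 2.
  by have := rbd x; rewrite ler_norml => /andP[? ?]; apply/andP; split; lra.
have pI x : `|p x| <= 1 / 4 by apply: (le_trans (pbd x)); lra.
have cp : continuous p := is_derive_continuous p p' d2.
have C0 := @Calpha_gt0 R alpha halpha1 halpha2.
have e4 : 4 * eps <= s by lra.
have e41 : 4 * eps <= 1 by lra.
have [G [c' [cn YG E]]] : exists (G : R -> R) (c1 : R),
    [/\ c1 != 0, forall P n, Ycls P n (fun x _ => p x) -> Ycls P n (fun x _ => G x) &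
      forall x, G x + c1 * self_integral alpha rho x = 0].
  case: eqn => [[Om eqn]|[W eqn]].
    exact: (CR_equation alpha rho p d1 rI pI cp eps d e0 hd m Om s).
  exact: (TR_equation alpha rho p d1 rI pI cp eps d e0 hd W).
(* This [b] is the midpoint of [alpha - 1] and [alpha / 2]; for [1 <= alpha < 2] it exceeds the
   former and stays below 1. *)
pose b := cos_exponent alpha.
have b1 : alpha - 1 < b by rewrite /b /cos_exponent; lra.
have b2 : b <= 1 by rewrite /b /cos_exponent; lra.
have b0 : 0 <= b by rewrite /b /cos_exponent; lra.
have pp' : periodic p' (2 * pi).
  have p1 := periodic_derive rho p d1 per; exact: (periodic_derive p p' d2 p1).
(* The factor [2 ^ b] comes from the reduced angle, which is at most twice the chord. *)
have hol' x t : 0 < t < 2 * pi -> `|p' x - p' (x - t)| <= c * 6 * 2 `^ b * chord t `^ b.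
  move=> tI; have [u [uc _ uE]] := reduced_angle t tI.
  have ch0 : 0 <= chord t by exact: ltW (chord_gt0 t tI).
  rewrite uE// /p' -mulrBr normrM ger0_norm// -!mulrA; apply: ler_wpM2l => //.
  rewrite -powRM//; rewrite -[x in f2 x - _](subrK u).
  apply: le_trans (hol (x - u) u) _; apply: ler_wpM2l => //.
  by apply: ge0_ler_powR; rewrite ?nnegrE// mulr_ge0.
have H0 : 0 <= c * 6 * 2 `^ b by rewrite !mulr_ge0 ?powR_ge0.
have Yp := contour_regularity alpha rho p halpha1 halpha2 d1 per rI pI cp p' b _ G c' d2
  (ex_intro _ _ pbd') b1 b2 H0 hol' YG cn E.
apply: lipcls_smooth => n; apply: (Ycls_le _ n n.+1); first exact: leqnSn.
apply: (Ycls_primitive _ n rho p 2 d1 _ (Yp n)) => x.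
by have /andP[? ?] := rI x; rewrite ger0_norm//; lra.
Qed.
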